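(* Let $\{\alpha_k\}_k$ be any of the natural sequences of symmetric tensor norms. Then the sequences $\{\mathfrak A^{max}_k\}_k$ and $\{\mathfrak A^{min}_k\}_k$ of maximal and minimal polynomial ideals associated to $\{\alpha_k\}_k$ are multiplicative.
   Context: All Banach spaces are complex. $\mathcal P^k(E)$ is the Banach space of continuous $k$-homogeneous polynomials $E\to\mathbb C$; $\check P$ is the symmetric $k$-linear form of $P\in\mathcal P^k(E)$, and for $a\in E$, $P_a(x)=\check P(a,x,\dots,x)$. A Banach ideal of (scalar valued continuous) $k$-homogeneous polynomials is a pair $(\mathfrak A_k,\|\cdot\|_{\mathfrak A_k})$ such that: (i) for every Banach space $E$, $\mathfrak A_k(E)=\mathfrak A_k\cap\mathcal P^k(E)$ is a linear subspace of $\mathcal P^k(E)$ and $(\mathfrak A_k(E),\|\cdot\|_{\mathfrak A_k(E)})$ is a Banach space; (ii) if $T\in\mathcal L(E_1,E)$ and $P\in\mathfrak A_k(E)$ then $P\circ T\in\mathfrak A_k(E_1)$ and $\|P\circ T\|_{\mathfrak A_k(E_1)}\le\|P\|_{\mathfrak A_k(E)}\|T\|^k$; (iii) $z\mapsto z^k$ belongs to $\mathfrak A_k(\mathbb C)$ and has norm 1. A sequence $\{\mathfrak A_k\}_{k\ge1}$ of such ideals is coherent if there are constants $C,D>0$ such that for every Banach space $E$ and $k\in\mathbb N$: $P\in\mathfrak A_{k+1}(E)$, $a\in E$ imply $P_a\in\mathfrak A_k(E)$ and $\|P_a\|_{\mathfrak A_k(E)}\le C\|P\|_{\mathfrak A_{k+1}(E)}\|a\|$;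 and $P\in\mathfrak A_k(E)$, $\gamma\in E'$ imply $\gamma P\in\mathfrak A_{k+1}(E)$ and $\|\gamma P\|_{\mathfrak A_{k+1}(E)}\le D\|\gamma\|\|P\|_{\mathfrak A_k(E)}$. It is multiplicative if it is coherent and there is a constant $M$ such that for all $k,l$, every Banach space $E$, $P\in\mathfrak A_k(E)$, $Q\in\mathfrak A_l(E)$, one has $PQ\in\mathfrak A_{k+l}(E)$ and $\|PQ\|_{\mathfrak A_{k+l}(E)}\le M^{k+l}\|P\|_{\mathfrak A_k(E)}\|Q\|_{\mathfrak A_l(E)}$. $\otimes^{k,s}E$ is the $k$-fold symmetric tensor product (the span of the tensors $x\otimes\cdots\otimes x$ in $\otimes^kE$). A $k$-fold symmetric tensor norm $\alpha_k$ assigns to each normed space $E$ a norm on $\otimes^{k,s}E$ such that $\alpha_k(1\otimes\cdots\otimes1)=1$ on $\otimes^{k,s}\mathbb C$ and the metric mapping property holds: $\|\otimes^kT\|\le\|T\|^k$ for $T\in\mathcal L(E,F)$. It is finitely generated if $\alpha_k(s,\otimes^{k,s}E)=\inf\{\alpha_k(s,\otimes^{k,s}N):N\subset E \text{ finite dimensional},\ s\in\otimes^{k,s}N\}$. $\pi_k$ and $\varepsilon_k$ are the projective and injective symmetric tensor norms: $\pi_k$ is the largest symmetric tensor norm (dual to the supremum norm of $k$-homogeneous polynomials on the unit ball), and $\varepsilon_k(\sum_i\lambda_i\,x_i\otimes\cdots\otimes x_i)=\sup_{\gamma\in B_{E'}}|\sum_i\lambda_i\gamma(x_i)^k|$. For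 a symmetric tensor norm $\beta_k$, the projective associate $\backslash\beta_k/$ and the injective associate $/\beta_k\backslash$ are the tensor norms determined, for Banach spaces $E$, by making $(\otimes^{k,s}\ell_1(B_E),\beta_k)\to(\otimes^{k,s}E,\backslash\beta_k/)$ a metric quotient map (induced by the canonical quotient $\ell_1(B_E)\to E$) and $(\otimes^{k,s}E,/\beta_k\backslash)\to(\otimes^{k,s}\ell_\infty(B_{E'}),\beta_k)$ an isometric embedding (induced by the canonical isometry $E\to\ell_\infty(B_{E'})$). The natural sequences are the six sequences $\{\alpha_k\}_k$ where, for all $k$, $\alpha_k$ is, respectively, $\pi_k$, $\varepsilon_k$, $/\pi_k\backslash$, $\backslash\varepsilon_k/$, $\backslash(/\pi_k\backslash)/$, $/(\backslash\varepsilon_k/)\backslash$. A polynomial ideal $\mathfrak A_k$ is associated to the finitely generated $\alpha_k$ if $\mathfrak A_k(N)=(\otimes^{k,s}N',\alpha_k)$ isometrically for every finite dimensional normed space $N$ (identifying $\gamma\otimes\cdots\otimes\gamma$ with $\gamma^k$). The maximal associated ideal is $\mathfrak A_k^{max}(E)=\{P\in\mathcal P^k(E):\|P\|_{\mathfrak A_k^{max}(E)}=\sup_N\|P|_N\|_{(\otimes^{k,s}N',\alpha_k)}<\infty\}$, supremum over finite dimensional subspaces $N\subset E$. The minimal associated ideal is $\mathfrak A_k^{min}=\mathfrak A_k^{max}\circ\overline{\mathcal F}$, with $\overline{\mathcal F}$ the ideal of approximable operators (operator norm closure of finite rank operators): $P\in\mathfrak A_k^{min}(E)$ iff $P=Q\circ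 T$ with $T\in\overline{\mathcal F}(E,E_1)$, $Q\in\mathfrak A_k^{max}(E_1)$, with norm $\inf\|Q\|_{\mathfrak A_k^{max}(E_1)}\|T\|^k$ over all such factorizations. *)

(* Defs.v *)
From HB Require Import structures.
From mathcomp Require Import all_boot all_order all_algebra perm finmap complex.
From mathcomp Require Import boolp classical_sets functions cardinality fsbigop reals.
From mathcomp Require Import ereal interval_inference topology normedtype sequences esum.
From mathcomp Require summability.
Set Implicit Arguments.
Unset Strict Implicit.
Unset Printing Implicit Defensive.
Import Order.TTheory GRing.Theory Num.Theory.
Import numFieldNormedType.Exports.
Local Open Scope classical_set_scope.
Local Open Scope ring_scope.
Local Open Scope complex_scope.

(* A complex Banach space is a [completeNormedModType R[i]]; its norm takes
   values in [R[i]], and [rnorm] is the same number as an element of [R]. *)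
HB.instance Definition _ (R : realType) := NormedModule.copy R[i] R[i]^o.

Definition rnorm {R : realType} {V : normedModType R[i]} (x : V) : R :=
  complex.Re `|x|.

Section RealNorm.
Context {R : realType} {V : normedModType R[i]}.
Implicit Types x y : V.

Lemma rnormE x : (rnorm x)%:C = `|x|.
Proof. by rewrite /rnorm RRe_real// normr_real. Qed.

Lemma rnorm_ge0 x : 0 <= rnorm x.
Proof. by rewrite -ler0c rnormE. Qed.

Lemma rnorm_le x (r : R) : (rnorm x <= r) = (`|x| <= r%:C).
Proof. by rewrite -rnormE lecR. Qed.

Lemma rnorm_lt x (r : R) : (rnorm x < r) = (`|x| < r%:C).
Proof. by rewrite -rnormE ltcR. Qed.

Lemma rnorm_ext x (r : R) : `|x| = r%:C -> rnorm x = r.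
Proof. by rewrite -rnormE => /complexI. Qed.

Lemma rnormD x y : rnorm (x + y) <= rnorm x + rnorm y.
Proof. by rewrite -lecR rmorphD/= !rnormE ler_normD. Qed.

Lemma rnormZ (a : R[i]) x : rnorm (a *: x) = rnorm a * rnorm x.
Proof. by apply: complexI; rewrite rmorphM/= !rnormE normrZ. Qed.

Lemma rnorm0 : rnorm (0 : V) = 0.
Proof. by apply: complexI; rewrite rnormE normr0. Qed.

Lemma rnorm0_eq0 x : rnorm x = 0 -> x = 0.
Proof. by move=> h; apply: normr0_eq0; rewrite -rnormE h. Qed.

Lemma rnormN x : rnorm (- x) = rnorm x.
Proof. by apply: complexI; rewrite !rnormE normrN. Qed.

Lemma rnormB x y : rnorm (x - y) = rnorm (y - x).
Proof. by rewrite -rnormN opprB. Qed.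

Lemma cvg_rnormP T (F : set_system T) {FF : Filter F} (f : T -> V) (l : V) :
  f @ F --> l <-> forall e : R, 0 < e -> \forall v \near F, rnorm (l - f v) < e.
Proof.
split=> [/cvgrPdist_lt fl e e0|fl].
  have e0' : 0 < e%:C by rewrite ltcR.
  by apply: filterS (fl _ e0') => v; rewrite rnorm_lt.
apply/cvgrPdist_lt => e e0.
have eE : e = (complex.Re e)%:C by rewrite RRe_real// gtr0_real.
have : 0 < complex.Re e by rewrite -ltcR -eE.
by move=> /fl; apply: filterS => v; rewrite rnorm_lt -eE.
Qed.

Lemma cvg_rnorm T (F : set_system T) {FF : Filter F} (f : T -> V) (l : V) :
  f @ F --> l -> (fun v => rnorm (f v)) @ F --> rnorm l.
Proof.
move=> /cvg_rnormP fl; apply/cvgrPdist_lt => e e0.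
apply: filterS (fl _ e0) => v; apply: le_lt_trans.
rewrite ler_norml; apply/andP; split.
  rewrite lerBrDr addrC lerBlDl -[leLHS]rnormN.
  by rewrite -[X in rnorm X](_ : l - f v - l = _) ?(le_trans (rnormD _ _))// ?rnormN// addrAC subrr sub0r.
by rewrite lerBlDr -[in leLHS](subrK (f v) l) rnormD.
Qed.

Lemma cauchy_rnormP (F : set_system V) {FF : ProperFilter F} :
  cauchy F <-> forall e : R, 0 < e -> exists v0, F [set v | rnorm (v - v0) < e].
Proof.
split=> [/cauchyP Fc e e0|Fc].
  have e0' : 0 < e%:C by rewrite ltcR.
  have [v0 h] := Fc _ e0'; exists v0; apply: filterS h => v.
  by rewrite -ball_normE/= rnormB rnorm_lt.
apply/cauchyP => e e0.
have eE : e = (complex.Re e)%:C by rewrite RRe_real// gtr0_real.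
have : 0 < complex.Re e by rewrite -ltcR -eE.
move=> /Fc[v0 h]; exists v0; apply: filterS h => v /=.
by rewrite -ball_normE/= rnormB rnorm_lt -eE.
Qed.

End RealNorm.

Section Scalars.
Variable R : realType.

Lemma rnorm_abs (x : R) : rnorm (x%:C : R[i]) = `|x|.
Proof. by apply: rnorm_ext; rewrite normc_def/= expr0n/= addr0 sqrtr_sqr. Qed.

Lemma rnorm_scalarM (a b : R[i]) : rnorm (a * b) = rnorm a * rnorm b.
Proof. exact: rnormZ. Qed.

Lemma rnorm_geRe (z : R[i]) : `|complex.Re z| <= rnorm z.
Proof. by rewrite -lecR rnormE normc_ge_Re. Qed.

Lemma rnorm_geIm (z : R[i]) : `|complex.Im z| <= rnorm z.
Proof.
rewrite -lecR rnormE normc_def lecR -sqrtr_sqr ler_sqrt ?addr_ge0 ?sqr_ge0//.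
by rewrite lerDr sqr_ge0.
Qed.

Lemma rnorm_leReIm (z : R[i]) : rnorm z <= `|complex.Re z| + `|complex.Im z|.
Proof.
have n0 : 0 <= `|complex.Re z| + `|complex.Im z| by rewrite addr_ge0.
rewrite -lecR rnormE normc_def lecR.
rewrite -(ger0_norm n0) -sqrtr_sqr ler_sqrt ?sqr_ge0//.
rewrite sqrrD !real_normK ?num_real// lerD2r lerDl mulrn_wge0// mulr_ge0.
Qed.

Lemma ReB (z w : R[i]) : complex.Re (z - w) = complex.Re z - complex.Re w.
Proof. by case: z w => [? ?] []. Qed.

Lemma ImB (z w : R[i]) : complex.Im (z - w) = complex.Im z - complex.Im w.
Proof. by case: z w => [? ?] []. Qed.

Lemma complex_complete (F : set_system R[i]) :
  ProperFilter F -> cauchy F -> cvg F.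
Proof.
move=> FF /cauchy_rnormP Fc.
have cR : cvg ((@complex.Re R) @ F).
  apply: R_complete; apply/cauchyP => e /Fc[v0 h].
  exists (complex.Re v0).
  change (F (@complex.Re R @^-1` ball (complex.Re v0) e)).
  apply: filterS h => v /= h.
  rewrite /ball/= distrC  -ReB; apply: le_lt_trans h.
  exact: rnorm_geRe.
have cI : cvg ((@complex.Im R) @ F).
  apply: R_complete; apply/cauchyP => e /Fc[v0 h].
  exists (complex.Im v0).
  change (F (@complex.Im R @^-1` ball (complex.Im v0) e)).
  apply: filterS h => v /= h.
  rewrite /ball/= distrC -ImB; apply: le_lt_trans h.
  exact: rnorm_geIm.
apply/cvg_ex; exists (Complex (lim ((@complex.Re R) @ F)) (lim (@complex.Im R @ F))).
apply/(@cvg_rnormP R R[i] _ F _ id) => e e0.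
have e20 : 0 < e / 2 by rewrite divr_gt0.
move/cvgrPdist_lt : cR => /(_ _ e20) hR; move/cvgrPdist_lt : cI => /(_ _ e20) hI.
apply: filterS2 hR hI => v hR hI; set l := Complex _ _.
apply: le_lt_trans (rnorm_leReIm (l - (v : R[i]))) _.
by rewrite ReB ImB (splitr e) ltrD.
Qed.

HB.instance Definition _ := Uniform_isComplete.Build R[i] complex_complete.

End Scalars.

(* Completeness of a space of functions whose closed balls are closed under
   pointwise limits; used for L(E, F), l_oo(I) and l_1(I). *)
Lemma complete_by_evaluation (R : realType) (V : normedModType R[i])
    (W : completeNormedModType R[i]) (X : Type) (ev : X -> V -> W) :
  (forall x v w, ev x (v - w) = ev x v - ev x w) ->
  (forall x, exists M : R, forall v, rnorm (ev x v) <= M * rnorm v) ->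
  (forall v w, (forall x, ev x v = ev x w) -> v = w) ->
  (forall (F : set_system V) (g : X -> W), ProperFilter F ->
     (forall x, ev x @ F --> g x) -> forall v0 (r : R),
     F [set v | rnorm (v - v0) <= r] ->
     exists v, (forall x, ev x v = g x) /\ rnorm (v - v0) <= r) ->
  forall F : set_system V, ProperFilter F -> cauchy F -> cvg F.
Proof.
move=> evB evM evI evC F FF Fc; have Fc' := (@cauchy_rnormP R V F FF).1 Fc.
have cev x : cvg (ev x @ F).
  apply: cauchy_cvg; apply/cauchy_rnormP => e e0.
  have [M HM] := evM x.
  have M0 : 0 < Num.max 1 M by rewrite lt_max ltr01.
  have /Fc'[v0 h] : 0 < e / Num.max 1 M by rewrite divr_gt0.
  exists (ev x v0).
  change (F (ev x @^-1` [set z | rnorm (z - ev x v0) < e])).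
  apply: filterS h => v /= h.
  rewrite -evB; apply: le_lt_trans (HM _) _.
  apply: (@le_lt_trans _ _ (Num.max 1 M * rnorm (v - v0))).
    by rewrite ler_wpM2r ?rnorm_ge0// le_max lexx orbT.
  by rewrite mulrC -ltr_pdivlMr.
pose g x := lim (ev x @ F).
have cg x : ev x @ F --> g x by exact: cev.
have [v1 Fv1] := Fc' 1 ltr01.
have Fv1' : F [set v | rnorm (v - v1) <= 1] by apply: filterS Fv1 => v /ltW.
have [l [lg _]] := evC F g FF cg v1 1 Fv1'.
apply/cvg_ex; exists l; apply/(@cvg_rnormP R V _ F _ id) => e e0.
have /Fc'[v0 Fv0] : 0 < e / 2 by rewrite divr_gt0.
have Fv0' : F [set v | rnorm (v - v0) <= e / 2] by apply: filterS Fv0 => v /ltW.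
have [l' [l'g l'v]] := evC F g FF cg v0 _ Fv0'.
have ll' : l = l' by apply: evI => x; rewrite lg l'g.
apply: filterS Fv0 => v hv /=.
rewrite -(subrK v0 l) -addrA; apply: le_lt_trans (rnormD _ _) _.
by rewrite (splitr e) ler_ltD// ?ll'// rnormB.
Qed.

Lemma sup_le_nneg (R : realType) (A : set R) (M : R) :
  0 <= M -> ubound A M -> sup A <= M.
Proof.
move=> M0 AM; have [->|/set0P A0] := eqVneq A set0; first by rewrite sup0.
exact: ge_sup.
Qed.

Lemma real_homogeneous (R : realType) (V : lmodType R[i]) (N : V -> R) :
  (forall (a : R[i]) x, N (a *: x) <= rnorm a * N x) -> (forall x, 0 <= N x) ->
  forall (a : R[i]) x, N (a *: x) = rnorm a * N x.
Proof.
move=> le N0 a x; apply/eqP; rewrite eq_le le/=.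
have [->|a0] := eqVneq a 0; first by rewrite rnorm0 mul0r N0.
have na0 : 0 < rnorm a.
  by rewrite lt_def rnorm_ge0 andbT; apply: contra_neq a0 => /rnorm0_eq0.
rewrite -ler_pdivlMl//; have {1}-> : x = a^-1 *: (a *: x).
  by rewrite scalerA mulVf// scale1r.
have -> : (rnorm a)^-1 = rnorm a^-1.
  by apply: complexI; rewrite rnormE normfV -rnormE fmorphV.
exact: le.
Qed.

Section BoundedOperators.
Context {R : realType}.
Variables E F : normedModType R[i].

Definition bounded_operator : {pred E -> F} :=
  [pred f | `[< linear f /\ continuous f >]].

Lemma bounded_operator_submod_closed : submod_closed bounded_operator.
Proof.
split=> [|a f g]; rewrite !inE.
  split=> [c x y|]; first by rewrite scaler0 addr0.
  exact: cst_continuous.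
move=> [fl fc] [gl gc]; split=> [c x y|].
  have fgE z : (a *: f + g) z = a *: f z + g z by [].
  by rewrite !fgE fl gl !scalerDr !scalerA (mulrC a) addrACA.
move=> x; apply: cvgD; last exact: gc.
by apply: cvgZr; exact: fc.
Qed.

HB.instance Definition _ :=
  GRing.isSubmodClosed.Build R[i] (E -> F) bounded_operator
    bounded_operator_submod_closed.

(* L(E, F), with the operator norm. *)
Record blin := BLin { blin_fun :> E -> F ; _ : blin_fun \in bounded_operator }.

HB.instance Definition _ := [isSub for blin_fun].
HB.instance Definition _ := [Choice of blin by <:].
HB.instance Definition _ := [SubChoice_isSubLmodule of blin by <:].

Lemma blin_linear (T : blin) : linear T.
Proof. by have /asboolP[] := valP T. Qed.

Lemma blin_continuous (T : blin) : continuous T.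
Proof. by have /asboolP[] := valP T. Qed.

HB.instance Definition _ (T : blin) :=
  GRing.isLinear.Build R[i] E F *:%R (blin_fun T) (blin_linear T).

Definition opnorm (T : blin) : R :=
  sup [set rnorm (T x) | x in [set x : E | `|x| <= 1]].

Lemma blin_bounded (T : blin) :
  exists2 M : R, 0 < M & forall x, rnorm (T x) <= M * rnorm x.
Proof.
have /linear_boundedP := continuous_linear_bounded 0 (@blin_continuous T 0).
move=> /pinfty_ex_gt0[M M0 TM].
have ME : M = (complex.Re M)%:C by rewrite RRe_real// gtr0_real.
exists (complex.Re M); first by rewrite -ltcR -ME.
by move=> x; rewrite -lecR rmorphM/= !rnormE -ME TM.
Qed.

Lemma opnorm_has_ubound (T : blin) :
  has_ubound [set rnorm (T x) | x in [set x : E | `|x| <= 1]].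
Proof.
have [M M0 TM] := blin_bounded T; exists M => _ [x x1 <-].
apply: le_trans (TM x) _; rewrite ger_pMr//.
by rewrite rnorm_le.
Qed.

Lemma opnorm_ge0 (T : blin) : 0 <= opnorm T.
Proof.
apply: ub_le_sup; first exact: opnorm_has_ubound.
by exists 0; rewrite /= ?normr0 ?ler01// linear0 rnorm0.
Qed.

Lemma le_opnorm (T : blin) x : rnorm (T x) <= opnorm T * rnorm x.
Proof.
have [->|x0] := eqVneq x 0; first by rewrite linear0 !rnorm0 mulr0.
have n0 : 0 < rnorm x.
  by rewrite lt_def rnorm_ge0 andbT; apply: contra_neq x0 => /rnorm0_eq0.
rewrite -ler_pdivrMr//.
have -> : rnorm (T x) / rnorm x = rnorm (T ((rnorm x)^-1%:C *: x)).
  by rewrite linearZ rnormZ rnorm_abs ger0_norm ?invr_ge0 ?rnorm_ge0// mulrC.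
apply: ub_le_sup; first exact: opnorm_has_ubound.
exists ((rnorm x)^-1%:C *: x) => //=.
rewrite -[leRHS]/(1%:C) -rnorm_le rnormZ rnorm_abs.
by rewrite ger0_norm ?invr_ge0 ?rnorm_ge0// mulVf ?gt_eqF.
Qed.

Lemma opnorm_le (T : blin) (M : R) :
  0 <= M -> (forall x, rnorm (T x) <= M * rnorm x) -> opnorm T <= M.
Proof.
move=> M0 TM; apply: sup_le_nneg => // _ [x x1 <-].
by apply: le_trans (TM x) _; rewrite ler_piMr// rnorm_le.
Qed.

Lemma opnormD (S T : blin) : (opnorm (S + T))%:C <= (opnorm S)%:C + (opnorm T)%:C.
Proof.
rewrite -rmorphD lecR; apply: opnorm_le => [|x].
  by rewrite addr_ge0 ?opnorm_ge0.
by rewrite mulrDl (le_trans (rnormD _ _))// lerD ?le_opnorm.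
Qed.

Lemma opnormZ (a : R[i]) (T : blin) : (opnorm (a *: T))%:C = `|a| * (opnorm T)%:C.
Proof.
rewrite -rnormE -rmorphM/=; congr (_ %:C).
have le b S : opnorm (b *: S) <= rnorm b * opnorm S.
  apply: opnorm_le => [|x]; first by rewrite mulr_ge0 ?opnorm_ge0 ?rnorm_ge0.
  by rewrite [X in rnorm X](_ : _ = b *: S x)// rnormZ -mulrA ler_wpM2l
    ?rnorm_ge0 ?le_opnorm.
exact: real_homogeneous le opnorm_ge0 a T.
Qed.

Lemma opnorm0_eq0 (T : blin) : (opnorm T)%:C = 0 -> T = 0.
Proof.
move=> /complexI T0; apply/val_inj/funext => x /=; apply: rnorm0_eq0.
by apply/eqP; rewrite eq_le rnorm_ge0 andbT (le_trans (le_opnorm _ _))// T0 mul0r.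
Qed.

HB.instance Definition _ :=
  Lmodule_isNormed.Build R[i] blin opnormD opnormZ opnorm0_eq0.

Lemma blin_rnormE (T : blin) : rnorm T = opnorm T.
Proof. exact: rnorm_ext. Qed.

End BoundedOperators.

Section OperatorsComplete.
Variables (R : realType) (E : normedModType R[i]).
Variable F : completeNormedModType R[i].

Lemma blin_complete (G : set_system (blin E F)) :
  ProperFilter G -> cauchy G -> cvg G.
Proof.
move: G; apply: (@complete_by_evaluation R (blin E F) F E (fun x T => T x)).
- by [].
- by move=> x; exists (rnorm x) => T; rewrite mulrC blin_rnormE le_opnorm.
- by move=> S T ST; apply/val_inj/funext.
move=> G g GG Gg T0 r Gr.
have r0 : 0 <= r.
  by have [T /= Tr] := filter_ex Gr; apply: le_trans Tr; exact: rnorm_ge0.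
have gl : linear g.
  move=> a x y; apply: (cvg_unique (@norm_hausdorff _ F) (Gg _)).
  rewrite (_ : (fun T : blin E F => T (a *: x + y)) = (fun T => a *: T x + T y)).
    by apply: cvgD; [apply: cvgZr; exact: Gg|exact: Gg].
  by apply/funext => T; rewrite linearP.
have gr x : rnorm (g x - T0 x) <= r * rnorm x.
  have cT : (fun T : blin E F => rnorm (T x - T0 x)) @ G --> rnorm (g x - T0 x).
    by apply: cvg_rnorm; apply: cvgB; [exact: Gg|exact: cvg_cst].
  rewrite -(cvg_lim (@Rhausdorff R) cT); apply: limr_le.
    by apply/cvg_ex; eexists; exact: cT.
  apply: filterS Gr => T /= Tr.
  rewrite -[T x - T0 x]/((T - T0) x) (le_trans (le_opnorm _ _))//.
  by rewrite ler_wpM2r ?rnorm_ge0// -blin_rnormE.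
have gc : continuous g.
  move=> x; apply/cvg_rnormP => e e0.
  have [M M0 T0M] := blin_bounded T0.
  have /(cvg_rnormP (F := nbhs x) id x).1 : y @[y --> x] --> x by exact: cvg_id.
  move=> /(_ (e / (r + M))); rewrite divr_gt0 ?ltr_wpDl// => /(_ isT).
  apply: filterS => y xy.
  have -> : g x - g y = g (x - y).
    have := gl 1 (x - y) y; rewrite !scale1r subrK => ->.
    by rewrite addrK.
  rewrite -(subrK (T0 (x - y)) (g (x - y))).
  apply: le_lt_trans (rnormD _ _) _.
  apply: (@le_lt_trans _ _ ((r + M) * rnorm (x - y))).
    by rewrite mulrDl lerD ?gr ?T0M.
  by rewrite mulrC -ltr_pdivlMr// ltr_wpDl.
have gP : g \in @bounded_operator R E F by rewrite !inE.
exists (BLin gP); split=> //.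
rewrite blin_rnormE; apply: opnorm_le => // x; exact: gr.
Qed.

HB.instance Definition _ := Uniform_isComplete.Build (blin E F) blin_complete.

End OperatorsComplete.

Section BoundedFamilies.
Variables (R : realType) (I : Type).

Definition bounded_family : {pred I -> R[i]} :=
  [pred f | `[< exists M : R, forall i, rnorm (f i) <= M >]].

Lemma bounded_family_submod_closed : submod_closed bounded_family.
Proof.
split=> [|a f g]; rewrite !inE.
  by exists 0 => i; rewrite rnorm0.
move=> [M fM] [N gN]; exists (rnorm a * M + N) => i.
apply: le_trans (rnormD _ _) _; rewrite lerD//.
by rewrite rnormZ ler_wpM2l ?rnorm_ge0.
Qed.

HB.instance Definition _ :=
  GRing.isSubmodClosed.Build R[i] (I -> R[i]) bounded_family
    bounded_family_submod_closed.

(* l_oo(I), with the supremum norm. *)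
Record linf := Linf { linf_fun :> I -> R[i] ; _ : linf_fun \in bounded_family }.

HB.instance Definition _ := [isSub for linf_fun].
HB.instance Definition _ := [Choice of linf by <:].
HB.instance Definition _ := [SubChoice_isSubLmodule of linf by <:].

Definition linf_norm (f : linf) : R := sup [set rnorm (f i) | i in [set: I]].

Lemma linf_has_ubound (f : linf) : has_ubound [set rnorm (f i) | i in [set: I]].
Proof. by have /asboolP[M fM] := valP f; exists M => _ [i _ <-]. Qed.

Lemma le_linf_norm (f : linf) i : rnorm (f i) <= linf_norm f.
Proof. by apply: ub_le_sup; [exact: linf_has_ubound|exists i]. Qed.

Lemma linf_norm_ge0 (f : linf) : 0 <= linf_norm f.
Proof.
rewrite /linf_norm; have [->|/set0P[r [i _ fi]]] :=
  eqVneq [set rnorm (f i) | i in [set: I]] set0; first by rewrite sup0.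
by rewrite (le_trans (rnorm_ge0 (f i)))// le_linf_norm.
Qed.

Lemma linf_norm_le (f : linf) (M : R) :
  0 <= M -> (forall i, rnorm (f i) <= M) -> linf_norm f <= M.
Proof. by move=> M0 fM; apply: sup_le_nneg => // _ [i _ <-]. Qed.

Lemma linf_normD (f g : linf) :
  (linf_norm (f + g))%:C <= (linf_norm f)%:C + (linf_norm g)%:C.
Proof.
rewrite -rmorphD lecR; apply: linf_norm_le => [|i].
  by rewrite addr_ge0 ?linf_norm_ge0.
by rewrite (le_trans (rnormD _ _))// lerD ?le_linf_norm.
Qed.

Lemma linf_normZ (a : R[i]) (f : linf) :
  (linf_norm (a *: f))%:C = `|a| * (linf_norm f)%:C.
Proof.
rewrite -rnormE -rmorphM/=; congr (_ %:C).
have le b g : linf_norm (b *: g) <= rnorm b * linf_norm g.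
  apply: linf_norm_le => [|i]; first by rewrite mulr_ge0 ?linf_norm_ge0 ?rnorm_ge0.
  by rewrite rnormZ ler_wpM2l ?rnorm_ge0 ?le_linf_norm.
exact: real_homogeneous le linf_norm_ge0 a f.
Qed.

Lemma linf_norm0_eq0 (f : linf) : (linf_norm f)%:C = 0 -> f = 0.
Proof.
move=> /complexI f0; apply/val_inj/funext => i /=; apply: rnorm0_eq0.
by apply/eqP; rewrite eq_le rnorm_ge0 andbT (le_trans (le_linf_norm _ _))// f0.
Qed.

HB.instance Definition _ :=
  Lmodule_isNormed.Build R[i] linf linf_normD linf_normZ linf_norm0_eq0.

Lemma linf_rnormE (f : linf) : rnorm f = linf_norm f.
Proof. exact: rnorm_ext. Qed.

Lemma linf_complete (G : set_system linf) :
  ProperFilter G -> cauchy G -> cvg G.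
Proof.
move: G; apply: (@complete_by_evaluation R linf R[i] I (fun i f => f i)).
- by [].
- by move=> i; exists 1 => f; rewrite mul1r linf_rnormE le_linf_norm.
- by move=> f g fg; apply/val_inj/funext.
move=> G g GG Gg f0 r Gr.
have r0 : 0 <= r.
  by have [f /= fr] := filter_ex Gr; apply: le_trans fr; exact: rnorm_ge0.
have gr i : rnorm (g i - f0 i) <= r.
  have cT : (fun f : linf => rnorm (f i - f0 i)) @ G --> rnorm (g i - f0 i).
    by apply: cvg_rnorm; apply: cvgB; [exact: Gg|exact: cvg_cst].
  rewrite -(cvg_lim (@Rhausdorff R) cT); apply: limr_le.
    by apply/cvg_ex; eexists; exact: cT.
  apply: filterS Gr => f /= fr.
  by rewrite -[f i - f0 i]/((f - f0) i) (le_trans (le_linf_norm _ _))// -linf_rnormE.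
have gP : g \in bounded_family.
  rewrite !inE; exists (r + linf_norm f0) => i.
  rewrite -(subrK (f0 i) (g i)) (le_trans (rnormD _ _))// lerD//.
  exact: le_linf_norm.
exists (Linf gP); split=> //.
rewrite linf_rnormE; apply: linf_norm_le => // i; exact: gr.
Qed.

HB.instance Definition _ := Uniform_isComplete.Build linf linf_complete.

End BoundedFamilies.

Section SummableFamilies.
Variables (R : realType) (I : choiceType).

Definition l1_sums (f : I -> R[i]) : set R :=
  [set \sum_(i <- A) rnorm (f i) | A in [set: {fset I}]].

Definition summable_family : {pred I -> R[i]} :=
  [pred f | `[< has_ubound (l1_sums f) >]].

Lemma summable_family_submod_closed : submod_closed summable_family.
Proof.
split=> [|a f g]; rewrite !inE.
  by exists 0 => _ [A _ <-]; rewrite big1// => i _; rewrite rnorm0.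
move=> [M fM] [N gN]; exists (rnorm a * M + N) => _ [A _ <-].
apply: (@le_trans _ _ (\sum_(i <- A) (rnorm a * rnorm (f i) + rnorm (g i)))).
  apply: ler_sum => i _; apply: le_trans (rnormD _ _) _; rewrite lerD//.
  by rewrite rnormZ.
rewrite big_split/= -mulr_sumr lerD//; last by apply: gN; exists A.
by rewrite ler_wpM2l ?rnorm_ge0//; apply: fM; exists A.
Qed.

HB.instance Definition _ :=
  GRing.isSubmodClosed.Build R[i] (I -> R[i]) summable_family
    summable_family_submod_closed.

(* l_1(I) for an arbitrary, possibly uncountable, index set I: the norm is the
   supremum of the sums over finite subsets. *)
Record l1 := L1 { l1_fun :> I -> R[i] ; _ : l1_fun \in summable_family }.

HB.instance Definition _ := [isSub for l1_fun].
HB.instance Definition _ := [Choice of l1 by <:].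
HB.instance Definition _ := [SubChoice_isSubLmodule of l1 by <:].

Definition l1_norm (f : l1) : R := sup (l1_sums f).

Lemma l1_has_ubound (f : l1) : has_ubound (l1_sums f).
Proof. by have /asboolP := valP f. Qed.

Lemma le_l1_norm (f : l1) (A : {fset I}) :
  \sum_(i <- A) rnorm (f i) <= l1_norm f.
Proof. by apply: ub_le_sup; [exact: l1_has_ubound|exists A]. Qed.

Lemma le_l1_norm1 (f : l1) i : rnorm (f i) <= l1_norm f.
Proof. by rewrite (le_trans _ (le_l1_norm f [fset i]%fset))// big_seq_fset1. Qed.

Lemma l1_norm_ge0 (f : l1) : 0 <= l1_norm f.
Proof. by rewrite (le_trans _ (le_l1_norm f fset0))// big_seq_fset0. Qed.

Lemma l1_norm_le (f : l1) (M : R) :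
  (forall A : {fset I}, \sum_(i <- A) rnorm (f i) <= M) -> l1_norm f <= M.
Proof.
move=> fM; apply: ge_sup; first by eexists; exists fset0.
by move=> _ [A _ <-].
Qed.

Lemma l1_normD (f g : l1) : (l1_norm (f + g))%:C <= (l1_norm f)%:C + (l1_norm g)%:C.
Proof.
rewrite -rmorphD lecR; apply: l1_norm_le => A.
apply: (@le_trans _ _ (\sum_(i <- A) (rnorm (f i) + rnorm (g i)))).
  by apply: ler_sum => i _; exact: rnormD.
by rewrite big_split lerD ?le_l1_norm.
Qed.

Lemma l1_normZ (a : R[i]) (f : l1) : (l1_norm (a *: f))%:C = `|a| * (l1_norm f)%:C.
Proof.
rewrite -rnormE -rmorphM/=; congr (_ %:C).
have le b g : l1_norm (b *: g) <= rnorm b * l1_norm g.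
  apply: l1_norm_le => A.
  under eq_bigr do rewrite rnormZ.
  by rewrite -mulr_sumr ler_wpM2l ?rnorm_ge0 ?le_l1_norm.
exact: real_homogeneous le l1_norm_ge0 a f.
Qed.

Lemma l1_norm0_eq0 (f : l1) : (l1_norm f)%:C = 0 -> f = 0.
Proof.
move=> /complexI f0; apply/val_inj/funext => i /=; apply: rnorm0_eq0.
by apply/eqP; rewrite eq_le rnorm_ge0 andbT (le_trans (le_l1_norm1 _ _))// f0.
Qed.

HB.instance Definition _ :=
  Lmodule_isNormed.Build R[i] l1 l1_normD l1_normZ l1_norm0_eq0.

Lemma l1_rnormE (f : l1) : rnorm f = l1_norm f.
Proof. exact: rnorm_ext. Qed.

Lemma l1_complete (G : set_system l1) :
  ProperFilter G -> cauchy G -> cvg G.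
Proof.
move: G; apply: (@complete_by_evaluation R l1 R[i] I (fun i f => f i)).
- by [].
- by move=> i; exists 1 => f; rewrite mul1r l1_rnormE le_l1_norm1.
- by move=> f g fg; apply/val_inj/funext.
move=> G g GG Gg f0 r Gr.
have gr (A : {fset I}) : \sum_(i <- A) rnorm (g i - f0 i) <= r.
  have cT : (fun f : l1 => \sum_(i <- A) rnorm (f i - f0 i)) @ G -->
      \sum_(i <- A) rnorm (g i - f0 i).
    apply: cvg_big => [|i _]; first exact: add_continuous.
    by apply: cvg_rnorm; apply: cvgB; [exact: Gg|exact: cvg_cst].
  rewrite -(cvg_lim (@Rhausdorff R) cT); apply: limr_le.
    by apply/cvg_ex; eexists; exact: cT.
  apply: filterS Gr => f /= fr.
  by rewrite (le_trans (le_l1_norm (f - f0) _))// -l1_rnormE.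
have gP : g \in summable_family.
  rewrite !inE; exists (r + l1_norm f0) => _ [A _ <-].
  apply: (@le_trans _ _ (\sum_(i <- A) (rnorm (g i - f0 i) + rnorm (f0 i)))).
    by apply: ler_sum => i _; rewrite -[in leLHS](subrK (f0 i) (g i)) rnormD.
  by rewrite big_split lerD ?le_l1_norm.
exists (L1 gP); split=> //.
rewrite l1_rnormE; apply: l1_norm_le => A; exact: gr.
Qed.

HB.instance Definition _ := Uniform_isComplete.Build l1 l1_complete.

End SummableFamilies.

Notation dual E := (blin E (complex _)).

Definition unit_ball (R : realType) (E : normedModType R[i]) : Type :=
  {x : E | `|x| <= 1}.

HB.instance Definition _ (R : realType) (E : normedModType R[i]) :=
  Choice.on (unit_ball E).

#[global] Existing Instance summability.totally_filter.

Section CanonicalMaps.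
Variable R : realType.

Lemma unit_ball_rnorm (E : normedModType R[i]) (b : unit_ball E) :
  rnorm (val b) <= 1.
Proof. by rewrite rnorm_le; exact: (valP b). Qed.

Section Embedding.
Variable E : normedModType R[i].

Lemma embed_bounded (x : E) :
  (fun b : unit_ball (dual E) => val b x) \in
    @bounded_family R (unit_ball (dual E)).
Proof.
rewrite !inE; exists (rnorm x) => b.
rewrite (le_trans (le_opnorm _ _))// ler_piMl ?rnorm_ge0//.
by rewrite -blin_rnormE unit_ball_rnorm.
Qed.

(* E -> l_oo(B_E'), x |-> (b |-> b x). *)
Definition linf_embed (x : E) : linf R (unit_ball (dual E)) :=
  Linf (embed_bounded x).

Lemma linf_embed_linear : linear linf_embed.
Proof. by move=> a x y; apply/val_inj/funext => b /=; rewrite linearP. Qed.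

HB.instance Definition _ :=
  GRing.isLinear.Build R[i] E (linf R (unit_ball (dual E))) *:%R linf_embed
    linf_embed_linear.

End Embedding.

Section Quotient.
Variable E : completeNormedModType R[i].

(* l_1(B_E) -> E, f |-> sum_b f(b) b, an unordered sum in E. *)
Definition l1_quotient (f : l1 R (unit_ball E)) : E :=
  summability.sum (fun b => f b *: val b).

Lemma partial_sumE (I : choiceType) (g : I -> E) (A : {fset I}) :
  summability.partial_sum g A = \sum_(i <- A) g i.
Proof. by rewrite big_seq_fsetE. Qed.

Lemma rnorm_sum (I : Type) (r : seq I) (P : pred I) (g : I -> E) :
  rnorm (\sum_(i <- r | P i) g i) <= \sum_(i <- r | P i) rnorm (g i).
Proof.
elim/big_rec2: _ => [|i a b _ h]; first by rewrite rnorm0.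
by rewrite (le_trans (rnormD _ _))// lerD2l.
Qed.

Lemma l1_quotient_cvg (f : l1 R (unit_ball E)) :
  cvg (summability.partial_sum (fun b => f b *: val b) @ summability.totally).
Proof.
apply: cauchy_cvg; apply/cauchy_rnormP => e e0.
have [_ [A0 _ <-] fA0] := sup_adherent e0
  (conj (ex_intro _ _ (ex_intro2 _ _ fset0 I erefl)) (l1_has_ubound f)).
exists (summability.partial_sum (fun b => f b *: val b) A0).
exists A0 => // A /= A0A; rewrite !partial_sumE.
have split_sum (V : zmodType) (g : unit_ball E -> V) :
    \sum_(i <- A) g i = \sum_(i <- A0) g i + \sum_(i <- (A `\` A0)%fset) g i.
  rewrite (big_fsetID _ (mem A0)); congr (_ + _); apply: eq_fbigl => i.
    rewrite !inE/=; case: (boolP (i \in A0)) => iA0; last by rewrite andbF.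
    by rewrite (fsubsetP A0A).
  by rewrite !inE/= andbC.
rewrite split_sum addrC addKr.
apply: (@le_lt_trans _ _ (\sum_(i <- (A `\` A0)%fset) rnorm (f i))).
  apply: le_trans (rnorm_sum _ _ _) _; apply: ler_sum => b _.
  by rewrite rnormZ ler_piMr ?rnorm_ge0 ?unit_ball_rnorm.
have := le_l1_norm f A; rewrite split_sum.
by rewrite -lerBrDl => /le_lt_trans; apply; rewrite ltrBlDl -ltrBlDr.
Qed.

Lemma l1_quotient_linear : linear l1_quotient.
Proof.
move=> a f g; apply: cvg_lim; first exact: norm_hausdorff.
rewrite (_ : summability.partial_sum _ =
  (fun A => a *: summability.partial_sum (fun b => f b *: val b) A +
            summability.partial_sum (fun b => g b *: val b) A)).
  by apply: cvgD; [apply: cvgZr|]; exact: l1_quotient_cvg.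
apply/funext => A; rewrite /summability.partial_sum scaler_sumr -big_split/=.
by apply: eq_bigr => b _; rewrite scalerDl scalerA.
Qed.

HB.instance Definition _ :=
  GRing.isLinear.Build R[i] (l1 R (unit_ball E)) E *:%R l1_quotient
    l1_quotient_linear.

End Quotient.
End CanonicalMaps.

Section Tensors.
Variables (R : realType) (k : nat).

Definition multilinear (E : lmodType R[i]) (A : ('I_k -> E) -> R[i]) : Prop :=
  forall (i : 'I_k) (x : 'I_k -> E) (a : R[i]) (u v : E),
    A (@dfwith _ (fun=> E) x i (a *: u + v)) =
    a * A (@dfwith _ (fun=> E) x i u) + A (@dfwith _ (fun=> E) x i v).

(* k-linear forms, with no continuity requirement. *)
Record mlin (E : lmodType R[i]) :=
  MLin { mlin_fun :> ('I_k -> E) -> R[i] ; mlinP : multilinear mlin_fun }.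

(* The k-fold tensor product of E is realized inside the linear functionals on
   the k-linear forms of E: x_1 (x) ... (x) x_k is the evaluation
   A |-> A(x_1, ..., x_k). Over a field this is faithful: k-linear forms
   separate the points of the tensor product. [dtensor x] is x (x) ... (x) x. *)
Definition dtensor (E : lmodType R[i]) (x : E) : mlin E -> R[i] :=
  fun A => A (fun=> x).

Definition is_symtensor (E : lmodType R[i]) : {pred mlin E -> R[i]} :=
  [pred u | `[< exists s : seq (R[i] * E),
                  u = \sum_(p <- s) p.1 *: dtensor p.2 >]].

Lemma symtensor_submod_closed (E : lmodType R[i]) :
  submod_closed (@is_symtensor E).
Proof.
split=> [|a u v]; rewrite !inE; first by exists [::]; rewrite big_nil.
move=> [s ->] [t ->]; exists ([seq (a * p.1, p.2) | p <- s] ++ t).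
rewrite big_cat big_map/= scaler_sumr; congr (_ + _).
by apply: eq_bigr => p _; rewrite scalerA.
Qed.

HB.instance Definition _ (E : lmodType R[i]) :=
  GRing.isSubmodClosed.Build R[i] (mlin E -> R[i]) (@is_symtensor E)
    (@symtensor_submod_closed E).

Record symtensor (E : lmodType R[i]) :=
  SymTensor { st_fun :> mlin E -> R[i] ; _ : st_fun \in @is_symtensor E }.

HB.instance Definition _ (E : lmodType R[i]) := [isSub for @st_fun E].
HB.instance Definition _ (E : lmodType R[i]) := [Choice of symtensor E by <:].
HB.instance Definition _ (E : lmodType R[i]) :=
  [SubChoice_isSubLmodule of symtensor E by <:].

Lemma mlin_comp_multilinear (E F : lmodType R[i]) (T : {linear E -> F})
  (A : mlin F) : multilinear (fun x : 'I_k -> E => A (T \o x)).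
Proof.
move=> i x a u v.
have TE w : T \o @dfwith _ (fun=> E) x i w = @dfwith _ (fun=> F) (T \o x) i (T w).
  apply/funext => j /=; case: (eqVneq i j) => [<-|ij]; first by rewrite !dfwith_in.
  by rewrite !dfwith_out.
by rewrite !TE linearP mlinP.
Qed.

Definition mlin_comp (E F : lmodType R[i]) (T : {linear E -> F}) (A : mlin F) :
  mlin E := MLin (mlin_comp_multilinear T A).

Lemma symtensor_map_subproof (E F : lmodType R[i]) (T : {linear E -> F})
  (u : symtensor E) : (fun A => u (mlin_comp T A)) \in @is_symtensor F.
Proof.
rewrite !inE; have /asboolP[s us] := valP u.
exists [seq (p.1, T p.2) | p <- s]; apply/funext => A.
rewrite -[u _]/(val u _) us big_map !fct_sumE.
by apply: eq_bigr => p _.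
Qed.

(* The restriction of T (x) ... (x) T to symmetric tensors. *)
Definition symtensor_map (E F : lmodType R[i]) (T : {linear E -> F})
  (u : symtensor E) : symtensor F := SymTensor (symtensor_map_subproof T u).

Lemma mlin_pow_multilinear (E : lmodType R[i]) (g : {linear E -> R[i]}) :
  multilinear (fun x : 'I_k -> E => \prod_i g (x i)).
Proof.
move=> i x a u v.
have E' w : \prod_j g (@dfwith _ (fun=> E) x i w j) =
    g w * \prod_(j | j != i) g (x j).
  rewrite (bigD1 i)//= dfwith_in; congr (_ * _).
  by apply: eq_bigr => j ji; rewrite dfwith_out// eq_sym.
by rewrite !E' linearP mulrDl -scalerAl.
Qed.

(* (x_1, ..., x_k) |-> g(x_1) ... g(x_k). *)
Definition mlin_pow (E : lmodType R[i]) (g : {linear E -> R[i]}) : mlin E :=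
  MLin (mlin_pow_multilinear g).

End Tensors.

Section DualEvaluation.
Variables (R : realType) (E : normedModType R[i]).

Definition dual_eval (x : E) : dual E -> R[i] := fun g => g x.

Lemma dual_eval_linear x : linear (dual_eval x).
Proof. by []. Qed.

HB.instance Definition _ x :=
  GRing.isLinear.Build R[i] (dual E) R[i] *:%R (dual_eval x)
    (dual_eval_linear x).

(* The identification of symmetric tensors of E' with polynomials on E, sending
   g (x) ... (x) g to g^k. *)
Definition tensor_poly (k : nat) (u : symtensor k (dual E)) (x : E) : R[i] :=
  u (mlin_pow k (dual_eval x)).

End DualEvaluation.

Section FiniteDimensional.
Variables (R : realType) (E : normedModType R[i]).

(* Finite dimensional subspaces of E; [fdspace N] is N as a normed space. *)
Record fdsub := FdSub {
  fd_pred :> {pred E} ;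
  fd_closed : submod_closed fd_pred ;
  fd_span : exists n (b : 'I_n -> E), forall x, x \in fd_pred ->
    exists c : 'I_n -> R[i], x = \sum_i c i *: b i }.

HB.instance Definition _ (N : fdsub) :=
  GRing.isSubmodClosed.Build R[i] E (fd_pred N) (fd_closed N).

Record fdspace (N : fdsub) := FdSpace { fd_val :> E ; _ : fd_val \in fd_pred N }.

HB.instance Definition _ (N : fdsub) := [isSub for @fd_val N].
HB.instance Definition _ (N : fdsub) := [Choice of fdspace N by <:].
HB.instance Definition _ (N : fdsub) := [SubChoice_isSubLmodule of fdspace N by <:].

Lemma fdspace_normD (N : fdsub) (x y : fdspace N) :
  `|fd_val (x + y)| <= `|fd_val x| + `|fd_val y|.
Proof. exact: ler_normD. Qed.

Lemma fdspace_normZ (N : fdsub) (a : R[i]) (x : fdspace N) :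
  `|fd_val (a *: x)| = `|a| * `|fd_val x|.
Proof. exact: normrZ. Qed.

Lemma fdspace_norm0_eq0 (N : fdsub) (x : fdspace N) : `|fd_val x| = 0 -> x = 0.
Proof. by move=> /normr0_eq0 x0; apply/val_inj. Qed.

HB.instance Definition _ (N : fdsub) :=
  Lmodule_isNormed.Build R[i] (fdspace N)
    (@fdspace_normD N) (@fdspace_normZ N) (@fdspace_norm0_eq0 N).

End FiniteDimensional.

Section Polynomials.
Variables (R : realType) (k : nat).

Definition polynomials (E : normedModType R[i]) : set (E -> R[i]) :=
  [set P | continuous P /\
           exists A : mlin k E, forall x, P x = A (fun=> x)].

Definition symmetric_form (E : normedModType R[i]) (A : ('I_k -> E) -> R[i]) :=
  forall (s : 'S_k) x, A (x \o s) = A x.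

(* The symmetric k-linear form of P, unique (by polarization) among those that
   restrict to P on the diagonal. *)
Definition polar_form (E : normedModType R[i]) (P : E -> R[i]) :
    ('I_k -> E) -> R[i] :=
  xget (fun=> 0) [set A | [/\ multilinear A, symmetric_form A &
                             forall x, A (fun=> x) = P x]].

End Polynomials.

(* P_a, for P homogeneous of degree k + 1. *)
Definition contract (R : realType) (k : nat) (E : normedModType R[i])
    (P : E -> R[i]) (a x : E) : R[i] :=
  polar_form (k := k.+1) P (fun i => if i == ord0 then a else x).

Section NaturalNorms.
Variable R : realType.

(* A family assigning a norm to each symmetric tensor power of each Banach space.
   The domain is Banach spaces, not all normed spaces: the associates below are
   characterized on Banach spaces only, and the ideals only evaluate the norms
   on duals of finite dimensional spaces. *)
Definition tensor_norms : Type :=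
  forall (k : nat) (E : completeNormedModType R[i]), symtensor k E -> R.

(* The norm dual to the supremum norm of polynomials on the unit ball. The pairing
   of u with a polynomial P is [u A] for any k-linear A with P on its diagonal:
   on symmetric tensors this depends on P only. *)
Definition projective_norm : tensor_norms := fun k E u =>
  sup [set rnorm (u A) | A in
        [set A : mlin k E | polynomials k (fun x => A (fun=> x)) /\
                            forall x, `|x| <= 1 -> `|A (fun=> x)| <= 1]].

Definition injective_norm : tensor_norms := fun k E u =>
  sup [set rnorm (u (mlin_pow k g)) | g in [set g : dual E | `|g| <= 1]].

Definition projective_associate (b : tensor_norms) : tensor_norms := fun k E u =>
  inf [set b k (l1 R (unit_ball E)) v | v in
        [set v | symtensor_map (@l1_quotient R E) v = u]].

Definition injective_associate (b : tensor_norms) : tensor_norms := fun k E u =>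
  b k (linf R (unit_ball (dual E))) (symtensor_map (@linf_embed R E) u).

Variant natural_sequence : tensor_norms -> Prop :=
| NatProj : natural_sequence projective_norm
| NatInj : natural_sequence injective_norm
| NatInjProj : natural_sequence (injective_associate projective_norm)
| NatProjInj : natural_sequence (projective_associate injective_norm)
| NatProjInjProj :
    natural_sequence (projective_associate (injective_associate projective_norm))
| NatInjProjInj :
    natural_sequence (injective_associate (projective_associate injective_norm)).

End NaturalNorms.

Section Ideals.
Variable R : realType.

(* V is a linear subspace of W and (V, nu) is a Banach space. *)
Record banach_subspace (W : lmodType R[i]) (V : set W) (nu : W -> R) : Prop := {
  banach_sub0 : V 0 ;
  banach_subP : forall (a : R[i]) (P Q : W), V P -> V Q -> V (a *: P + Q) ;
  banach_normD : forall P Q : W, V P -> V Q -> nu (P + Q) <= nu P + nu Q ;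
  banach_normZ : forall (a : R[i]) (P : W), V P -> nu (a *: P) = rnorm a * nu P ;
  banach_norm0_eq0 : forall P : W, V P -> nu P = 0 -> P = 0 ;
  banach_complete : forall u : nat -> W, (forall n, V (u n)) ->
    (forall e : R, 0 < e -> exists N, forall m n, (N <= m)%N -> (N <= n)%N ->
       nu (u m - u n) < e) ->
    exists2 P : W, V P & (fun n => nu (u n - P)) @ \oo --> (0 : R) }.

Record poly_ideal := PolyIdeal {
  ideal_set : forall E : completeNormedModType R[i], set (E -> R[i]) ;
  ideal_norm : forall E : completeNormedModType R[i], (E -> R[i]) -> R }.

Record banach_ideal (k : nat) (A : poly_ideal) : Prop := {
  ideal_polynomials : forall E : completeNormedModType R[i],
    ideal_set A (E := E) `<=` polynomials k (E := E) ;
  ideal_banach : forall E : completeNormedModType R[i],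
    banach_subspace (ideal_set A (E := E)) (ideal_norm A (E := E)) ;
  ideal_comp : forall (E1 E : completeNormedModType R[i]) (T : blin E1 E)
      (P : E -> R[i]), ideal_set A P ->
    ideal_set A (P \o T) /\
    ideal_norm A (P \o T) <= ideal_norm A P * rnorm T ^+ k ;
  ideal_power : ideal_set A (fun z : R[i] => z ^+ k) /\
    ideal_norm A (fun z : R[i] => z ^+ k) = 1 }.

Definition coherent_sequence (A : nat -> poly_ideal) : Prop :=
  (forall k, (1 <= k)%N -> banach_ideal k (A k)) /\
  exists C D : R, [/\ 0 < C, 0 < D &
    forall (E : completeNormedModType R[i]) (k : nat), (1 <= k)%N ->
      (forall (P : E -> R[i]) (a : E), ideal_set (A k.+1) P ->
         ideal_set (A k) (contract k P a) /\
         ideal_norm (A k) (contract k P a) <=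
           C * ideal_norm (A k.+1) P * rnorm a) /\
      (forall (P : E -> R[i]) (g : dual E), ideal_set (A k) P ->
         ideal_set (A k.+1) (fun x => g x * P x) /\
         ideal_norm (A k.+1) (fun x => g x * P x) <=
           D * rnorm g * ideal_norm (A k) P)].

Definition multiplicative_sequence (A : nat -> poly_ideal) : Prop :=
  coherent_sequence A /\
  exists M : R, forall (k l : nat), (1 <= k)%N -> (1 <= l)%N ->
    forall (E : completeNormedModType R[i]) (P Q : E -> R[i]),
      ideal_set (A k) P -> ideal_set (A l) Q ->
      ideal_set (A (k + l)%N) (fun x => P x * Q x) /\
      ideal_norm (A (k + l)%N) (fun x => P x * Q x) <=
        M ^+ (k + l) * ideal_norm (A k) P * ideal_norm (A l) Q.

Variable alpha : tensor_norms R.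

(* The norms of the restrictions of P to the finite dimensional subspaces N, each
   restriction being viewed as a symmetric tensor of N'. *)
Definition restriction_norms (k : nat) (E : completeNormedModType R[i])
    (P : E -> R[i]) : set R :=
  [set r | exists (N : fdsub E) (u : symtensor k (dual (fdspace N))),
     (forall x : fdspace N, tensor_poly u x = P (fd_val x)) /\ r = @alpha k _ u].

Definition max_ideal (k : nat) : poly_ideal := {|
  ideal_set E := [set P | polynomials k P /\ has_ubound (restriction_norms k P)] ;
  ideal_norm E P := sup (restriction_norms k P) |}.

Definition finite_rank (E F : normedModType R[i]) (S : blin E F) : Prop :=
  exists n (b : 'I_n -> F), forall x,
    exists c : 'I_n -> R[i], S x = \sum_i c i *: b i.

Definition approximable (E F : normedModType R[i]) (T : blin E F) : Prop :=
  forall e : R, 0 < e -> exists S : blin E F, finite_rank S /\ rnorm (T - S) < e.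

Definition factorization_norms (k : nat) (E : completeNormedModType R[i])
    (P : E -> R[i]) : set R :=
  [set r | exists (E1 : completeNormedModType R[i]) (T : blin E E1)
                  (Q : E1 -> R[i]),
     [/\ approximable T, ideal_set (max_ideal k) Q, P = Q \o T &
         r = ideal_norm (max_ideal k) Q * rnorm T ^+ k]].

Definition min_ideal (k : nat) : poly_ideal := {|
  ideal_set E := [set P | factorization_norms k P !=set0] ;
  ideal_norm E P := inf (factorization_norms k P) |}.

End Ideals.

(* Main.v *)
From HB Require Import structures.
From mathcomp Require Import all_boot all_order all_algebra perm finmap complex.
From mathcomp Require Import cyclic separable cyclotomic.
From mathcomp Require Import boolp classical_sets functions reals.
From mathcomp Require Import interval_inference topology normedtype sequences exp.
From mathcomp Require summability.
From mathcomp Require Import ring lra.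
Require Import Defs.
Set Implicit Arguments.
Unset Strict Implicit.
Unset Printing Implicit Defensive.
Import Order.TTheory GRing.Theory Num.Theory.
Import numFieldNormedType.Exports.
Local Open Scope classical_set_scope.
Local Open Scope ring_scope.
Local Open Scope complex_scope.

(** Multiplicativity is a matter of estimates for tensors that do not see which natural
    sequence is considered. Three operations on symmetric tensors matter: the symmetrized
    product ([tprod]), the contraction by a functional ([contr]) and the image under an
    operator. On tensors of the dual of a finite dimensional space they are the product
    of polynomials, the passage from P to P_a and the composition with an operator.
    The record [uniform_norms] lists what is required from a sequence of tensor norms:
    seminorm axioms, the metric mapping property, comparison with powers of vectors and
    functionals, a bound e for contractions, and a bound [growth] for products
    that is e^(k+l) in general but only e when the first factor has degree 1.

    The constants come from one inequality. If A is a (k+l)-linear form with polynomial P,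
    then the symmetrization of A at (x, ..., x, y, ..., y) is, up to a binomial
    coefficient, the coefficient of t^l in P(x + t y), and a mean over roots of unity on
    a circle |t| = r extracts it ([mixed_polarization]). For k = 1 the choice r = l gives
    (1 + 1/l)^l <= e. This settles products for the projective norm, which is dual to the
    supremum norm of polynomials, and contractions for the injective norm, which is a
    supremum norm of polynomials on the dual space; the remaining estimates for these two
    norms are immediate. All estimates pass to associates: functionals and operators lift
    along the quotient maps from l_1(B_E) and extend along the embeddings into l_oo(B_E')
    without increase of norm, and the three operations commute with images under
    operators ([projective_associate_uniform], [injective_associate_uniform]).

    For the maximal ideals, a finite dimensional space N has finitely many points at
    which evaluation gives coordinates both on the polynomials of degree k on N and on
    the symmetric tensors of its dual ([interpolation]). Hence the restriction of a
    polynomial to N is a unique tensor, the estimates for tensors become estimates for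
    polynomials, and pointwise limits are limits of tensors, which yields completeness.

    For the minimal ideals, polynomials P_n = Q_n o T_n with different middle spaces are
    combined through the l_oo-sum of these spaces: operators T_n with norms tending to 0
    give one approximable operator ([approximable_glue]), and the Q_n become
    polynomials on one space, where the statements for the maximal ideal apply. Two
    terms give sums and products, and infinitely many give completeness. *)

(** * Symmetric multilinear forms and polarization *)

Section Multilinear.
Variables (R : realType) (E : lmodType R[i]).

Lemma multilinear_sum k (A : mlin k E) i (x : 'I_k -> E) (J : Type) (r : seq J)
    (c : J -> R[i]) (u : J -> E) :
  A (@dfwith _ (fun=> E) x i (\sum_(j <- r) c j *: u j)) =
  \sum_(j <- r) c j * A (@dfwith _ (fun=> E) x i (u j)).
Proof.
elim: r => [|j r IH].
  have := mlinP A i x (-1) 0 0; rewrite scaler0 addr0 mulN1r addNr.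
  by rewrite !big_nil.
by rewrite !big_cons mlinP IH.
Qed.

Definition tjoin m n (x : 'I_m -> E) (y : 'I_n -> E) : 'I_(m + n) -> E :=
  fun i => match fintype.split i with inl j => x j | inr j => y j end.

Lemma tjoin_l m n (x : 'I_m -> E) (y : 'I_n -> E) i : tjoin x y (lshift n i) = x i.
Proof. by rewrite /tjoin (unsplitK (inl i)). Qed.

Lemma tjoin_r m n (x : 'I_m -> E) (y : 'I_n -> E) i : tjoin x y (rshift m i) = y i.
Proof. by rewrite /tjoin (unsplitK (inr i)). Qed.

Lemma tjoin_eq m n (x : 'I_m -> E) (y : 'I_n -> E) (z : 'I_(m + n) -> E) :
  (forall i, z (lshift n i) = x i) -> (forall i, z (rshift m i) = y i) ->
  z = tjoin x y.
Proof.
move=> zx zy; apply/funext => i; rewrite -(splitK i).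
by case: (fintype.split i) => j /=; rewrite ?tjoin_l ?tjoin_r.
Qed.

Lemma tjoin_dfwith_l m n (x : 'I_m -> E) (y : 'I_n -> E) i w :
  tjoin (@dfwith _ (fun=> E) x i w) y =
  @dfwith _ (fun=> E) (tjoin x y) (lshift n i) w.
Proof.
apply/esym/tjoin_eq => j; last by rewrite dfwith_out ?tjoin_r// eq_lrshift.
have [->|ij] := eqVneq i j; first by rewrite !dfwith_in.
by rewrite !dfwith_out ?tjoin_l// eq_lshift.
Qed.

Lemma tjoin_dfwith_r m n (x : 'I_m -> E) (y : 'I_n -> E) i w :
  tjoin x (@dfwith _ (fun=> E) y i w) =
  @dfwith _ (fun=> E) (tjoin x y) (rshift m i) w.
Proof.
apply/esym/tjoin_eq => j; first by rewrite dfwith_out ?tjoin_l// eq_rlshift.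
have [->|ij] := eqVneq i j; first by rewrite !dfwith_in.
by rewrite !dfwith_out ?tjoin_r// eq_rshift.
Qed.

Lemma mlin_tail_multilinear m n (A : mlin (m + n) E) (x : 'I_m -> E) :
  multilinear (fun y : 'I_n -> E => A (tjoin x y)).
Proof. by move=> i y a u v; rewrite !tjoin_dfwith_r mlinP. Qed.

Definition mlin_tail m n (A : mlin (m + n) E) (x : 'I_m -> E) : mlin n E :=
  MLin (mlin_tail_multilinear A x).

(** Multilinear expansion, one slot at a time: the first slot is split off and
    the remaining ones form a form of smaller degree. *)
Lemma mlin_expand k (J : finType) (A : mlin k E) (c : 'I_k -> J -> R[i]) (e : J -> E) :
  A (fun j => \sum_i c j i *: e i) =
  \sum_(h : {ffun 'I_k -> J}) (\prod_j c j (h j)) * A (fun j => e (h j)).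
Proof.
elim: k A c => [|k IH] A c.
  rewrite (big_pred1 (ffun0 (card_ord 0))) => [|h /=].
    by rewrite big_ord0 mul1r; congr (A _); apply/funext => -[].
  by apply/esym/eqP/ffunP => -[].
pose s0 : 'I_(1 + k) := lshift k ord0.
have -> : (fun j : 'I_(1 + k) => \sum_i c j i *: e i) =
    tjoin (@dfwith _ (fun=> E) (fun _ : 'I_1 => 0) ord0 (\sum_i c s0 i *: e i))
          (fun j => \sum_i c (rshift 1 j) i *: e i).
  by apply: tjoin_eq => // i; rewrite (ord1 i) dfwith_in.
rewrite tjoin_dfwith_l multilinear_sum.
pose glue (p : J * {ffun 'I_k -> J}) : {ffun 'I_(1 + k) -> J} :=
  [ffun j => match fintype.split j with inl _ => p.1 | inr j' => p.2 j' end].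
have glue_l p i : glue p (lshift k i) = p.1.
  by rewrite ffunE (unsplitK (inl i)).
have glue_r p i : glue p (rshift 1 i) = p.2 i.
  by rewrite ffunE (unsplitK (inr i)).
rewrite (reindex glue)/=; last first.
  exists (fun h : {ffun 'I_(1 + k) -> J} => (h s0, [ffun j => h (rshift 1 j)])) => [p _|h _].
    by case: p => a p; rewrite /s0 glue_l; congr pair; apply/ffunP => j; rewrite ffunE glue_r.
  apply/ffunP => j; rewrite ffunE -[j in RHS]splitK.
  by case: (fintype.split j) => j' /=; rewrite ?ffunE// (ord1 j').
pose F (h : {ffun 'I_(1 + k) -> J}) := (\prod_j c j (h j)) * A (fun j => e (h j)).
rewrite -(pair_big predT predT (fun a p => F (glue (a, p))))/=.
apply: eq_bigr => a _.
pose B : mlin (1 + k) E := A.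
rewrite -(@tjoin_dfwith_l 1 k) -[A _]/(mlin_tail B (@dfwith _ (fun=> E) (fun _ : 'I_1 => 0) ord0 (e a)) _).
rewrite (IH _ (fun j => c (rshift 1 j))) mulr_sumr; apply: eq_bigr => p _.
rewrite mulrA; congr (_ * _).
  rewrite (@big_split_ord _ _ _ 1 k)/= big_ord1 glue_l; congr (_ * _).
  by apply: eq_bigr => j _; rewrite glue_r.
congr (A _); apply/esym/(@tjoin_eq 1 k) => i; last by rewrite glue_r.
by rewrite (ord1 i) dfwith_in glue_l.
Qed.

Lemma sum_neg1_supset k (h : {ffun 'I_k -> 'I_k}) :
  \sum_(S : {set 'I_k}) (-1) ^+ (k - #|S|) * \prod_j ((h j \in S)%:R : R[i]) =
  (injectiveb h)%:R.
Proof.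
pose G i : R[i] := if i \in codom h then 0 else -1.
transitivity (\prod_i (1 + G i)).
  rewrite bigA_distr; apply: eq_bigr => S _.
  have -> : (-1) ^+ (k - #|S|) = \prod_i (if i \in S then 1 else -1) :> R[i].
    rewrite (eq_bigr (fun i => if i \notin S then -1 else 1)) => [|i _]; last by case: ifP.
    by rewrite -big_mkcond/= prodr_const -{1}[k]card_ord -(cardC S) addKn.
  have [/forallP hS|] := boolP [forall j, h j \in S].
    rewrite [X in _ * X]big1 ?mulr1 => [|j _]; last by rewrite hS.
    apply: eq_bigr => i _; case: ifPn => // iS.
    by rewrite /G ifF//; apply: contraNF iS => /codomP[j ->].
  rewrite negb_forall => /existsP[j hj].
  rewrite [X in _ * X](bigD1 j)//= (negbTE hj) mul0r mulr0 (bigD1 (h j))//= (negbTE hj).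
  by rewrite /G codom_f mul0r.
have GE i : 1 + G i = (i \in codom h)%:R by rewrite /G; case: ifP; rewrite ?addr0 ?subrr.
under eq_bigr do rewrite GE.
have [hi|] := boolP (injectiveb h).
  rewrite big1// => i _.
  by rewrite injF_onto//; exact/fintype.injectiveP.
move=> hi; have [i ih] : exists i, i \notin codom h.
  apply/existsP; apply: contraNT hi; rewrite negb_exists => /forallP h'.
  suff /image_injP hI : #|[seq h x | x in 'I_k]| == #|'I_k|.
    by apply/fintype.injectiveP => x y; exact: hI.
  by apply/eqP/eq_card => i; rewrite [RHS]inE; apply: negbNE; exact: h'.
by rewrite (bigD1 i)//= (negbTE ih) mul0r.
Qed.

(** Symmetrization lets a polynomial be handled through any multilinear form that
    induces it, symmetric or not. *)
Definition asym k (A : mlin k E) (v : 'I_k -> E) : R[i] :=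
  (k`!%:R)^-1 * \sum_(s : 'S_k) A (v \o s).

(** Inclusion-exclusion: expanding each A(sum_S v, ..., sum_S v), a term
    A(v_h1, ..., v_hk) is counted with the alternating sum over the sets S that
    contain the range of h, and it survives only when h is surjective. *)
Lemma polarization k (A : mlin k E) (v : 'I_k -> E) :
  asym A v = (k`!%:R)^-1 *
    \sum_(S : {set 'I_k}) (-1) ^+ (k - #|S|) * A (fun=> \sum_(i in S) v i).
Proof.
congr (_ * _); apply/esym.
transitivity (\sum_(S : {set 'I_k}) \sum_(h : {ffun 'I_k -> 'I_k})
    ((-1) ^+ (k - #|S|) * \prod_j (h j \in S)%:R) * A (fun j => v (h j))).
  apply: eq_bigr => S _.
  under [RHS]eq_bigr do rewrite -mulrA.
  rewrite -mulr_sumr -(mlin_expand A (fun j i => (i \in S)%:R)); congr (_ * A _).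
  apply/funext => j; rewrite big_mkcond; apply: eq_bigr => i _.
  by case: (i \in S); rewrite ?scale1r ?scale0r.
rewrite exchange_big/=.
under eq_bigr => h _ do rewrite -mulr_suml sum_neg1_supset.
rewrite (bigID (@injectiveb _ _ \o (fun h : {ffun 'I_k -> 'I_k} => h)))/= [X in _ + X]big1 ?addr0 => [|h /negbTE ->]; last by rewrite mul0r.
rewrite (reindex (fun s : 'S_k => pval s))/=; last first.
  by exists (insubd (1%g : 'S_k)) => /= f; [rewrite valKd|exact: insubdK].
apply: eq_big => [s|s _]; first by rewrite (valP s).
by rewrite (valP s) mul1r; congr (A _); apply/funext => j /=; rewrite -pvalE.
Qed.

Lemma asym_multilinear k (A : mlin k E) : multilinear (asym A).
Proof.
move=> i x a u v; rewrite /asym.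
have E1 (s : 'S_k) w : @dfwith _ (fun=> E) x i w \o s =
    @dfwith _ (fun=> E) (x \o s) ((s^-1)%g i) w.
  apply/funext => j /=; have [<-|ij] := eqVneq (s^-1 i)%g j.
    by rewrite permKV !dfwith_in.
  rewrite !dfwith_out//; apply: contra_neq ij => ->; by rewrite permK.
under eq_bigr do rewrite E1 mlinP.
rewrite big_split/= mulrDr -mulr_sumr mulrCA; congr (_ * (_ * _) + _ * _).
  by apply: eq_bigr => s _; rewrite E1.
by apply: eq_bigr => s _; rewrite E1.
Qed.

Definition mlin_sym k (A : mlin k E) : mlin k E := MLin (asym_multilinear A).

Lemma asym_perm k (A : mlin k E) (s : 'S_k) v : asym A (v \o s) = asym A v.
Proof.
congr (_ * _); rewrite (reindex_inj (mulIg (s^-1)%g))/=; apply: eq_bigr => t _.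
by congr (A _); apply/funext => j /=; rewrite permM permKV.
Qed.

Lemma factC_neq0 k : (k`!%:R : R[i]) != 0.
Proof. by rewrite pnatr_eq0 -lt0n fact_gt0. Qed.

Lemma asym_id k (A : mlin k E) v : (forall s : 'S_k, A (v \o s) = A v) -> asym A v = A v.
Proof.
move=> Av; rewrite /asym; under eq_bigr do rewrite Av.
by rewrite sumr_const card_Sn -[in X in _ * X]mulr_natl mulKf ?factC_neq0.
Qed.

Lemma asym_diag k (A : mlin k E) x : asym A (fun=> x) = A (fun=> x).
Proof. exact: asym_id. Qed.

End Multilinear.
(** * Symmetric tensors *)

Section SymTensors.
Variable R : realType.
Implicit Types E F : lmodType R[i].

Lemma symtensor_rep k E (u : symtensor k E) :
  exists s : seq (R[i] * E), forall A, u A = \sum_(p <- s) p.1 * A (fun=> p.2).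
Proof.
have /asboolP[s us] := valP u; exists s => A.
by rewrite -[u A]/(val u A) us fct_sumE.
Qed.

Lemma symtensor_ext k E (u v : symtensor k E) : (forall A, u A = v A) -> u = v.
Proof. by move=> uv; apply/val_inj/funext. Qed.

(** A symmetric tensor is a combination of diagonal evaluations, so that it
    only sees the polynomial of a multilinear form. *)
Lemma symtensor_comb k E (u : symtensor k E) (A : mlin k E) (J : Type) (r : seq J)
    (c : J -> R[i]) (B : J -> mlin k E) :
  (forall x, A (fun=> x) = \sum_(j <- r) c j * B j (fun=> x)) ->
  u A = \sum_(j <- r) c j * u (B j).
Proof.
move=> AB; have [s us] := symtensor_rep u; rewrite us.
under eq_bigr do rewrite AB mulr_sumr.
rewrite exchange_big/=; apply: eq_bigr => j _; rewrite us mulr_sumr.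
by apply: eq_bigr => p _; rewrite mulrCA.
Qed.

Lemma symtensor_eq k E (u : symtensor k E) (A B : mlin k E) :
  (forall x, A (fun=> x) = B (fun=> x)) -> u A = u B.
Proof.
move=> AB; rewrite (@symtensor_comb _ _ u A _ [:: tt] (fun=> 1) (fun=> B)).
  by rewrite big_seq1 mul1r.
by move=> x; rewrite big_seq1 mul1r AB.
Qed.

Lemma symtensor_lin k E (u : symtensor k E) (A B C : mlin k E) (a : R[i]) :
  (forall x, A (fun=> x) = a * B (fun=> x) + C (fun=> x)) -> u A = a * u B + u C.
Proof.
move=> AB; rewrite (@symtensor_comb _ _ u A _ [:: true; false]
  (fun b => if b then a else 1) (fun b => if b then B else C)).
  by rewrite big_cons big_seq1 mul1r.
by move=> x; rewrite big_cons big_seq1 mul1r AB.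
Qed.

Lemma symtensorDE k E (u v : symtensor k E) A : (u + v) A = u A + v A.
Proof. by []. Qed.

Lemma symtensorZE k E a (u : symtensor k E) A : (a *: u) A = a * u A.
Proof. by []. Qed.

Lemma symtensor_sumE k E (J : Type) (r : seq J) (w : J -> symtensor k E) A :
  (\sum_(j <- r) w j) A = \sum_(j <- r) w j A.
Proof.
elim: r => [|j r IH]; first by rewrite !big_nil.
by rewrite !big_cons symtensorDE IH.
Qed.

Lemma dpow_subproof k E (x : E) : @dtensor R k E x \in @is_symtensor R k E.
Proof. by rewrite inE; exists [:: (1, x)]; rewrite big_seq1 scale1r. Qed.

Definition dpow k E (x : E) : symtensor k E := SymTensor (dpow_subproof k x).

Lemma is_symtensor_sum k E (J : Type) (r : seq J) (c : J -> R[i]) (x : J -> E) :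
  (fun A : mlin k E => \sum_(j <- r) c j * A (fun=> x j)) \in @is_symtensor R k E.
Proof.
rewrite inE; exists [seq (c j, x j) | j <- r]; apply/funext => A.
by rewrite big_map fct_sumE; apply: eq_bigr.
Qed.

(** By polarization the symmetrization of v_1 (x) ... (x) v_k lies in the span of
    the tensors x (x) ... (x) x. *)
Lemma symprod_subproof k E (v : 'I_k -> E) :
  (fun A => asym A v) \in @is_symtensor R k E.
Proof.
suff -> : (fun A => asym A v) = (fun A : mlin k E => \sum_(S : {set 'I_k})
   ((k`!%:R)^-1 * (-1) ^+ (k - #|S|)) * A (fun=> \sum_(i in S) v i)).
  exact: is_symtensor_sum.
apply/funext => A; rewrite polarization mulr_sumr.
by apply: eq_bigr => S _; rewrite mulrA.
Qed.

Definition symprod k E (v : 'I_k -> E) : symtensor k E :=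
  SymTensor (symprod_subproof v).

Lemma tprod_inner_multilinear k l E (v : symtensor l E) (A : mlin (k + l) E) :
  multilinear (fun x : 'I_k -> E => v (mlin_tail A x)).
Proof.
move=> i x a p q; apply: symtensor_lin => y /=.
by rewrite !tjoin_dfwith_l mlinP.
Qed.

Definition tprod_inner k l E (v : symtensor l E) (A : mlin (k + l) E) : mlin k E :=
  MLin (tprod_inner_multilinear v A).

Lemma tprod_subproof k l E (u : symtensor k E) (v : symtensor l E) :
  (fun A => u (tprod_inner v (mlin_sym A))) \in @is_symtensor R (k + l) E.
Proof.
have [s us] := symtensor_rep u; have [t vt] := symtensor_rep v.
suff -> : (fun A => u (tprod_inner v (mlin_sym A))) =
    \sum_(p <- s) \sum_(q <- t) (p.1 * q.1) *:
      (val (symprod (tjoin (fun _ : 'I_k => p.2) (fun _ : 'I_l => q.2)))).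
  by do 2!apply: rpred_sum => ? _; apply: rpredZ; exact: valP.
apply/funext => A; rewrite us fct_sumE; apply: eq_bigr => p _ /=.
rewrite vt mulr_sumr fct_sumE; apply: eq_bigr => q _.
by rewrite mulrA.
Qed.

(** The symmetrized tensor product; on symmetric tensors of a dual space it is
    the product of polynomials. *)
Definition tprod k l E (u : symtensor k E) (v : symtensor l E) : symtensor (k + l) E :=
  SymTensor (tprod_subproof u v).

Lemma mlin_prod_multilinear k l E (A : mlin k E) (B : mlin l E) :
  multilinear (fun x : 'I_(k + l) -> E => A (x \o @lshift k l) * B (x \o @rshift k l)).
Proof.
move=> i x a p q; rewrite -(splitK i); case: (fintype.split i) => j /=.
  have L w : @dfwith _ (fun=> E) x (lshift l j) w \o @lshift k l =
      @dfwith _ (fun=> E) (x \o @lshift k l) j w.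
    apply/funext => m /=; have [<-|jm] := eqVneq j m; first by rewrite !dfwith_in.
    by rewrite !dfwith_out// eq_lshift.
  have M w : @dfwith _ (fun=> E) x (lshift l j) w \o @rshift k l = x \o @rshift k l.
    by apply/funext => m /=; rewrite dfwith_out// eq_lrshift.
  by rewrite !L !M mlinP mulrDl mulrA.
have L w : @dfwith _ (fun=> E) x (rshift k j) w \o @rshift k l =
    @dfwith _ (fun=> E) (x \o @rshift k l) j w.
  apply/funext => m /=; have [<-|jm] := eqVneq j m; first by rewrite !dfwith_in.
  by rewrite !dfwith_out// eq_rshift.
have M w : @dfwith _ (fun=> E) x (rshift k j) w \o @lshift k l = x \o @lshift k l.
  by apply/funext => m /=; rewrite dfwith_out// eq_rlshift.
by rewrite !L !M mlinP mulrDr mulrCA.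
Qed.

Definition mlin_prod k l E (A : mlin k E) (B : mlin l E) : mlin (k + l) E :=
  MLin (mlin_prod_multilinear A B).

Lemma contr_subproof k E (f : {linear E -> R[i]}) (u : symtensor k.+1 E) :
  (fun A => u (mlin_prod (mlin_pow 1 f) A)) \in @is_symtensor R k E.
Proof.
have [s us] := symtensor_rep u.
suff -> : (fun A => u (mlin_prod (mlin_pow 1 f) A)) =
    (fun A : mlin k E => \sum_(p <- s) (p.1 * f p.2) * A (fun=> p.2)).
  exact: is_symtensor_sum.
apply/funext => A; rewrite us; apply: eq_bigr => p _ /=.
by rewrite big_ord1 mulrA.
Qed.

(** The linear map that sends x^(k+1) to f(x) x^k. On symmetric tensors of a dual
    space, with f the evaluation at a, it is the map from P to P_a. *)
Definition contr k E (f : {linear E -> R[i]}) (u : symtensor k.+1 E) : symtensor k E :=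
  SymTensor (contr_subproof f u).

Lemma symtensor_mapE k E F (T : {linear E -> F}) (u : symtensor k E) A :
  symtensor_map T u A = u (mlin_comp T A).
Proof. by []. Qed.

Lemma asym_comp k E F (T : {linear E -> F}) (A : mlin k F) v :
  asym (mlin_comp T A) v = asym A (T \o v).
Proof. by []. Qed.

Lemma tjoin_comp E F (T : {linear E -> F}) k l (x : 'I_k -> E) (y : 'I_l -> E) :
  T \o tjoin x y = tjoin (T \o x) (T \o y).
Proof. by apply: tjoin_eq => i /=; rewrite ?tjoin_l ?tjoin_r. Qed.

Lemma symtensor_map_tprod k l E F (T : {linear E -> F}) (u : symtensor k E)
    (v : symtensor l E) :
  symtensor_map T (tprod u v) = tprod (symtensor_map T u) (symtensor_map T v).
Proof.
apply: symtensor_ext => A.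
rewrite -[LHS]/(u (tprod_inner v (mlin_sym (mlin_comp T A)))).
rewrite -[RHS]/(u (mlin_comp T (tprod_inner (symtensor_map T v) (mlin_sym A)))).
apply: symtensor_eq => x.
rewrite -[LHS]/(v (mlin_tail (mlin_sym (mlin_comp T A)) (fun=> x))).
rewrite -[RHS]/(v (mlin_comp T (mlin_tail (mlin_sym A) (fun=> T x)))).
by apply: symtensor_eq => y /=; rewrite asym_comp tjoin_comp.
Qed.

Lemma symtensor_map_contr k E F (T : {linear E -> F}) (f : {linear F -> R[i]})
    (g : {linear E -> R[i]}) (u : symtensor k.+1 E) :
  (forall x, g x = f (T x)) ->
  symtensor_map T (contr g u) = contr f (symtensor_map T u).
Proof.
move=> gf; apply: symtensor_ext => A.
apply: (@symtensor_eq k.+1 _ u (mlin_prod (mlin_pow 1 g) (mlin_comp T A))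
  (mlin_comp T (mlin_prod (mlin_pow 1 f) A))) => x /=.
by rewrite !big_ord1 gf.
Qed.

Lemma symtensor_map_dpow k E F (T : {linear E -> F}) x :
  symtensor_map T (dpow k x) = dpow k (T x).
Proof. exact: symtensor_ext. Qed.

Lemma symtensor_mapD k E F (T : {linear E -> F}) (u v : symtensor k E) :
  symtensor_map T (u + v) = symtensor_map T u + symtensor_map T v.
Proof. exact: symtensor_ext. Qed.

Lemma symtensor_mapZ k E F (T : {linear E -> F}) a (u : symtensor k E) :
  symtensor_map T (a *: u) = a *: symtensor_map T u.
Proof. exact: symtensor_ext. Qed.

Lemma tprod_pow k l E (u : symtensor k E) (v : symtensor l E) (f : {linear E -> R[i]}) :
  tprod u v (mlin_pow (k + l) f) = u (mlin_pow k f) * v (mlin_pow l f).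
Proof.
rewrite /tprod /=.
(* A form c B is seen as (c - 1) B + B, for u and then for v. *)
rewrite (@symtensor_lin _ _ u _ (mlin_pow k f) (mlin_pow k f) (v (mlin_pow l f) - 1)).
  by rewrite mulrBl mul1r subrK mulrC.
move=> g /=; rewrite mulrBl mul1r subrK mulrC.
rewrite (@symtensor_lin _ _ v _ (mlin_pow l f) (mlin_pow l f) (\prod_(i < k) f g - 1)).
  by rewrite mulrBl mul1r subrK mulrC.
move=> h /=; rewrite mulrBl mul1r subrK asym_id => [/=|s].
  rewrite big_split_ord/=; congr (_ * _).
    by apply: eq_bigr => i _; rewrite tjoin_l.
  by apply: eq_bigr => i _; rewrite tjoin_r.
by rewrite [RHS](reindex_perm s).
Qed.

End SymTensors.

Section TensorPoly.
Variable R : realType.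

Lemma tensor_polyD k (E : normedModType R[i]) (u v : symtensor k (dual E)) x :
  tensor_poly (u + v) x = tensor_poly u x + tensor_poly v x.
Proof. by []. Qed.

Lemma tensor_polyZ k (E : normedModType R[i]) a (u : symtensor k (dual E)) x :
  tensor_poly (a *: u) x = a * tensor_poly u x.
Proof. by []. Qed.

Lemma tensor_poly_dpow k (E : normedModType R[i]) (g : dual E) x :
  tensor_poly (dpow k g) x = g x ^+ k.
Proof. by rewrite /tensor_poly/= prodr_const card_ord. Qed.

Lemma tensor_poly_map k (E F : normedModType R[i]) (S : {linear dual F -> dual E})
    (u : symtensor k (dual F)) x y :
  (forall g, S g x = g y) -> tensor_poly (symtensor_map S u) x = tensor_poly u y.
Proof.
move=> Sxy; rewrite /tensor_poly symtensor_mapE; apply: symtensor_eq => g /=.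
apply: eq_bigr => i _.
by rewrite /dual_eval/= Sxy.
Qed.

Lemma tensor_poly_prod k l (E : normedModType R[i]) (u : symtensor k (dual E))
    (v : symtensor l (dual E)) x :
  tensor_poly (tprod u v) x = tensor_poly u x * tensor_poly v x.
Proof.
exact: tprod_pow.
Qed.

End TensorPoly.
(** * Coefficient extraction *)

Section Scalars.
Variable R : realType.
Implicit Types (z w : R[i]).

Lemma rnorm1 : rnorm (1 : R[i]) = 1.
Proof. by rewrite -[1 : R[i]]/(1%:C) rnorm_abs normr1. Qed.

Lemma rnormX z n : rnorm (z ^+ n) = rnorm z ^+ n.
Proof.
by elim: n => [|n IH]; rewrite ?expr0 ?rnorm1// !exprS rnorm_scalarM IH.
Qed.

Lemma rnormV z : rnorm z^-1 = (rnorm z)^-1.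
Proof. by apply: complexI; rewrite rnormE normfV -rnormE fmorphV. Qed.

Lemma rnorm_nat n : rnorm (n%:R : R[i]) = n%:R.
Proof. by rewrite -(rmorph_nat (real_complex R)) rnorm_abs normr_nat. Qed.

Lemma primitive_root_exists n : (0 < n)%N -> exists z : R[i], n.-primitive_root z.
Proof.
move=> n0; have [rs] := closed_field_poly_normal ('X^n - 1 : {poly R[i]}).
rewrite (monicP (monicXnsubC 1 n0)) scale1r => Xn.
have /hasP[z _ pz] : has n.-primitive_root rs; last by exists z.
apply: has_prim_root => //.
- by apply/allP => z zrs; rewrite /root_of_unity Xn root_prod_XsubC.
- by rewrite -separable_prod_XsubC -Xn separable_Xn_sub_1// pnatr_eq0 -lt0n.
- by rewrite -ltnS -(size_prod_XsubC rs id) -Xn size_XnsubC.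
Qed.

Lemma primitive_root_rnorm n z : n.-primitive_root z -> rnorm z = 1.
Proof.
move=> pz; have n0 := prim_order_gt0 pz.
have : rnorm z ^+ n = 1 by rewrite -rnormX (prim_expr_order pz) rnorm1.
by move/eqP; rewrite pexpr_eq1 ?rnorm_ge0 // => /eqP.
Qed.

(** Cauchy's formula for a coefficient of a polynomial of degree at most n, with
    the integral over the circle of radius r replaced by the mean over r times
    the (n+1)-st roots of unity. *)
Lemma coef_extraction n l (r : R) : (l <= n)%N -> 0 < r ->
  exists w t : 'I_n.+1 -> R[i],
    [/\ forall j, rnorm (t j) = r, \sum_j rnorm (w j) = r ^- l &
     forall a : nat -> R[i],
       \sum_j w j * (\sum_(p < n.+1) a p * t j ^+ p) = a l].
Proof.
move=> ln r0; have [z pz] := primitive_root_exists (ltn0Sn n).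
have z1 := primitive_root_rnorm pz.
have z0 : z != 0 by apply: contra_eq_neq z1 => ->; rewrite rnorm0 eq_sym oner_eq0.
have rC0 : r%:C != 0 :> R[i] by rewrite (fmorph_eq0 (real_complex R)) gt_eqF.
pose t (j : 'I_n.+1) : R[i] := r%:C * z ^+ j.
have tr j : rnorm (t j) = r.
  by rewrite rnorm_scalarM rnorm_abs gtr0_norm// rnormX z1 expr1n mulr1.
exists (fun j => n.+1%:R^-1 * t j ^- l), t; split=> //.
  under eq_bigr do rewrite rnorm_scalarM !rnormV rnormX tr rnorm_nat.
  by rewrite sumr_const card_ord -[LHS]mulr_natl mulrA mulfV ?mul1r// pnatr_eq0.
move=> a.
under eq_bigr do rewrite mulr_sumr.
rewrite exchange_big/= (bigD1 (Ordinal (ln : (l < n.+1)%N)))//= [X in _ + X]big1 => [|p pl].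
  rewrite addr0; under eq_bigr => j _.
    rewrite mulrCA -mulrA mulVf ?mulr1; last first.
      by rewrite expf_neq0// mulf_neq0// expf_neq0.
    over.
  by rewrite sumr_const card_ord -[LHS]mulr_natl mulrCA mulfV ?mulr1// pnatr_eq0.
pose q := z ^+ p / z ^+ l.
have E (j : 'I_n.+1) : n.+1%:R^-1 * t j ^- l * (a p * t j ^+ p) =
    n.+1%:R^-1 * a p * (r%:C ^+ p / r%:C ^+ l) * q ^+ j.
  rewrite /t /q !exprMn !exprVn -!exprM [(j * p)%N]mulnC [(j * l)%N]mulnC.
  by field; rewrite ?expf_neq0//= ?pnatr_eq0.
under eq_bigr do rewrite E.
rewrite -mulr_sumr; suff -> : \sum_(j < n.+1) q ^+ j = 0 by rewrite mulr0.
have q1 : q - 1 != 0.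
  rewrite subr_eq0; apply: contra pl => /eqP q1; apply/eqP/val_inj/eqP => /=.
  have : z ^+ p == z ^+ l.
    by rewrite -[X in _ == X]mul1r -q1 mulfVK// expf_neq0.
  by rewrite (eq_prim_root_expr pz) !modn_small// ltnS.
apply: (mulfI q1); rewrite mulr0 -subrX1 /q expr_div_n -!exprM.
by rewrite ![(_ * n.+1)%N]mulnC !exprM (prim_expr_order pz) !expr1n divr1 subrr.
Qed.

End Scalars.

Section MixedPolarization.
Variables R : realType.

(** The terms of the expansion of A(x + t y, ..., x + t y) depend, when A is
    symmetric, only on the number of slots that hold y. *)
Lemma asym_mix (E : lmodType R[i]) k l (A : mlin (k + l) E) (x y : E)
    (S : {set 'I_(k + l)}) : #|S| = l ->
  asym A (fun j => if j \in S then y else x) =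
  asym A (tjoin (fun _ : 'I_k => x) (fun _ : 'I_l => y)).
Proof.
move=> Sl; pose S0 := [set rshift k j | j : 'I_l].
have S0l : #|S0| = l by rewrite card_imset ?card_ord//; exact: rshift_inj.
have -> : tjoin (fun _ : 'I_k => x) (fun _ : 'I_l => y) =
    (fun j => if j \in S0 then y else x).
  apply/esym/tjoin_eq => i; last by rewrite imset_f.
  by rewrite ifF//; apply/imsetP => -[j _ /eqP]; rewrite eq_lrshift.
pose tS (T : {set 'I_(k + l)}) := [tuple j \in T | j < k + l].
have cT (T : {set 'I_(k + l)}) : count_mem true (tS T) = #|T|.
  rewrite cardE /enum_mem size_filter count_map -enumT.
  by apply: eq_count => j /=; case: (j \in T).
have cF (T : {set 'I_(k + l)}) : count_mem false (tS T) = (k + l - #|T|)%N.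
  have := count_predC (pred1 true) (tS T); rewrite size_tuple cT => h.
  rewrite -[X in (X - _)%N]h addKn.
  by apply: eq_count => -[].
have : perm_eq (tS S) (tS S0).
  by apply/allP => b _ /=; case: b; rewrite ?cT ?cF Sl S0l.
case/tuple_permP => s /val_inj E1.
have {}E1 j : (j \in S) = (s j \in S0).
  by have := congr1 (fun u => tnth u j) E1; rewrite !tnth_mktuple.
rewrite -[RHS](asym_perm A s); congr (asym A _).
by apply/funext => j /=; rewrite E1.
Qed.

(** The constant in the bound of the norm of the (k, l)-mixed part of a
    polynomial of degree k + l. It stays bounded when k = 1: coherence requires
    constants that do not depend on the degree. *)
Definition growth (k l : nat) : R := if k == 1%N then expR 1 else expR 1 ^+ (k + l).

Lemma expR1_ge2 : 2 <= expR 1 :> R.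
Proof. by rewrite -(natr1 1) addrC expR_ge1Dx. Qed.

Lemma growth_ge1 k l : 1 <= growth k l.
Proof.
have e1 : 1 <= expR 1 :> R by apply: le_trans expR1_ge2; rewrite ler1n.
by rewrite /growth; case: ifP => // _; exact: exprn_ege1.
Qed.

Lemma growth_le k l : (0 < k)%N -> growth k l <= expR 1 ^+ (k + l).
Proof.
move=> k0; have e1 : 1 <= expR 1 :> R by apply: le_trans expR1_ge2; rewrite ler1n.
by rewrite /growth; case: ifP => // _; rewrite ler_eXnr// addn_gt0 k0.
Qed.

(** A(x, ..., x, y, ..., y) is, up to a binomial coefficient, the coefficient of
    t^l in A(x + t y, ..., x + t y), which is read off a circle |t| = r. The radius
    r = l is the optimal one for k = 1, where it gives (1 + 1/l)^l <= e. *)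
Lemma mixed_polarization k l : (0 < l)%N ->
  exists w t : 'I_(k + l).+1 -> R[i],
    \sum_j rnorm (w j) * (1 + rnorm (t j)) ^+ (k + l) <= growth k l /\
    forall (E : lmodType R[i]) (A : mlin (k + l) E) (x y : E),
      asym A (tjoin (fun _ : 'I_k => x) (fun _ : 'I_l => y)) =
      \sum_j w j * A (fun=> x + t j *: y).
Proof.
move=> l0; pose r : R := if k == 1%N then l%:R else 1.
have r0 : 0 < r by rewrite /r; case: ifP; rewrite ?ltr0n ?ltr01.
have [w [t [tr wr wt]]] := coef_extraction (leq_addl k l) r0.
pose b := 'C(k + l, l).
have b0 : (0 < b)%N by rewrite bin_gt0 leq_addl.
exists (fun j => b%:R^-1 * w j), t; split.
  under eq_bigr do rewrite rnorm_scalarM rnormV rnorm_nat tr.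
  rewrite -mulr_suml -mulr_sumr wr /r /growth /b; case: eqP => [->|_].
    rewrite add1n binSn exprS mulrA.
    have l0' : (l%:R : R) != 0 by rewrite pnatr_eq0 -lt0n.
    rewrite (_ : _ * _ = (1 + l%:R^-1) ^+ l); last first.
      rewrite nat1r (mulrAC l.+1%:R^-1) mulVf ?pnatr_eq0// mul1r mulrC -expr_div_n.
      by rewrite -nat1r mulrDl divff// div1r addrC.
    have : 1 + l%:R^-1 <= expR l%:R^-1 :> R by exact: expR_ge1Dx.
    move=> /(lerXn2r l) h; apply: le_trans (h _ _) _.
    - by rewrite nnegrE addr_ge0 ?invr_ge0.
    - by rewrite nnegrE expR_ge0.
    by rewrite -expRM_natl mulfV.
  rewrite expr1n invr1 mulr1; apply: (@le_trans _ _ (1 * 2 ^+ (k + l))).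
    by rewrite ler_wpM2r ?exprn_ge0// invf_le1 ?ltr0n// ler1n.
  by rewrite mul1r lerXn2r ?nnegrE ?expR_ge0 ?expR1_ge2.
move=> E A x y; apply: (@mulfI _ b%:R); first by rewrite pnatr_eq0 -lt0n.
pose a (p : nat) : R[i] := \sum_(S : {set 'I_(k + l)} | #|S| == p)
  asym A (fun j => if j \in S then y else x).
transitivity (a l).
  rewrite /a (eq_bigr (fun=> asym A (tjoin (fun _ : 'I_k => x) (fun _ : 'I_l => y)))).
    by rewrite sumr_const -cardsE card_draws card_ord mulr_natl.
  by move=> S /eqP; exact: asym_mix.
rewrite -[LHS]wt mulr_sumr; apply: eq_bigr => j _; rewrite !mulrA mulfV ?mul1r; last first.
  by rewrite pnatr_eq0 -lt0n.
congr (_ * _); rewrite -asym_diag.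
have -> : (fun _ : 'I_(k + l) => x + t j *: y) =
    (fun _ => \sum_(b : bool) (if b then t j else 1) *: (if b then y else x)).
  by apply/funext => _; rewrite big_bool/= scale1r addrC.
rewrite -[asym A]/(mlin_fun (mlin_sym A)).
rewrite (mlin_expand (mlin_sym A) (fun _ b => if b then t j else 1)).
rewrite (reindex (fun S : {set 'I_(k + l)} => [ffun i => i \in S]))/=; last first.
  exists (fun h : {ffun 'I_(k + l) -> bool} => [set i | h i]%SET) => [S _|h _].
    by apply/setP => i; rewrite inE ffunE.
  by apply/ffunP => i; rewrite ffunE inE.
under [RHS]eq_bigr => S _.
  rewrite (eq_bigr (fun i => if i \in S then t j else 1)) => [|i _]; last by rewrite ffunE.
  rewrite -big_mkcond/= prodr_const.
  rewrite (_ : (fun j => _) = (fun j => if j \in S then y else x)); last first.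
    by apply/funext => i; rewrite ffunE.
  over.
rewrite /a; under eq_bigr do rewrite mulr_suml.
rewrite (exchange_big_dep predT)//=; apply: eq_bigr => S _.
have Sk : (#|S| < (k + l).+1)%N by rewrite ltnS; have := max_card (mem S); rewrite card_ord.
rewrite (big_pred1 (Ordinal Sk)) => [|p]; first by rewrite mulrC.
by rewrite eq_sym.
Qed.

End MixedPolarization.
(** * Continuous homogeneous polynomials *)

Section PolynomialForms.
Variable R : realType.

Lemma mlin_diagZ k (E : lmodType R[i]) (A : mlin k E) (c : R[i]) x :
  A (fun=> c *: x) = c ^+ k * A (fun=> x).
Proof.
have -> : (fun _ : 'I_k => c *: x) = (fun _ => \sum_(j : unit) c *: x).
  by apply/funext => _; rewrite (big_pred1 tt)//; case.
rewrite (mlin_expand A (fun _ _ => c) (fun _ : unit => x)).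
rewrite (big_pred1 [ffun=> tt]) => [|h]; first by rewrite prodr_const card_ord.
by apply/esym/eqP/ffunP => i; case: (h i) => //; rewrite ffunE.
Qed.

(** The polarization formula expresses a symmetric form through its polynomial, hence
    the uniqueness. *)
Lemma polar_formE k (E : normedModType R[i]) (P : E -> R[i]) (A : mlin k E) :
  (forall x, P x = A (fun=> x)) -> polar_form (k := k) P = asym A.
Proof.
move=> PA; apply: xget_unique.
  split=> [|s v|x]; [exact: asym_multilinear|exact: asym_perm|].
  by rewrite asym_diag PA.
move=> B [Bm Bs BP]; apply/funext => v.
have -> : B v = asym (MLin Bm) v by rewrite asym_id// => s /=; rewrite Bs.
rewrite !polarization; congr (_ * _); apply: eq_bigr => S _.
by rewrite -PA -BP.
Qed.

Lemma contractE k (E : normedModType R[i]) (P : E -> R[i]) (A : mlin k.+1 E) a x :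
  (forall x, P x = A (fun=> x)) ->
  contract k P a x = asym A (tjoin (fun _ : 'I_1 => a) (fun _ : 'I_k => x)).
Proof.
move=> PA; rewrite /contract (polar_formE PA); congr (asym A _).
apply: (@tjoin_eq _ _ 1 k) => i; first by rewrite (ord1 i).
by case: eqP => // /(congr1 val).
Qed.

Lemma mlin_evals_multilinear k (E : normedModType R[i]) (v : 'I_k -> E) :
  multilinear (fun g : 'I_k -> dual E => \prod_i g i (v i)).
Proof.
move=> i g a p q.
have E' w : \prod_j (@dfwith _ (fun=> dual E) g i w j) (v j) =
    w (v i) * \prod_(j | j != i) (g j) (v j).
  rewrite (bigD1 i)//= dfwith_in; congr (_ * _).
  by apply: eq_bigr => j ji; rewrite dfwith_out// eq_sym.
by rewrite !E' mulrA -mulrDl.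
Qed.

Definition mlin_evals k (E : normedModType R[i]) (v : 'I_k -> E) : mlin k (dual E) :=
  MLin (mlin_evals_multilinear v).

Lemma poly_form_multilinear k (E : normedModType R[i]) (u : symtensor k (dual E)) :
  multilinear (fun v : 'I_k -> E => u (mlin_evals v)).
Proof.
move=> i v a p q; apply: symtensor_lin => g /=.
have E' w : \prod_j g (@dfwith _ (fun=> E) v i w j) =
    g w * \prod_(j | j != i) g (v j).
  rewrite (bigD1 i)//= dfwith_in; congr (_ * _).
  by apply: eq_bigr => j ji; rewrite dfwith_out// eq_sym.
by rewrite !E' linearP mulrDl mulrA.
Qed.

(** It is symmetric because u only sees the diagonal of g |-> prod_i g_i(v_i). *)
Definition poly_form k (E : normedModType R[i]) (u : symtensor k (dual E)) : mlin k E :=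
  MLin (poly_form_multilinear u).

Lemma poly_form_diag k (E : normedModType R[i]) (u : symtensor k (dual E)) x :
  poly_form u (fun=> x) = tensor_poly u x.
Proof. exact: symtensor_eq. Qed.

Lemma poly_form_sym k (E : normedModType R[i]) (u : symtensor k (dual E)) v :
  asym (poly_form u) v = poly_form u v.
Proof.
apply: asym_id => s; apply: symtensor_eq => g /=.
by rewrite [RHS](reindex_perm s).
Qed.

Lemma tensor_poly_contr k (E : normedModType R[i]) (u : symtensor k.+1 (dual E)) a x :
  tensor_poly (contr (dual_eval a) u) x = contract k (tensor_poly u) a x.
Proof.
rewrite (contractE (A := poly_form u)) => [|y]; last by rewrite poly_form_diag.
rewrite poly_form_sym.
apply: (@symtensor_eq _ k.+1 _ u (mlin_prod (mlin_pow 1 (dual_eval a))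
  (mlin_pow k (dual_eval x))) (mlin_evals _)) => g /=.
rewrite (@big_split_ord _ _ _ 1 k)/= !big_ord1 (@tjoin_l _ _ 1 k); congr (_ * _).
by apply: eq_bigr => i _; rewrite (@tjoin_r _ _ 1 k).
Qed.

Lemma polynomials_prod k l (E : normedModType R[i]) (P Q : E -> R[i]) :
  polynomials k P -> polynomials l Q -> polynomials (k + l) (fun x => P x * Q x).
Proof.
move=> [Pc [A PA]] [Qc [B QB]]; split; last first.
  by exists (mlin_prod A B) => x /=; rewrite PA QB.
by move=> x; apply: cvgM; [exact: Pc|exact: Qc].
Qed.

Lemma mlin_lin_multilinear k (E : lmodType R[i]) (a : R[i]) (A B : mlin k E) :
  multilinear (fun v => a * A v + B v).
Proof.
by move=> i v c p q; rewrite !mlinP; ring.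
Qed.

Definition mlin_lin k (E : lmodType R[i]) (a : R[i]) (A B : mlin k E) : mlin k E :=
  MLin (mlin_lin_multilinear a A B).

Lemma mlin_zero_multilinear k (E : lmodType R[i]) :
  multilinear (fun _ : 'I_k -> E => 0 : R[i]).
Proof. by move=> i v c p q; rewrite mulr0 addr0. Qed.

Definition mlin_zero k (E : lmodType R[i]) : mlin k E := MLin (@mlin_zero_multilinear k E).

Lemma polynomials_lin k (E : normedModType R[i]) a (P Q : E -> R[i]) :
  polynomials k P -> polynomials k Q -> polynomials k (a *: P + Q).
Proof.
move=> [Pc [A PA]] [Qc [B QB]]; split; last first.
  by exists (mlin_lin a A B) => x /=; rewrite -PA -QB.
move=> x; apply: cvgD; last exact: Qc.
by apply: cvgZr; exact: Pc.
Qed.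

Lemma polynomials0 k (E : normedModType R[i]) : polynomials k (0 : E -> R[i]).
Proof. by split; [exact: cst_continuous|exists (mlin_zero k E)]. Qed.

Lemma polynomials_comp k (E F : normedModType R[i]) (T : blin E F) (P : F -> R[i]) :
  polynomials k P -> polynomials k (P \o T).
Proof.
move=> [Pc [A PA]]; split; last by exists (mlin_comp T A) => x /=; rewrite PA.
by move=> x; apply: continuous_comp; [exact: blin_continuous|exact: Pc].
Qed.

(** Mixed parts are combinations of translates of the polynomial. *)
Lemma polynomials_mixed k l (E : normedModType R[i]) (A : mlin (k + l) E) x :
  (0 < l)%N -> polynomials (k + l) (fun x : E => A (fun=> x)) ->
  polynomials l (fun y => asym A (tjoin (fun _ : 'I_k => x) (fun _ : 'I_l => y))).
Proof.
move=> l0 [Ac _]; have [w [t [_ wt]]] := mixed_polarization R k l0.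
split; last by exists (mlin_tail (mlin_sym A) (fun=> x)).
under eq_fun do rewrite wt.
move=> y; apply: cvg_big => [|j _]; first exact: add_continuous.
apply: cvgM; first exact: cvg_cst.
apply: (@continuous_comp _ _ _ (fun y => x + t j *: y) (fun z => A (fun=> z))).
  by apply: cvgD; [exact: cvg_cst|apply: cvgZr; exact: cvg_id].
exact: Ac.
Qed.

Lemma polynomials_contract k (E : normedModType R[i]) (P : E -> R[i]) a :
  (0 < k)%N -> polynomials k.+1 P -> polynomials k (contract k P a).
Proof.
move=> k0 [Pc [A PA]].
rewrite (_ : contract k P a = (fun y => asym A
    (tjoin (fun _ : 'I_1 => a) (fun _ : 'I_k => y)))); last first.
  by apply/funext => x; exact: contractE.
apply: (@polynomials_mixed 1 k E A a k0); split; last by exists A.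
by rewrite (_ : (fun x => _) = P)//; apply/funext => x; rewrite PA.
Qed.

End PolynomialForms.

(** * Finite dimensional spaces *)

Section BoundedLinear.
Context {R : realType} {E F : normedModType R[i]}.

Lemma bounded_linear_blin (f : E -> F) (M : R) : linear f ->
  (forall x, rnorm (f x) <= M * rnorm x) -> f \in @bounded_operator R E F.
Proof.
move=> fl fM; rewrite inE; split=> // x; apply/cvg_rnormP => e e0.
have M0 : 0 < Num.max 1 M by rewrite lt_max ltr01.
have /(cvg_rnormP (F := nbhs x) id x).1 : y @[y --> x] --> x by exact: cvg_id.
move=> /(_ (e / Num.max 1 M)); rewrite divr_gt0// => /(_ isT).
apply: filterS => y xy.
have -> : f x - f y = f (x - y).
  by rewrite -[f y]scale1r -scaleNr addrC -fl scaleN1r addrC.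
apply: le_lt_trans (fM _) _.
apply: (@le_lt_trans _ _ (Num.max 1 M * rnorm (x - y))).
  by rewrite ler_wpM2r ?rnorm_ge0// le_max lexx orbT.
by rewrite mulrC -ltr_pdivlMr.
Qed.

Definition mkblin (f : E -> F) (M : R) (fl : linear f)
    (fM : forall x, rnorm (f x) <= M * rnorm x) : blin E F :=
  BLin (bounded_linear_blin fl fM).

Lemma mkblin_rnorm (f : E -> F) (M : R) (fl : linear f)
    (fM : forall x, rnorm (f x) <= M * rnorm x) :
  0 <= M -> rnorm (mkblin fl fM) <= M.
Proof. by move=> M0; rewrite blin_rnormE; exact: opnorm_le. Qed.

Lemma le_blin (T : blin E F) x : rnorm (T x) <= rnorm T * rnorm x.
Proof. by rewrite blin_rnormE le_opnorm. Qed.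

End BoundedLinear.

Lemma cauchy_seq_limit (R : realType) (W : completeNormedModType R[i]) (u : nat -> W) :
  (forall e : R, 0 < e -> exists N, forall m n, (N <= m)%N -> (N <= n)%N ->
     rnorm (u m - u n) < e) ->
  exists l : W, u @ \oo --> l.
Proof.
move=> uc; have : cvg (u @ \oo).
  apply: cauchy_cvg; apply/cauchy_rnormP => e e0; have [N uN] := uc e e0.
  by exists (u N); exists N => // n Nn; exact: uN.
by move=> /cvg_ex.
Qed.

Section Frames.
Variables (R : realType) (V : normedModType R[i]).

Definition independent n (b : 'I_n -> V) : Prop :=
  forall c : 'I_n -> R[i], \sum_i c i *: b i = 0 -> forall i, c i = 0.

(** In the induction, if a new vector b_0 had distance 0 to the span of the previous ones,
    the coordinates of approximations of b_0 would converge, by the bound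
    on previous coordinates, and b_0 would lie in that span by the completeness of the
    scalars. *)
Lemma independent_coercive n (b : 'I_n -> V) : independent b ->
  exists2 K : R, 0 <= K &
    forall c : 'I_n -> R[i], \sum_i rnorm (c i) <= K * rnorm (\sum_i c i *: b i).
Proof.
elim: n b => [|n IH] b bi.
  by exists 0 => // c; rewrite big_ord0 mul0r.
pose b' i := b (lift ord0 i).
have [c' b'i|K K0 bK] := IH b'.
  move=> i; have := bi (fun j => if unlift ord0 j is Some j' then c' j' else 0).
  rewrite big_ord_recl unlift_none scale0r add0r.
  under eq_bigr do rewrite liftK.
  by move=> /(_ b'i (lift ord0 i)); rewrite liftK.
have [d d0 bd] : exists2 d : R, 0 < d &
    forall c : 'I_n -> R[i], d <= rnorm (b ord0 - \sum_i c i *: b' i).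
  apply: contrapT => nd.
  have /choice[C HC] : forall m : nat, exists c : 'I_n -> R[i],
      rnorm (b ord0 - \sum_i c i *: b' i) < m.+1%:R^-1.
    move=> m; apply: contrapT => h; apply: nd; exists m.+1%:R^-1; first by rewrite invr_gt0.
    move=> c; rewrite leNgt; apply/negP => h'; apply: h; by exists c.
  have /choice[c Cc] : forall i, exists l : R[i], (fun m => C m i) @ \oo --> l.
    move=> i; apply: cauchy_seq_limit => e e0.
    pose e' := e / (2 * (K + 1)).
    have e'0 : 0 < e' by rewrite divr_gt0// mulr_gt0// ltr_wpDl.
    have [N _ HN] := near_infty_natSinv_lt (PosNum e'0).
    exists N => p q Np Nq.
    apply: (@le_lt_trans _ _ (\sum_i rnorm (C p i - C q i))).
      by rewrite (bigD1 i)//= lerDl sumr_ge0// => j _; exact: rnorm_ge0.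
    apply: le_lt_trans (bK (fun i => C p i - C q i)) _.
    have -> : \sum_i (C p i - C q i) *: b' i =
        (b ord0 - \sum_i C q i *: b' i) - (b ord0 - \sum_i C p i *: b' i).
      under eq_bigr do rewrite scalerBl.
      by rewrite sumrB opprD opprK addrACA subrr add0r addrC.
    apply: (@le_lt_trans _ _ (K * (2 * e'))).
      rewrite ler_wpM2l// (le_trans (rnormD _ _))// rnormN mulr_natl mulr2n.
      by rewrite lerD// ltW// (lt_trans (HC _))// HN.
    rewrite /e' (_ : K * _ = e * (K / (K + 1))); last by field; lra.
    rewrite gtr_pMr// ltr_pdivrMr; last by lra.
    by lra.
  have lim0 : b ord0 - \sum_i c i *: b' i = 0.
    apply: rnorm0_eq0.
    have h1 : (fun m => rnorm (b ord0 - \sum_i C m i *: b' i)) @ \oo -->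
        rnorm (b ord0 - \sum_i c i *: b' i).
      apply: cvg_rnorm; apply: cvgB; first exact: cvg_cst.
      apply: cvg_big => [|i _]; first exact: add_continuous.
      by apply: cvgZl; exact: Cc.
    have h2 : (fun m => rnorm (b ord0 - \sum_i C m i *: b' i)) @ \oo --> (0 : R).
      apply/cvgrPdist_lt => e e0; have [N _ HN] := near_infty_natSinv_lt (PosNum e0).
      exists N => // m Nm /=; rewrite sub0r normrN ger0_norm ?rnorm_ge0//.
      by rewrite (lt_trans (HC _))// HN.
    exact: (cvg_unique (@Rhausdorff R) h1 h2).
  have := bi (fun j => if unlift ord0 j is Some j' then - c j' else 1).
  rewrite big_ord_recl unlift_none scale1r.
  under eq_bigr do rewrite liftK scaleNr.
  rewrite sumrN => /(_ lim0 ord0); rewrite unlift_none => /eqP.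
  by rewrite oner_eq0.
(* The first coordinate is at most ||x|| / d, and the sum of the others at most
   K ||x - c_0 b_0||. *)
exists (d^-1 + K * (1 + rnorm (b ord0) / d)).
  rewrite addr_ge0 ?invr_ge0 ?(ltW d0)// mulr_ge0// addr_ge0//.
  by rewrite divr_ge0 ?rnorm_ge0// ltW.
move=> c; set x := \sum_i c i *: b i.
have c0 : rnorm (c ord0) <= d^-1 * rnorm x.
  have [->|c0] := eqVneq (c ord0) 0; first by rewrite rnorm0 mulr_ge0 ?rnorm_ge0 ?invr_ge0 ?ltW.
  rewrite ler_pdivlMl// mulrC.
  have -> : x = c ord0 *: (b ord0 - \sum_i (- (c (lift ord0 i) / c ord0)) *: b' i).
    rewrite /x big_ord_recl scalerBr scaler_sumr -sumrN; congr (_ + _).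
    apply: eq_bigr => i _; rewrite scalerA -scaleNr; congr (_ *: _).
    by rewrite mulrN opprK mulrC divfK.
  by rewrite rnormZ ler_wpM2l ?rnorm_ge0.
rewrite big_ord_recl mulrDl lerD// -mulrA.
apply: le_trans (bK (fun i => c (lift ord0 i))) _; rewrite ler_wpM2l//.
have -> : \sum_i c (lift ord0 i) *: b' i = x - c ord0 *: b ord0.
  by rewrite /x big_ord_recl addrAC subrr add0r.
rewrite (le_trans (rnormD _ _))// rnormN rnormZ mulrDl mul1r lerD2l.
by rewrite mulrC -mulrA ler_wpM2l ?rnorm_ge0.
Qed.

End Frames.
Section Interpolation.
Variables (R : realType) (V : normedModType R[i]).

Lemma independent_coords n (b : 'I_n -> V) (c d : 'I_n -> R[i]) : independent b ->
  \sum_i c i *: b i = \sum_i d i *: b i -> forall i, c i = d i.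
Proof.
move=> bi cd i; apply/eqP; rewrite -subr_eq0; apply/eqP.
apply: (bi (fun i => c i - d i)); under eq_bigr do rewrite scalerBl.
by rewrite sumrB cd subrr.
Qed.

(** A maximal independent family spans, and its coordinate functionals are
    continuous. *)
Lemma frame_exists n : (forall m (v : 'I_m -> V), independent v -> (m <= n)%N) ->
  exists m (e : 'I_m -> V) (f : 'I_m -> dual V), forall x, x = \sum_i f i x *: e i.
Proof.
move=> hn; pose P m := `[< exists v : 'I_m -> V, independent v >].
have P0 : exists m, P m.
  by exists 0; apply/asboolP; exists (fun=> 0) => c _ [].
have Pn m : P m -> (m <= n)%N by move=> /asboolP[v]; exact: hn.
have [m /asboolP[e ei] maxm] := ex_maxnP P0 Pn.
have /choice[c cE] : forall x, exists c : 'I_m -> R[i], x = \sum_i c i *: e i.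
  move=> x; apply: contrapT => nx.
  suff : P m.+1 by move=> /maxm; rewrite ltnn.
  apply/asboolP; exists (fun j => if unlift ord0 j is Some j' then e j' else x) => c.
  rewrite big_ord_recl unlift_none; under eq_bigr do rewrite liftK.
  have [c0|c0] := eqVneq (c ord0) 0.
    rewrite c0 scale0r add0r => h i; case: (unliftP ord0 i) => [j ->|->//].
    exact: (ei (fun j => c (lift ord0 j)) h j).
  move=> h; exfalso; apply: nx; exists (fun i => - (c (lift ord0 i) / c ord0)).
  apply: (scalerI c0); rewrite scaler_sumr; move/eqP: h; rewrite addr_eq0 => /eqP ->.
  rewrite -sumrN; apply: eq_bigr => i _; rewrite scalerA -scaleNr; congr (_ *: _).
  by rewrite mulrN mulrC divfK.
have [K K0 eK] := independent_coercive ei.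
have cl i : linear (fun x => c x i : R[i]).
  move=> a x y; apply: (independent_coords (c := c (a *: x + y))
    (d := fun i => a *: c x i + c y i) ei).
  rewrite -cE; under [in RHS]eq_bigr => j _ do rewrite scalerDl -scalerA.
  by rewrite big_split/= -scaler_sumr -!cE.
have cK i x : rnorm (c x i) <= K * rnorm x.
  apply: (@le_trans _ _ (K * rnorm (\sum_j c x j *: e j))); last by rewrite -cE.
  apply: le_trans (eK (c x)).
  by rewrite (bigD1 i)//= lerDl sumr_ge0// => j _; exact: rnorm_ge0.
by exists m, e, (fun i => mkblin (cl i) (cK i)).
Qed.

(** Expand vectors in a frame, and functionals in the dual frame; polarization turns
    the values of a symmetric form at the frame vectors into values of its
    polynomial, so that finitely many evaluations are coordinates on the common
    space of polynomials and symmetric tensors of the dual. *)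
Lemma interpolation n k :
    (forall m (v : 'I_m -> V), independent v -> (m <= n)%N) ->
  exists (J : finType) (x : J -> V) (w : J -> symtensor k (dual V)),
    (forall (A : mlin k V) y, A (fun=> y) =
       \sum_j A (fun=> x j) * tensor_poly (w j) y) /\
    (forall u : symtensor k (dual V), u = \sum_j tensor_poly u (x j) *: w j).
Proof.
move=> /frame_exists[m [e [f fE]]].
pose x (p : {ffun 'I_k -> 'I_m} * {set 'I_k}) := \sum_(i in p.2) e (p.1 i).
pose c (S : {set 'I_k}) : R[i] := (k`!%:R)^-1 * (-1) ^+ (k - #|S|).
pose w (p : {ffun 'I_k -> 'I_m} * {set 'I_k}) := c p.2 *: symprod (fun i => f (p.1 i)).
have polar (W : lmodType R[i]) (A : mlin k W) (g : 'I_m -> W) (h : {ffun 'I_k -> 'I_m}) :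
    asym A (fun i => g (h i)) = \sum_S c S * A (fun=> \sum_(i in S) g (h i)).
  by rewrite polarization mulr_sumr; apply: eq_bigr => S _; rewrite mulrA.
have sumE (W : zmodType) (F : {ffun 'I_k -> 'I_m} -> {set 'I_k} -> W) :
    \sum_p F p.1 p.2 = \sum_h \sum_S F h S.
  by rewrite pair_bigA.
exists _, x, w; split=> [A y|u].
  rewrite -asym_diag.
  have -> : (fun _ : 'I_k => y) = (fun _ => \sum_i f i y *: e i).
    by apply/funext => _; rewrite -fE.
  rewrite -[asym A]/(mlin_fun (mlin_sym A)) (mlin_expand _ (fun _ i => f i y)).
  rewrite (sumE _ (fun h S => A (fun=> \sum_(i in S) e (h i)) *
    tensor_poly (c S *: symprod (fun i => f (h i))) y)).
  apply: eq_bigr => h _; rewrite /= polar mulr_sumr; apply: eq_bigr => S _.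
  rewrite -[(_ *: _) _]/(c S * asym (mlin_pow k (dual_eval y)) (fun i => f (h i))).
  rewrite asym_id/= => [|s]; last by rewrite [RHS](reindex_perm s).
  by rewrite /dual_eval; ring.
apply: symtensor_ext => A; rewrite symtensor_sumE.
rewrite (sumE _ (fun h S => (tensor_poly u (\sum_(i in S) e (h i)) *:
    (c S *: symprod (fun i => f (h i)))) A)).
have gE (g : dual V) : g = \sum_i g (e i) *: f i.
  apply/val_inj/funext => y; rewrite -[val _ y]/(g y) {1}[y]fE linear_sum.
  rewrite raddf_sum fct_sumE; apply: eq_bigr => i _.
  rewrite linearZ; exact: mulrC.
rewrite (@symtensor_comb _ _ _ u A _ (index_enum _)
  (fun h : {ffun 'I_k -> 'I_m} => asym A (fun i => f (h i)))
  (fun h => mlin_evals (fun i => e (h i)))); last first.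
  move=> g; rewrite -asym_diag.
  rewrite [in LHS](_ : (fun _ : 'I_k => g) = (fun _ => \sum_i g (e i) *: f i)); last first.
    by apply/funext => _; rewrite -gE.
  rewrite -[asym A]/(mlin_fun (mlin_sym A)) (mlin_expand _ (fun _ i => g (e i))).
  apply: eq_bigr => h _. exact: mulrC.
apply: eq_bigr => h _; rewrite -[u _]/(poly_form u (fun i => e (h i))).
rewrite -poly_form_sym [X in _ * X]polar mulr_sumr; apply: eq_bigr => S _.
rewrite poly_form_diag !symtensorZE -[symprod _ A]/(asym A _).
by ring.
Qed.

End Interpolation.

Section Restriction.
Variables (R : realType) (E : normedModType R[i]).
Implicit Type N : fdsub E.

Lemma fdspace_dim N : exists n, forall m (v : 'I_m -> fdspace N),
  independent v -> (m <= n)%N.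
Proof.
have [n [b bN]] := fd_span N; exists n => m v vi; rewrite leqNgt; apply/negP => nm.
have /choice[c cE] : forall j, exists c : 'I_n -> R[i], fd_val (v j) = \sum_i c i *: b i.
  by move=> j; apply: bN; exact: valP.
pose C : 'M[R[i]]_(m, n) := \matrix_(j, i) c j i.
have : kermx C != 0.
  by rewrite kermx_eq0 /row_free neq_ltn (leq_ltn_trans (rank_leq_col C)).
case/rowV0Pn => u /sub_kermxP uC /negP; apply; apply/eqP/rowP => j; rewrite [RHS]mxE.
apply: (vi (fun j => u ord0 j)); apply: val_inj; rewrite raddf_sum raddf0.
transitivity (\sum_i (u *m C) ord0 i *: b i).
  under [RHS]eq_bigr do rewrite mxE scaler_suml.
  rewrite exchange_big/=; apply: eq_bigr => l _.
  rewrite -[LHS]/(u ord0 l *: fd_val (v l)) cE scaler_sumr; apply: eq_bigr => i _.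
  by rewrite mxE scalerA.
by rewrite uC big1// => i _; rewrite mxE scale0r.
Qed.

Lemma fd_val_linear N : linear (@fd_val _ _ N).
Proof. by []. Qed.

HB.instance Definition _ N :=
  GRing.isLinear.Build R[i] (fdspace N) E *:%R (@fd_val _ _ N) (@fd_val_linear N).

(** The form in which interpolation is used: the points and the tensors serve for
    all polynomials on E at once, which makes limits on N computable pointwise. *)
Lemma restriction_interpolation k N :
  exists (J : finType) (x : J -> fdspace N) (w : J -> symtensor k (dual (fdspace N))),
    (forall P : E -> R[i], polynomials k P -> forall y,
       P (fd_val y) = tensor_poly (\sum_j P (fd_val (x j)) *: w j) y) /\
    (forall u : symtensor k (dual (fdspace N)), u = \sum_j tensor_poly u (x j) *: w j).
Proof.
have [n Nn] := fdspace_dim N; have [J [x [w [xw uw]]]] := interpolation k Nn.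
exists J, x, w; split=> // P [_ [A PA]] y.
pose B := mlin_comp (@fd_val _ _ N) A.
have PB z : P (fd_val z) = B (fun=> z) by rewrite PA.
rewrite PB xw /tensor_poly symtensor_sumE; apply: eq_bigr => j _.
by rewrite symtensorZE PB.
Qed.

Lemma tensor_poly_inj k N (u v : symtensor k (dual (fdspace N))) :
  (forall x, tensor_poly u x = tensor_poly v x) -> u = v.
Proof.
move=> uv; have [n Nn] := fdspace_dim N; have [J [x [w [_ uw]]]] := interpolation k Nn.
by rewrite (uw u) (uw v); apply: eq_bigr => j _; rewrite uv.
Qed.

Lemma restriction_exists k N (P : E -> R[i]) : polynomials k P ->
  exists u : symtensor k (dual (fdspace N)), forall y, tensor_poly u y = P (fd_val y).
Proof.
have [J [x [w [xw _]]]] := restriction_interpolation k N => kP.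
by eexists => y; rewrite (xw P).
Qed.

End Restriction.
(** * Uniform estimates for symmetric tensor norms *)

Section NormLemmas.
Variable R : realType.

Lemma eq_polynomials k (E : normedModType R[i]) (P Q : E -> R[i]) :
  P =1 Q -> polynomials k P -> polynomials k Q.
Proof. by move=> /funext ->. Qed.

Lemma polynomials_pow k (E : normedModType R[i]) (g : dual E) :
  polynomials k (fun x : E => mlin_pow k g (fun=> x)).
Proof.
split; last by exists (mlin_pow k g).
move=> x; apply: cvg_big => [|i _]; first exact: mul_continuous.
exact: blin_continuous.
Qed.

Lemma norm_le1 (V : normedModType R[i]) (x : V) : (`|x| <= 1) = (rnorm x <= 1).
Proof. by rewrite rnorm_le. Qed.

Lemma unit_decomp (V : normedModType R[i]) (x : V) :
  exists2 y : V, rnorm y <= 1 & x = (rnorm x)%:C *: y.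
Proof.
have [->|x0] := eqVneq x 0.
  by exists 0; rewrite ?scaler0// rnorm0 ler01.
have n0 : rnorm x != 0 by apply: contra_neq x0 => /rnorm0_eq0.
exists ((rnorm x)^-1%:C *: x).
  by rewrite rnormZ rnorm_abs ger0_norm ?invr_ge0 ?rnorm_ge0// mulVf.
by rewrite scalerA -rmorphM/= mulfV// scale1r.
Qed.

Lemma rnormM_C (V : normedModType R[i]) (r : R) (x : V) : 0 <= r ->
  rnorm (r%:C *: x) = r * rnorm x.
Proof. by move=> r0; rewrite rnormZ rnorm_abs ger0_norm. Qed.

Lemma mlin_homogeneous_bound k (E : normedModType R[i]) (A : mlin k E) (c : R) :
  (forall x, rnorm x <= 1 -> rnorm (A (fun=> x)) <= c) ->
  forall x, rnorm (A (fun=> x)) <= c * rnorm x ^+ k.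
Proof.
move=> Ac x; have [y y1 xE] := unit_decomp x.
rewrite {1}xE mlin_diagZ rnorm_scalarM rnormX rnorm_abs ger0_norm ?rnorm_ge0//.
by rewrite mulrC ler_wpM2r ?exprn_ge0 ?rnorm_ge0// Ac.
Qed.

Section Composition.
Variables E F G : normedModType R[i].

Lemma bcomp_linear (S : blin F G) (T : blin E F) : linear (S \o T).
Proof. by move=> a x y; rewrite /= !linearP. Qed.

Lemma bcomp_bound (S : blin F G) (T : blin E F) x :
  rnorm ((S \o T) x) <= (rnorm S * rnorm T) * rnorm x.
Proof.
rewrite -mulrA (le_trans (le_blin _ _))// ler_wpM2l ?rnorm_ge0//; exact: le_blin.
Qed.

Definition bcomp (S : blin F G) (T : blin E F) : blin E G :=
  mkblin (bcomp_linear S T) (bcomp_bound S T).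

Lemma bcomp_rnorm (S : blin F G) (T : blin E F) : rnorm (bcomp S T) <= rnorm S * rnorm T.
Proof. by apply: mkblin_rnorm; rewrite mulr_ge0 ?rnorm_ge0. Qed.

End Composition.

(** What the ideals need to know about a sequence of tensor norms. The lower
    bound by evaluations makes the ideal norm dominate the supremum norm. The last two
    estimates give coherence and multiplicativity: the constant for contractions does
    not depend on the degree, and the one for products does not when the first
    factor has degree 1, as for multiplication by a functional. *)
Record uniform_norms (alpha : tensor_norms R) : Prop := UniformNorms {
  tn_ge0 : forall k (E : completeNormedModType R[i]) u, 0 <= alpha k E u ;
  tn_add : forall k (E : completeNormedModType R[i]) (u v : symtensor k E),
    alpha k E (u + v) <= alpha k E u + alpha k E v ;
  tn_scale : forall k (E : completeNormedModType R[i]) a (u : symtensor k E),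
    alpha k E (a *: u) <= rnorm a * alpha k E u ;
  tn_dpow : forall k (E : completeNormedModType R[i]) (x : E),
    alpha k E (dpow k x) <= rnorm x ^+ k ;
  tn_eval : forall k (E : completeNormedModType R[i]) (g : dual E) (u : symtensor k E),
    rnorm (u (mlin_pow k g)) <= rnorm g ^+ k * alpha k E u ;
  tn_map : forall k (E F : completeNormedModType R[i]) (T : blin E F) (u : symtensor k E),
    alpha k F (symtensor_map T u) <= rnorm T ^+ k * alpha k E u ;
  tn_contr : forall k (E : completeNormedModType R[i]) (g : dual E)
      (u : symtensor k.+1 E), (0 < k)%N ->
    alpha k E (contr g u) <= expR 1 * rnorm g * alpha k.+1 E u ;
  tn_prod : forall k l (E : completeNormedModType R[i]) (u : symtensor k E)
      (v : symtensor l E), (0 < l)%N ->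
    alpha (k + l)%N E (tprod u v) <= growth R k l * alpha k E u * alpha l E v }.

Lemma contrZ k (E : normedModType R[i]) (a : R[i]) (g : dual E) (u : symtensor k.+1 E) :
  contr (a *: g) u = a *: contr g u.
Proof.
apply: symtensor_ext => A; rewrite symtensorZE.
rewrite -[LHS]/(u (mlin_prod (mlin_pow 1 (a *: g)) A)).
rewrite -[contr g u A]/(u (mlin_prod (mlin_pow 1 g) A)).
rewrite (@symtensor_comb _ k.+1 _ u _ _ [:: tt] (fun=> a)
  (fun=> mlin_prod (mlin_pow 1 g) A)); first by rewrite big_seq1.
by move=> x; rewrite big_seq1/= !big_ord1 mulrA.
Qed.

Lemma pow_scale k (E : normedModType R[i]) (a : R[i]) (g : dual E) (u : symtensor k E) :
  u (mlin_pow k (a *: g)) = a ^+ k * u (mlin_pow k g).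
Proof.
rewrite (@symtensor_comb _ k _ u _ _ [:: tt] (fun=> a ^+ k) (fun=> mlin_pow k g)).
  by rewrite big_seq1.
by move=> x; rewrite big_seq1/= !prodr_const card_ord -exprMn.
Qed.

End NormLemmas.

Section Projective.
Variable R : realType.
Implicit Type E : completeNormedModType R[i].

Lemma projective_le k E (u : symtensor k E) (M : R) : 0 <= M ->
  (forall A : mlin k E, polynomials k (fun x : E => A (fun=> x)) ->
     (forall x, rnorm x <= 1 -> rnorm (A (fun=> x)) <= 1) -> rnorm (u A) <= M) ->
  projective_norm u <= M.
Proof.
move=> M0 h; apply: sup_le_nneg => // _ [A /= [Ap A1] <-]; apply: h => // x.
by rewrite -!norm_le1; exact: A1.
Qed.

Lemma projective_ub k E (u : symtensor k E) (A : mlin k E) (c : R) : 0 <= c ->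
  polynomials k (fun x : E => A (fun=> x)) ->
  (forall x, rnorm x <= 1 -> rnorm (A (fun=> x)) <= c) ->
  rnorm (u A) <= c * projective_norm u.
Proof.
move=> c0 Ap Ac; have [s us] := symtensor_rep u.
have [c0'|cn0] := eqVneq c 0.
  rewrite us big1 ?rnorm0 ?c0' ?mul0r// => p _.
  rewrite (_ : A _ = 0) ?mulr0//; apply: rnorm0_eq0; apply/eqP.
  by rewrite eq_le rnorm_ge0 andbT (le_trans (mlin_homogeneous_bound Ac _))// c0' mul0r.
have cp : 0 < c by rewrite lt_def cn0.
pose B := mlin_lin (c^-1)%:C A (mlin_zero k E).
have uB : u B = (c^-1)%:C * u A.
  rewrite (@symtensor_comb _ k _ u B _ [:: tt] (fun=> (c^-1)%:C) (fun=> A)).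
    by rewrite big_seq1.
  by move=> x; rewrite big_seq1/= addr0.
rewrite -ler_pdivrMl// -[c^-1]ger0_norm ?invr_ge0// -rnorm_abs -rnorm_scalarM -uB.
apply: ub_le_sup.
  exists (\sum_(p <- s) rnorm p.1 * rnorm p.2 ^+ k) => _ [D [_ D1] <-].
  rewrite us (le_trans (rnorm_sum _ _ _))//; apply: ler_sum => p _.
  rewrite rnorm_scalarM ler_wpM2l ?rnorm_ge0//.
  rewrite -[leRHS]mul1r; apply: mlin_homogeneous_bound => x x1.
  by rewrite -norm_le1 D1// norm_le1.
exists B => //; split.
  exact: eq_polynomials (polynomials_lin (c^-1)%:C Ap (polynomials0 k E)).
move=> x; rewrite !norm_le1 => x1; rewrite /= addr0 rnorm_scalarM rnorm_abs.
by rewrite ger0_norm ?invr_ge0// ler_pdivrMl// mulr1 Ac.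
Qed.

Lemma projective_ge0 k E (u : symtensor k E) : 0 <= projective_norm u.
Proof.
have := @projective_ub k E u (mlin_zero k E) 1 ler01 (polynomials0 k E).
rewrite mul1r => h; apply: le_trans (rnorm_ge0 _) (h _) => x _ /=.
by rewrite rnorm0 ler01.
Qed.

Lemma mixed_bound k l E (A : mlin (k + l) E) x y : (0 < l)%N ->
  (forall x, rnorm x <= 1 -> rnorm (A (fun=> x)) <= 1) ->
  rnorm x <= 1 -> rnorm y <= 1 ->
  rnorm (asym A (tjoin (fun _ : 'I_k => x) (fun _ : 'I_l => y))) <= growth R k l.
Proof.
move=> l0 A1 x1 y1; have [w [t [wt ->]]] := mixed_polarization R k l0.
apply: le_trans wt; rewrite (le_trans (rnorm_sum _ _ _))//.
apply: ler_sum => j _; rewrite rnorm_scalarM ler_wpM2l ?rnorm_ge0//.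
apply: (le_trans (mlin_homogeneous_bound A1 _)); rewrite mul1r.
rewrite lerXn2r ?nnegrE ?addr_ge0 ?rnorm_ge0// (le_trans (rnormD _ _))// lerD//.
by rewrite rnormZ ler_piMr ?rnorm_ge0.
Qed.

(** Products are estimated one factor at a time: <uv, A> pairs u with the polynomial
    x |-> <v, A(x, ..., x, .)>, whose values are bounded by the norm of v and the mixed
    values of A. *)
Lemma projective_uniform : uniform_norms (@projective_norm R).
Proof.
split.
- exact: projective_ge0.
- move=> k E u v; apply: projective_le => [|A Ap A1].
    by rewrite addr_ge0 ?projective_ge0.
  rewrite symtensorDE (le_trans (rnormD _ _))// lerD//.
    by rewrite -[leRHS]mul1r projective_ub.
  by rewrite -[leRHS]mul1r projective_ub.
- move=> k E a u; apply: projective_le => [|A Ap A1].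
    by rewrite mulr_ge0 ?rnorm_ge0 ?projective_ge0.
  rewrite symtensorZE rnorm_scalarM ler_wpM2l ?rnorm_ge0//.
  by rewrite -[leRHS]mul1r projective_ub.
- move=> k E x; apply: projective_le => [|A Ap A1]; first by rewrite exprn_ge0 ?rnorm_ge0.
  rewrite -[leRHS]mul1r -[dpow _ _ _]/(A (fun=> x)); exact: mlin_homogeneous_bound.
- move=> k E g u; apply: projective_ub => [||x x1]; first by rewrite exprn_ge0 ?rnorm_ge0.
    exact: polynomials_pow.
  rewrite /= prodr_const card_ord rnormX lerXn2r ?nnegrE ?rnorm_ge0//.
  by rewrite (le_trans (le_blin _ _))// ler_piMr ?rnorm_ge0.
- move=> k E F T u; apply: projective_le => [|A Ap A1].
    by rewrite mulr_ge0 ?exprn_ge0 ?rnorm_ge0 ?projective_ge0.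
  rewrite symtensor_mapE; apply: projective_ub; first by rewrite exprn_ge0 ?rnorm_ge0.
    exact: (polynomials_comp T Ap).
  move=> x x1; apply: (le_trans (mlin_homogeneous_bound A1 (T x))); rewrite mul1r.
  rewrite lerXn2r ?nnegrE ?rnorm_ge0//.
  by rewrite (le_trans (le_blin _ _))// ler_piMr ?rnorm_ge0.
- move=> k E g u k0.
  apply: (@le_trans _ _ (rnorm g * projective_norm u)); last first.
    rewrite -[expR 1 * _]mulrC -mulrA ler_wpM2l ?rnorm_ge0// ler_peMl ?projective_ge0//.
    by apply: le_trans (expR1_ge2 R); rewrite ler1n.
  apply: projective_le => [|A Ap A1]; first by rewrite mulr_ge0 ?rnorm_ge0 ?projective_ge0.
  apply: (@projective_ub k.+1 E u (mlin_prod (mlin_pow 1 g) A)); first exact: rnorm_ge0.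
    have g1 : polynomials 1 g.
      split; first exact: blin_continuous.
      by exists (mlin_pow 1 g) => x /=; rewrite big_ord1.
    by apply: eq_polynomials (polynomials_prod g1 Ap) => x /=; rewrite big_ord1.
  move=> x x1; rewrite /= big_ord1 rnorm_scalarM -[leRHS]mulr1.
  apply: ler_pM; rewrite ?rnorm_ge0 ?A1//.
  by rewrite (le_trans (le_blin _ _))// ler_piMr ?rnorm_ge0.
- move=> k l E u v l0; have g0 : 0 <= growth R k l by rewrite (le_trans ler01)// growth_ge1.
  apply: projective_le => [|A Ap A1]; first by rewrite !mulr_ge0 ?projective_ge0.
  rewrite -[tprod u v A]/(u (tprod_inner v (mlin_sym A))) mulrAC.
  apply: projective_ub; first by rewrite mulr_ge0 ?projective_ge0.
    split; last by exists (tprod_inner v (mlin_sym A)).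
    have [s vs] := symtensor_rep v; have [w [t [_ wt]]] := mixed_polarization R k l0.
    rewrite (_ : (fun x : E => _) =
        (fun x => \sum_(p <- s) p.1 * \sum_j w j * A (fun=> x + t j *: p.2))); last first.
      apply/funext => x; rewrite /= vs; apply: eq_bigr => p _; congr (_ * _).
      by rewrite -wt.
    move=> x; apply: cvg_big => [|p _]; first exact: add_continuous.
    apply: cvgM; first exact: cvg_cst.
    apply: cvg_big => [|j _]; first exact: add_continuous.
    apply: cvgM; first exact: cvg_cst.
    apply: (@continuous_comp _ _ _ (fun x => x + t j *: p.2) (fun z => A (fun=> z))).
      by apply: cvgD; [exact: cvg_id|exact: cvg_cst].
    exact: Ap.1.
  move=> x x1; rewrite /=; apply: projective_ub => // [|y y1].
    exact: (polynomials_mixed x l0 Ap).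
  exact: (mixed_bound l0 A1 x1 y1).
Qed.

End Projective.

Section Injective.
Variable R : realType.
Implicit Type E : completeNormedModType R[i].

Lemma injective_le k E (u : symtensor k E) (M : R) : 0 <= M ->
  (forall g : dual E, rnorm g <= 1 -> rnorm (u (mlin_pow k g)) <= M) ->
  injective_norm u <= M.
Proof.
by move=> M0 h; apply: sup_le_nneg => // _ [g /= g1 <-]; apply: h; rewrite -norm_le1.
Qed.

Lemma injective_ub1 k E (u : symtensor k E) (g : dual E) : rnorm g <= 1 ->
  rnorm (u (mlin_pow k g)) <= injective_norm u.
Proof.
move=> g1; apply: ub_le_sup; last by exists g => //=; rewrite norm_le1.
have [s us] := symtensor_rep u.
exists (\sum_(p <- s) rnorm p.1 * rnorm p.2 ^+ k) => _ [f /= f1 <-].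
rewrite us (le_trans (rnorm_sum _ _ _))//; apply: ler_sum => p _.
rewrite rnorm_scalarM ler_wpM2l ?rnorm_ge0//= prodr_const card_ord rnormX.
rewrite lerXn2r ?nnegrE ?rnorm_ge0// (le_trans (le_blin _ _))//.
by rewrite ler_piMl ?rnorm_ge0// -norm_le1.
Qed.

Lemma injective_ub k E (u : symtensor k E) (g : dual E) :
  rnorm (u (mlin_pow k g)) <= rnorm g ^+ k * injective_norm u.
Proof.
have [h h1 gh] := unit_decomp g; rewrite {1}gh pow_scale rnorm_scalarM rnormX rnorm_abs.
rewrite ger0_norm ?rnorm_ge0// ler_wpM2l ?exprn_ge0 ?rnorm_ge0//.
exact: injective_ub1.
Qed.

Lemma injective_ge0 k E (u : symtensor k E) : 0 <= injective_norm u.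
Proof.
apply: (le_trans (rnorm_ge0 (u (mlin_pow k (0 : dual E))))); apply: injective_ub1.
by rewrite rnorm0 ler01.
Qed.

(** Contraction, tested on g^k, in terms of evaluations at powers of functionals. *)
Lemma contr_pow k E (f g : dual E) (u : symtensor k.+1 E) w t :
  (forall (V : lmodType R[i]) (A : mlin (1 + k) V) (x y : V),
      asym A (tjoin (fun _ : 'I_1 => x) (fun _ : 'I_k => y)) =
      \sum_(j < (1 + k).+1) w j * A (fun=> x + t j *: y)) ->
  contr f u (mlin_pow k g) = \sum_j w j * u (mlin_pow k.+1 (f + t j *: g)).
Proof.
move=> wt; apply: (@symtensor_comb _ k.+1) => x.
transitivity (asym (mlin_pow (1 + k) (dual_eval x))
    (tjoin (fun _ : 'I_1 => f) (fun _ : 'I_k => g))).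
  rewrite asym_id/= => [|s]; last by rewrite [RHS](reindex_perm s).
  rewrite (@big_split_ord _ _ _ 1 k)/= !big_ord1 (@tjoin_l _ _ 1 k); congr (_ * _).
  by apply: eq_bigr => i _; rewrite (@tjoin_r _ _ 1 k).
exact: wt.
Qed.

(** The contraction of u by f, evaluated at g^k, is a mixed value of the polynomial
    g |-> <u, g^(k+1)> on the dual space. *)
Lemma injective_uniform : uniform_norms (@injective_norm R).
Proof.
split.
- exact: injective_ge0.
- move=> k E u v; apply: injective_le => [|g g1]; first by rewrite addr_ge0 ?injective_ge0.
  by rewrite symtensorDE (le_trans (rnormD _ _))// lerD// injective_ub1.
- move=> k E a u; apply: injective_le => [|g g1].
    by rewrite mulr_ge0 ?rnorm_ge0 ?injective_ge0.
  by rewrite symtensorZE rnorm_scalarM ler_wpM2l ?rnorm_ge0// injective_ub1.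
- move=> k E x; apply: injective_le => [|g g1]; first by rewrite exprn_ge0 ?rnorm_ge0.
  rewrite -[dpow _ _ _]/(\prod_(i < k) g x) prodr_const card_ord rnormX.
  rewrite lerXn2r ?nnegrE ?rnorm_ge0// (le_trans (le_blin _ _))//.
  by rewrite ler_piMl ?rnorm_ge0.
- by move=> k E g u; exact: injective_ub.
- move=> k E F T u; apply: injective_le => [|g g1].
    by rewrite mulr_ge0 ?exprn_ge0 ?rnorm_ge0 ?injective_ge0.
  rewrite symtensor_mapE (@symtensor_eq _ _ _ u _ (mlin_pow k (bcomp g T)))//.
  rewrite (le_trans (injective_ub _ _))// ler_wpM2r ?injective_ge0//.
  rewrite lerXn2r ?nnegrE ?rnorm_ge0// (le_trans (bcomp_rnorm _ _))//.
  by rewrite ler_piMl ?rnorm_ge0.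
- move=> k E f u k0; have [f' f1 fE] := unit_decomp f.
  rewrite {1}fE contrZ; apply: injective_le => [|g g1].
    by rewrite !mulr_ge0 ?expR_ge0 ?rnorm_ge0 ?injective_ge0.
  rewrite symtensorZE rnorm_scalarM rnorm_abs ger0_norm ?rnorm_ge0//.
  rewrite -[expR 1 * _]mulrC -mulrA ler_wpM2l ?rnorm_ge0//.
  have [w [t [wt wE]]] := mixed_polarization R 1 k0; rewrite (contr_pow _ _ _ wE).
  apply: (le_trans (rnorm_sum _ _ _)).
  apply: (@le_trans _ _ (\sum_j rnorm (w j) * (1 + rnorm (t j)) ^+ (1 + k) *
      injective_norm u)); last first.
    by rewrite -mulr_suml ler_wpM2r ?injective_ge0.
  apply: ler_sum => j _; rewrite rnorm_scalarM -mulrA ler_wpM2l ?rnorm_ge0//.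
  rewrite (le_trans (injective_ub _ _))// ler_wpM2r ?injective_ge0//.
  rewrite lerXn2r ?nnegrE ?addr_ge0 ?rnorm_ge0// (le_trans (rnormD _ _))// lerD//.
  by rewrite rnormZ ler_piMr ?rnorm_ge0.
- move=> k l E u v l0; have g0 : 0 <= growth R k l by rewrite (le_trans ler01)// growth_ge1.
  apply: injective_le => [|g g1]; first by rewrite !mulr_ge0 ?injective_ge0.
  rewrite tprod_pow rnorm_scalarM -mulrA.
  apply: (@le_trans _ _ (injective_norm u * injective_norm v)).
    by apply: ler_pM; rewrite ?rnorm_ge0 ?injective_ub1.
  by rewrite ler_peMl ?growth_ge1// mulr_ge0 ?injective_ge0.
Qed.

End Injective.
(** * The projective and injective associates *)

Lemma sum_fset_split (I : choiceType) (V : zmodType) (h : I -> V) (A B : {fset I}) :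
  (B `<=` A)%fset -> \sum_(i <- A) h i = \sum_(i <- B) h i + \sum_(i <- (A `\` B)%fset) h i.
Proof.
move=> BA; rewrite (big_fsetID _ [in B]); congr (_ + _); apply: eq_fbigl => i.
  by rewrite !inE/= andbC; apply: andb_idr; exact: (fsubsetP BA).
by rewrite !inE/= andbC.
Qed.

Section L1Synthesis.
Variables (R : realType) (I : choiceType) (G : completeNormedModType R[i]).
Variables (g : I -> G) (M : R) (gM : forall i, rnorm (g i) <= M).

Lemma l1_synthesis_cvg (f : l1 R I) :
  cvg (summability.partial_sum (fun i => f i *: g i) @ summability.totally).
Proof.
apply: cauchy_cvg; apply/cauchy_rnormP => e e0.
have M0 : 0 < Num.max 1 M by rewrite lt_max ltr01.
have e'0 : 0 < e / Num.max 1 M by rewrite divr_gt0.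
have [_ [A0 _ <-] fA0] := sup_adherent e'0
  (conj (ex_intro _ _ (ex_intro2 _ _ fset0 Logic.I erefl)) (l1_has_ubound f)).
exists (summability.partial_sum (fun i => f i *: g i) A0).
exists A0 => // A /= A0A; rewrite !partial_sumE.
rewrite (sum_fset_split _ A0A) addrC addKr.
apply: (@le_lt_trans _ _ (Num.max 1 M * \sum_(i <- (A `\` A0)%fset) rnorm (f i))).
  apply: le_trans (rnorm_sum _ _ _) _; rewrite mulr_sumr; apply: ler_sum => b _.
  rewrite rnormZ mulrC ler_wpM2r ?rnorm_ge0// (le_trans (gM b))//.
  by rewrite le_max lexx orbT.
rewrite mulrC -ltr_pdivlMr//.
have := le_l1_norm f A; rewrite (sum_fset_split _ A0A).
by rewrite -lerBrDl => /le_lt_trans; apply; rewrite ltrBlDl -ltrBlDr.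
Qed.

Definition l1_synthesis (f : l1 R I) : G := summability.sum (fun i => f i *: g i).

Lemma l1_synthesisP (f : l1 R I) :
  summability.partial_sum (fun i => f i *: g i) @ summability.totally --> l1_synthesis f.
Proof. exact: l1_synthesis_cvg. Qed.

Lemma l1_synthesis_linear : linear l1_synthesis.
Proof.
move=> a f h; apply: cvg_lim; first exact: norm_hausdorff.
rewrite (_ : summability.partial_sum _ =
  (fun A => a *: summability.partial_sum (fun b => f b *: g b) A +
            summability.partial_sum (fun b => h b *: g b) A)).
  by apply: cvgD; [apply: cvgZr|]; exact: l1_synthesis_cvg.
apply/funext => A; rewrite /summability.partial_sum scaler_sumr -big_split/=.
by apply: eq_bigr => b _; rewrite scalerDl scalerA.
Qed.

Lemma l1_synthesis_bound (f : l1 R I) : rnorm (l1_synthesis f) <= M * rnorm f.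
Proof.
have cT : (fun A => rnorm (summability.partial_sum (fun i => f i *: g i) A))
    @ summability.totally --> rnorm (l1_synthesis f).
  by apply: cvg_rnorm; exact: l1_synthesisP.
rewrite -(cvg_lim (@Rhausdorff R) cT); apply: limr_le.
  by apply/cvg_ex; eexists; exact: cT.
apply: nearW => A; rewrite partial_sumE (le_trans (rnorm_sum _ _ _))//.
have [M0|M0] := leP 0 M.
  rewrite (@le_trans _ _ (M * \sum_(i <- A) rnorm (f i)))//.
    rewrite mulr_sumr; apply: ler_sum => i _.
    by rewrite rnormZ mulrC ler_wpM2r ?rnorm_ge0.
  by rewrite ler_wpM2l// l1_rnormE le_l1_norm.
have I0 (i : I) : False by have := le_trans (rnorm_ge0 (g i)) (gM i); rewrite leNgt M0.
rewrite (_ : f = 0); last by apply/val_inj/funext => i; case: (I0 i).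
by rewrite rnorm0 mulr0 big1// => i; case: (I0 i).
Qed.

End L1Synthesis.

Section L1Basis.
Variables (R : realType) (I : choiceType).

Lemma l1_delta_sum (i : I) (c : R[i]) (A : {fset I}) :
  \sum_(j <- A) rnorm (if j == i then c else 0) <= rnorm c.
Proof.
rewrite (eq_bigr (fun j => if j == i then rnorm c else 0)) => [|j _]; last first.
  by case: ifP; rewrite ?rnorm0.
have [iA|iA] := boolP (i \in A).
  by rewrite (big_fsetD1 i)//= eqxx big1_fset ?addr0// => j; rewrite !inE => /andP[/negbTE ->].
rewrite big1_fset ?rnorm_ge0// => j jA _; case: eqP => // ji; move: iA.
by rewrite -ji jA.
Qed.

Lemma l1_delta_subproof (i : I) (c : R[i]) :
  (fun j => if j == i then c else 0) \in @summable_family R I.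
Proof. by rewrite inE; exists (rnorm c) => _ [A _ <-]; exact: l1_delta_sum. Qed.

Definition l1_delta (i : I) (c : R[i]) : l1 R I := L1 (l1_delta_subproof i c).

Lemma l1_delta_rnorm (i : I) (c : R[i]) : rnorm (l1_delta i c) <= rnorm c.
Proof. by rewrite l1_rnormE; apply: l1_norm_le => A; exact: l1_delta_sum. Qed.

End L1Basis.

Section QuotientMap.
Variables (R : realType).
Implicit Types E F : completeNormedModType R[i].

Lemma l1_quotient_bound E (f : l1 R (unit_ball E)) : rnorm (l1_quotient f) <= 1 * rnorm f.
Proof. exact: (@l1_synthesis_bound _ _ _ _ _ (@unit_ball_rnorm R E)). Qed.

Definition quotient_map E : blin (l1 R (unit_ball E)) E :=
  mkblin (@l1_quotient_linear R E) (@l1_quotient_bound E).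

Lemma quotient_map_rnorm E : rnorm (quotient_map E) <= 1.
Proof. exact: mkblin_rnorm. Qed.

Lemma l1_quotient_delta E (b : unit_ball E) (c : R[i]) :
  l1_quotient (l1_delta b c) = c *: val b.
Proof.
apply: cvg_lim; first exact: norm_hausdorff.
apply: cvg_near_cst; exists [fset b]%fset => // A /= bA; rewrite partial_sumE.
rewrite (big_fsetD1 b) ?(fsubsetP bA) ?inE//= eqxx big1_fset ?addr0// => j.
by rewrite !inE => /andP[/negbTE -> _] _; rewrite scale0r.
Qed.

Lemma l1_lift E (x : E) : exists2 f : l1 R (unit_ball E),
  l1_quotient f = x & rnorm f <= rnorm x.
Proof.
have [y y1 xE] := unit_decomp x; rewrite -norm_le1 in y1.
exists (l1_delta (exist _ y y1) (rnorm x)%:C).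
  by rewrite l1_quotient_delta -xE.
rewrite (le_trans (l1_delta_rnorm _ _))// rnorm_abs ger0_norm//; exact: rnorm_ge0.
Qed.

Lemma symtensor_lift k E (u : symtensor k E) :
  exists v, symtensor_map (@l1_quotient R E) v = u.
Proof.
have [s us] := symtensor_rep u; have /choice[L LE] : forall x : E, exists f, l1_quotient f = x.
  by move=> x; have [f fx _] := l1_lift x; exists f.
exists (\sum_(p <- s) p.1 *: dpow k (L p.2)); apply: symtensor_ext => A.
rewrite symtensor_mapE symtensor_sumE us; apply: eq_bigr => p _.
by rewrite symtensorZE -[dpow _ _ _]/(A (fun=> l1_quotient (L p.2))) LE.
Qed.

(** The basis vector at b is sent to a lift of T b of norm at most ||T||. *)
Lemma l1_lift_operator E F (T : blin E F) :
  exists2 S : blin (l1 R (unit_ball E)) (l1 R (unit_ball F)),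
    rnorm S <= rnorm T & forall f, l1_quotient (S f) = T (l1_quotient f).
Proof.
have /choice[L LE] : forall b : unit_ball E, exists f : l1 R (unit_ball F),
    l1_quotient f = T (val b) /\ rnorm f <= rnorm T.
  move=> b; have [f fE fb] := l1_lift (T (val b)); exists f; split=> //.
  rewrite (le_trans fb)// (le_trans (le_blin _ _))// ler_piMr ?rnorm_ge0//.
  exact: unit_ball_rnorm.
have LT b := (LE b).2.
exists (mkblin (l1_synthesis_linear LT) (l1_synthesis_bound LT)).
  by apply: mkblin_rnorm; exact: rnorm_ge0.
move=> f.
have c1 : summability.partial_sum (fun b => f b *: T (val b)) @ summability.totally -->
    quotient_map F (l1_synthesis L f).
  rewrite (_ : summability.partial_sum _ = quotient_map F \o
     summability.partial_sum (fun b => f b *: L b)); last first.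
    apply/funext => A; rewrite /= /summability.partial_sum linear_sum.
    by apply: eq_bigr => b _; rewrite linearZ/=; congr (_ *: _); rewrite -(LE (val b)).1.
  apply: continuous_cvg; first exact: blin_continuous.
  exact: (l1_synthesisP LT).
have c2 : summability.partial_sum (fun b => f b *: T (val b)) @ summability.totally -->
    T (l1_quotient f).
  rewrite (_ : summability.partial_sum _ = T \o
     summability.partial_sum (fun b => f b *: val b)); last first.
    apply/funext => A; rewrite /= /summability.partial_sum linear_sum.
    by apply: eq_bigr => b _; rewrite linearZ.
  apply: continuous_cvg; first exact: blin_continuous.
  exact: l1_quotient_cvg.
exact: (cvg_unique (@norm_hausdorff _ F) c1 c2).
Qed.

End QuotientMap.

Section Associates.
Variable R : realType.
Variable beta : tensor_norms R.
Hypothesis betaU : uniform_norms beta.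
Implicit Types E F : completeNormedModType R[i].

Lemma inf_mulr_ge (A : set R) (c x : R) : A !=set0 -> 0 <= c ->
  (forall r, A r -> x <= c * r) -> x <= c * inf A.
Proof.
move=> A0 c0 Ax; have [c0'|cn0] := eqVneq c 0.
  by have [r /Ax] := A0; rewrite c0' !mul0r.
have cp : 0 < c by rewrite lt_def cn0.
rewrite -ler_pdivrMl//; apply: lb_le_inf => // r /Ax; by rewrite -ler_pdivrMl.
Qed.

Lemma projective_associate_nonempty k E (u : symtensor k E) :
  [set @beta k (l1 R (unit_ball E)) v | v in
    [set v | symtensor_map (@l1_quotient R E) v = u]] !=set0.
Proof. by have [v vu] := symtensor_lift u; exists (@beta k _ v); exists v. Qed.

Lemma projective_associate_le k E (v : symtensor k (l1 R (unit_ball E))) :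
  projective_associate beta (symtensor_map (@l1_quotient R E) v) <= @beta k _ v.
Proof.
apply: ge_inf; last by exists v.
by exists 0 => _ [w _ <-]; exact: (tn_ge0 betaU).
Qed.

Lemma projective_associate_ge k E (u : symtensor k E) (c x : R) : 0 <= c ->
  (forall v, symtensor_map (@l1_quotient R E) v = u -> x <= c * @beta k _ v) ->
  x <= c * projective_associate beta u.
Proof.
move=> c0 h; apply: inf_mulr_ge => //; first exact: projective_associate_nonempty.
by move=> _ [v vu <-]; exact: h.
Qed.

Lemma projective_associate_ge0 k E (u : symtensor k E) : 0 <= projective_associate beta u.
Proof.
rewrite -[leRHS]mul1r; apply: projective_associate_ge => // v _.
by rewrite mul1r (tn_ge0 betaU).
Qed.

(** Every estimate for the quotient norm is the estimate of a lift. *)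
Lemma projective_associate_uniform : uniform_norms (projective_associate beta).
Proof.
split.
- exact: projective_associate_ge0.
- move=> k E u v; rewrite -lerBlDr -[leRHS]mul1r.
  apply: projective_associate_ge => // u' u'E; rewrite mul1r lerBlDr -lerBlDl -[leRHS]mul1r.
  apply: projective_associate_ge => // v' v'E; rewrite mul1r lerBlDl.
  rewrite -u'E -v'E -symtensor_mapD (le_trans (projective_associate_le _))//.
  exact: (tn_add betaU).
- move=> k E a u; apply: projective_associate_ge => [|u' u'E]; first exact: rnorm_ge0.
  rewrite -u'E -symtensor_mapZ (le_trans (projective_associate_le _))//.
  exact: (tn_scale betaU).
- move=> k E x; have [f fx fle] := l1_lift x.
  rewrite -fx -symtensor_map_dpow (le_trans (projective_associate_le _))//.
  rewrite (le_trans (tn_dpow betaU _ _))// lerXn2r ?nnegrE ?rnorm_ge0// fx.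
  exact: fle.
- move=> k E g u; apply: projective_associate_ge => [|v <-].
    by rewrite exprn_ge0 ?rnorm_ge0.
  rewrite symtensor_mapE (@symtensor_eq _ _ _ v _ (mlin_pow k (bcomp g (quotient_map E))))//.
  rewrite (le_trans (tn_eval betaU _ _))// ler_wpM2r ?(tn_ge0 betaU)//.
  rewrite lerXn2r ?nnegrE ?rnorm_ge0// (le_trans (bcomp_rnorm _ _))//.
  by rewrite ler_piMr ?rnorm_ge0 ?quotient_map_rnorm.
- move=> k E F T u; apply: projective_associate_ge => [|v <-].
    by rewrite exprn_ge0 ?rnorm_ge0.
  have [S ST SE] := l1_lift_operator T.
  rewrite (_ : symtensor_map T _ = symtensor_map (@l1_quotient R F) (symtensor_map S v)).
    rewrite (le_trans (projective_associate_le _))// (le_trans (tn_map betaU _ _))//.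
    by rewrite ler_wpM2r ?(tn_ge0 betaU)// lerXn2r ?nnegrE ?rnorm_ge0.
  apply: symtensor_ext => A; rewrite !symtensor_mapE; apply: symtensor_eq => x /=.
  by congr (A _); apply/funext => i /=; rewrite SE.
- move=> k E g u k0; apply: projective_associate_ge => [|v <-].
    by rewrite mulr_ge0 ?expR_ge0 ?rnorm_ge0.
  rewrite -(@symtensor_map_contr _ _ _ _ _ _ (bcomp g (quotient_map E)))//.
  rewrite (le_trans (projective_associate_le _))// (le_trans (tn_contr betaU _ _ k0))//.
  rewrite ler_wpM2r ?(tn_ge0 betaU)// ler_wpM2l ?expR_ge0// (le_trans (bcomp_rnorm _ _))//.
  by rewrite ler_piMr ?rnorm_ge0 ?quotient_map_rnorm.
- move=> k l E u v l0; have g0 : 0 <= growth R k l by rewrite (le_trans ler01)// growth_ge1.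
  apply: projective_associate_ge => [|v' <-].
    by rewrite mulr_ge0 ?projective_associate_ge0.
  rewrite mulrAC; apply: projective_associate_ge => [|u' <-].
    by rewrite mulr_ge0 ?(tn_ge0 betaU).
  rewrite -symtensor_map_tprod (le_trans (projective_associate_le _))//.
  by rewrite mulrAC; exact: (tn_prod betaU).
Qed.

Lemma linf_embed_bound E (x : E) : rnorm (@linf_embed R E x) <= 1 * rnorm x.
Proof.
rewrite mul1r linf_rnormE; apply: linf_norm_le => [|b]; first exact: rnorm_ge0.
rewrite (le_trans (le_blin _ _))// ler_piMl ?rnorm_ge0//; exact: unit_ball_rnorm.
Qed.

(** The coordinate of l_oo(B_E') at g / ||g|| restricts to g / ||g|| on E. *)
Lemma linf_extend E (g : dual E) :
  exists2 G : dual (linf R (unit_ball (dual E))),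
    rnorm G <= rnorm g & forall x, G (linf_embed x) = g x.
Proof.
have [h h1 gE] := unit_decomp g; rewrite -norm_le1 in h1.
pose f (z : linf R (unit_ball (dual E))) : R[i] := (rnorm g)%:C * z (exist _ h h1).
have fl : linear f.
  move=> a x y; rewrite -[LHS]/((rnorm g)%:C * (a * x (exist _ h h1) + y (exist _ h h1))).
  by rewrite mulrDr mulrCA.
have fM z : rnorm (f z) <= rnorm g * rnorm z.
  rewrite rnorm_scalarM rnorm_abs ger0_norm ?rnorm_ge0// ler_wpM2l ?rnorm_ge0//.
  by rewrite linf_rnormE le_linf_norm.
exists (mkblin fl fM); first by apply: mkblin_rnorm; exact: rnorm_ge0.
by move=> x; rewrite [in RHS]gE.
Qed.

(** Each coordinate of x |-> T x in l_oo(B_F') is a functional on E; extend them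
    separately. *)
Lemma linf_extend_operator E F (T : blin E F) :
  exists2 S : blin (linf R (unit_ball (dual E))) (linf R (unit_ball (dual F))),
    rnorm S <= rnorm T & forall x, S (linf_embed x) = linf_embed (T x).
Proof.
have /choice[G GE] : forall b : unit_ball (dual F),
    exists G : dual (linf R (unit_ball (dual E))),
      rnorm G <= rnorm T /\ forall x, G (linf_embed x) = val b (T x).
  move=> b; have [G Gb GE] := linf_extend (bcomp (val b) T); exists G; split=> //.
  rewrite (le_trans Gb)// (le_trans (bcomp_rnorm _ _))// ler_piMl ?rnorm_ge0//.
  exact: unit_ball_rnorm.
have Gb z b : rnorm (G b z) <= rnorm T * rnorm z.
  by rewrite (le_trans (le_blin _ _))// ler_wpM2r ?rnorm_ge0//; exact: (GE b).1.
have Gf z : (fun b => G b z) \in @bounded_family R (unit_ball (dual F)).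
  by rewrite inE; exists (rnorm T * rnorm z).
have fl : linear (fun z => Linf (Gf z)).
  by move=> a x y; apply/val_inj/funext => b /=; rewrite linearP.
have fM z : rnorm (Linf (Gf z)) <= rnorm T * rnorm z.
  rewrite linf_rnormE; apply: linf_norm_le => [|b]; last exact: Gb.
  by rewrite mulr_ge0 ?rnorm_ge0.
exists (mkblin fl fM); first by apply: mkblin_rnorm; exact: rnorm_ge0.
by move=> x; apply/val_inj/funext => b /=; rewrite (GE b).2.
Qed.

(** Every estimate for the induced norm is the estimate of the image in l_oo(B_E'),
    on which functionals and operators extend without increasing their norm. *)
Lemma injective_associate_uniform : uniform_norms (injective_associate beta).
Proof.
rewrite /injective_associate; split.
- by move=> k E u; exact: (tn_ge0 betaU).
- by move=> k E u v; rewrite symtensor_mapD; exact: (tn_add betaU).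
- by move=> k E a u; rewrite symtensor_mapZ; exact: (tn_scale betaU).
- move=> k E x; rewrite symtensor_map_dpow (le_trans (tn_dpow betaU _ _))//.
  rewrite lerXn2r ?nnegrE ?rnorm_ge0//.
  by have := linf_embed_bound x; rewrite mul1r.
- move=> k E g u; have [G Gg GE] := linf_extend g.
  rewrite (@symtensor_eq _ _ _ u _ (mlin_comp (@linf_embed R E) (mlin_pow k G))); last first.
    by move=> x; apply: eq_bigr => i _; exact/esym/GE.
  rewrite -symtensor_mapE (le_trans (tn_eval betaU _ _))//.
  by rewrite ler_wpM2r ?(tn_ge0 betaU)// lerXn2r ?nnegrE ?rnorm_ge0.
- move=> k E F T u; have [S ST SE] := linf_extend_operator T.
  rewrite (_ : symtensor_map _ _ = symtensor_map S (symtensor_map (@linf_embed R E) u)).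
    rewrite (le_trans (tn_map betaU _ _))// ler_wpM2r ?(tn_ge0 betaU)//.
    by rewrite lerXn2r ?nnegrE ?rnorm_ge0.
  apply: symtensor_ext => A; rewrite !symtensor_mapE; apply: symtensor_eq => x /=.
  by congr (A _); apply/funext => i /=; rewrite SE.
- move=> k E g u k0; have [G Gg GE] := linf_extend g.
  rewrite (@symtensor_map_contr _ _ _ _ _ G); last by move=> x; exact/esym/GE.
  rewrite (le_trans (tn_contr betaU _ _ k0))// ler_wpM2r ?(tn_ge0 betaU)//.
  by rewrite ler_wpM2l ?expR_ge0.
- move=> k l E u v l0; rewrite symtensor_map_tprod; exact: (tn_prod betaU).
Qed.

End Associates.

Lemma natural_uniform (R : realType) (alpha : tensor_norms R) :
  natural_sequence alpha -> uniform_norms alpha.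
Proof.
have pU := projective_uniform R; have iU := injective_uniform R.
case=> //.
- exact: injective_associate_uniform.
- exact: projective_associate_uniform.
- by apply: projective_associate_uniform; exact: injective_associate_uniform.
- by apply: injective_associate_uniform; exact: projective_associate_uniform.
Qed.
(** * Maximal ideals *)

Section Subspaces.
Variables (R : realType) (E : normedModType R[i]).

Lemma zero_submod_closed : submod_closed [pred y : E | y == 0].
Proof. by split=> [|a x y]; rewrite !inE// => /eqP -> /eqP ->; rewrite scaler0 addr0. Qed.

Lemma zero_fd_span : exists n (b : 'I_n -> E), forall x, x \in [pred y : E | y == 0] ->
  exists c : 'I_n -> R[i], x = \sum_i c i *: b i.
Proof.
exists 0, (fun=> 0) => x; rewrite inE => /eqP ->; exists (fun=> 0).
by rewrite big_ord0.
Qed.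

Definition zero_fdsub : fdsub E := FdSub zero_submod_closed zero_fd_span.

Variables (N : fdsub E) (a : E).

Definition adjoin_pred : {pred E} :=
  [pred y | `[< exists c : R[i], exists2 z, z \in fd_pred N & y = c *: a + z >]].

Lemma adjoin_submod_closed : submod_closed adjoin_pred.
Proof.
split=> [|d x y]; rewrite !inE.
  by exists 0, 0; rewrite ?(rpred0 N)// scale0r addr0.
move=> [c [z zN ->]] [c' [z' zN' ->]]; exists (d * c + c'), (d *: z + z').
  by rewrite rpredD// rpredZ.
by rewrite scalerDr scalerA scalerDl addrACA.
Qed.

Lemma adjoin_fd_span : exists n (b : 'I_n -> E), forall x, x \in adjoin_pred ->
  exists c : 'I_n -> R[i], x = \sum_i c i *: b i.
Proof.
have [n [b bN]] := fd_span N.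
exists n.+1, (fun j => if unlift ord0 j is Some i then b i else a) => x.
rewrite inE => -[c [z /bN[d ->] ->]].
exists (fun j => if unlift ord0 j is Some i then d i else c).
rewrite big_ord_recl unlift_none; congr (_ + _).
by apply: eq_bigr => i _; rewrite liftK.
Qed.

Definition adjoin : fdsub E := FdSub adjoin_submod_closed adjoin_fd_span.

Lemma adjoin_in : a \in fd_pred adjoin.
Proof. by rewrite inE; exists 1, 0; rewrite ?(rpred0 N)// scale1r addr0. Qed.

Lemma adjoin_sub x : x \in fd_pred N -> x \in fd_pred adjoin.
Proof. by move=> xN; rewrite inE; exists 0, x; rewrite // scale0r add0r. Qed.

End Subspaces.

Section Image.
Variables (R : realType) (E F : normedModType R[i]) (T : blin E F) (N : fdsub E).

Definition image_pred : {pred F} :=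
  [pred y | `[< exists2 x, x \in fd_pred N & y = T x >]].

Lemma image_submod_closed : submod_closed image_pred.
Proof.
split=> [|d x y]; rewrite !inE; first by exists 0; rewrite ?(rpred0 N)// linear0.
move=> [z zN ->] [z' zN' ->]; exists (d *: z + z'); first by rewrite rpredD// rpredZ.
by rewrite linearP.
Qed.

Lemma image_fd_span : exists n (b : 'I_n -> F), forall x, x \in image_pred ->
  exists c : 'I_n -> R[i], x = \sum_i c i *: b i.
Proof.
have [n [b bN]] := fd_span N; exists n, (T \o b) => x.
rewrite inE => -[z /bN[d ->] ->]; exists d; rewrite linear_sum.
by apply: eq_bigr => i _; rewrite linearZ.
Qed.

Definition image_fdsub : fdsub F := FdSub image_submod_closed image_fd_span.

Lemma image_in x : x \in fd_pred N -> T x \in fd_pred image_fdsub.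
Proof. by move=> xN; rewrite inE; exists x. Qed.

End Image.

Section Adjoint.
Variable R : realType.

Lemma rnorm_fd_val (E : normedModType R[i]) (N : fdsub E) (x : fdspace N) :
  rnorm (fd_val x) = rnorm x.
Proof. by []. Qed.

(** Applied to an operator and the image of a subspace, or to an inclusion of
    subspaces. *)
Lemma restrict_operator (E F : normedModType R[i]) (T : blin E F) (N : fdsub E)
    (N' : fdsub F) : (forall x, x \in fd_pred N -> T x \in fd_pred N') ->
  exists2 S : blin (fdspace N) (fdspace N'),
    rnorm S <= rnorm T & forall x, fd_val (S x) = T (fd_val x).
Proof.
move=> TN; pose f (x : fdspace N) : fdspace N' := FdSpace (TN _ (valP x)).
have fl : linear f by move=> a x y; apply/val_inj; rewrite /= linearP.
have fM x : rnorm (f x) <= rnorm T * rnorm x.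
  by rewrite -rnorm_fd_val (le_trans (le_blin _ _)).
exists (mkblin fl fM) => //; apply: mkblin_rnorm; exact: rnorm_ge0.
Qed.

Lemma adjoint_exists (V W : normedModType R[i]) (S : blin V W) :
  exists2 T : blin (dual W) (dual V), rnorm T <= rnorm S & forall g x, T g x = g (S x).
Proof.
pose f (g : dual W) : dual V := bcomp g S.
have fl : linear f by move=> a g h; apply/val_inj.
have fM g : rnorm (f g) <= rnorm S * rnorm g by rewrite mulrC bcomp_rnorm.
exists (mkblin fl fM) => //; apply: mkblin_rnorm; exact: rnorm_ge0.
Qed.

Lemma id_linear (E : normedModType R[i]) : linear (@id E). Proof. by []. Qed.

Lemma id_bound (E : normedModType R[i]) x : rnorm (@id E x) <= 1 * rnorm x.
Proof. by rewrite mul1r. Qed.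

Definition id_blin (E : normedModType R[i]) : blin E E := mkblin (@id_linear E) (@id_bound E).

Lemma id_blin_rnorm (E : normedModType R[i]) : rnorm (id_blin E) <= 1.
Proof. exact: mkblin_rnorm. Qed.

Lemma eval_blin_exists (V : normedModType R[i]) (x : V) :
  exists2 G : dual (dual V), rnorm G <= rnorm x & forall g, G g = dual_eval x g.
Proof.
have fM (g : dual V) : rnorm (dual_eval x g) <= rnorm x * rnorm g.
  by rewrite mulrC; exact: le_blin.
exists (mkblin (@dual_eval_linear _ _ x) fM) => //.
by apply: mkblin_rnorm; exact: rnorm_ge0.
Qed.

End Adjoint.

Section MaximalIdeal.
Variables (R : realType) (alpha : tensor_norms R).
Hypothesis aU : uniform_norms alpha.
Implicit Types E F : completeNormedModType R[i].

(** For a continuous polynomial P such a u exists and is unique ([restriction_exists],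
    [tensor_poly_inj]); the estimates below identify it with a tensor built from the
    restrictions of other polynomials. *)
Definition represents k E (N : fdsub E) (u : symtensor k (dual (fdspace N)))
  (P : E -> R[i]) : Prop := forall x : fdspace N, tensor_poly u x = P (fd_val x).

Lemma max_norm_ub k E (P : E -> R[i]) (N : fdsub E)
    (u : symtensor k (dual (fdspace N))) :
  ideal_set (max_ideal alpha k) P -> represents u P ->
  @alpha k _ u <= ideal_norm (max_ideal alpha k) P.
Proof. by move=> [_ Pb] uP; apply: ub_le_sup => //; exists N, u. Qed.

Lemma max_norm_le k E (P : E -> R[i]) (M : R) : 0 <= M -> polynomials k P ->
  (forall (N : fdsub E) (u : symtensor k (dual (fdspace N))),
     represents u P -> @alpha k _ u <= M) ->
  ideal_set (max_ideal alpha k) P /\ ideal_norm (max_ideal alpha k) P <= M.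
Proof.
move=> M0 Pp PM; have ubM : ubound (restriction_norms alpha k P) M.
  by move=> _ [N [u [uP ->]]]; exact: PM.
by split; [split=> //; exists M|exact: sup_le_nneg].
Qed.

Lemma max_norm_ge0 k E (P : E -> R[i]) : ideal_set (max_ideal alpha k) P ->
  0 <= ideal_norm (max_ideal alpha k) P.
Proof.
move=> Pm; have [u uP] := restriction_exists (zero_fdsub E) Pm.1.
by rewrite (le_trans _ (max_norm_ub Pm uP))// (tn_ge0 aU).
Qed.

(** Restrict to the line through x. *)
Lemma max_norm_eval k E (P : E -> R[i]) x : ideal_set (max_ideal alpha k) P ->
  rnorm (P x) <= ideal_norm (max_ideal alpha k) P * rnorm x ^+ k.
Proof.
move=> Pm; pose N := adjoin (zero_fdsub E) x.
have [u uP] := restriction_exists N Pm.1.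
pose y : fdspace N := FdSpace (adjoin_in (zero_fdsub E) x).
have [G Gx GE] := eval_blin_exists y.
rewrite -[P x]/(P (fd_val y)) -uP /tensor_poly.
rewrite (@symtensor_eq _ _ _ u _ (mlin_pow k G)); last first.
  by move=> g; apply: eq_bigr => i _; exact/esym/GE.
rewrite (le_trans (tn_eval aU _ _))// mulrC.
apply: ler_pM; rewrite ?exprn_ge0 ?rnorm_ge0 ?(tn_ge0 aU)//; first exact: max_norm_ub.
by rewrite lerXn2r ?nnegrE ?rnorm_ge0// (le_trans Gx).
Qed.

Lemma max_lin k E (a : R[i]) (P Q : E -> R[i]) :
  ideal_set (max_ideal alpha k) P -> ideal_set (max_ideal alpha k) Q ->
  ideal_set (max_ideal alpha k) (a *: P + Q) /\
  ideal_norm (max_ideal alpha k) (a *: P + Q) <=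
    rnorm a * ideal_norm (max_ideal alpha k) P + ideal_norm (max_ideal alpha k) Q.
Proof.
move=> Pm Qm; apply: max_norm_le.
- by rewrite addr_ge0 ?mulr_ge0 ?rnorm_ge0 ?max_norm_ge0.
- by apply: polynomials_lin; [exact: Pm.1|exact: Qm.1].
move=> N u uPQ; have [v vP] := restriction_exists N Pm.1.
have [w wQ] := restriction_exists N Qm.1.
have -> : u = a *: v + w.
  by apply: tensor_poly_inj => x; rewrite tensor_polyD tensor_polyZ uPQ vP wQ.
rewrite (le_trans (tn_add aU _ _))// lerD//; last exact: max_norm_ub.
rewrite (le_trans (tn_scale aU _ _))// ler_wpM2l ?rnorm_ge0//; exact: max_norm_ub.
Qed.

Lemma max0 k E : ideal_set (max_ideal alpha k) (0 : E -> R[i]) /\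
  ideal_norm (max_ideal alpha k) (0 : E -> R[i]) <= 0.
Proof.
apply: max_norm_le => //; first exact: polynomials0.
move=> N u u0; have -> : u = 0 *: u.
  by apply: tensor_poly_inj => x; rewrite tensor_polyZ u0 mul0r.
by rewrite (le_trans (tn_scale aU _ _))// rnorm0 mul0r.
Qed.

Lemma max_norm_comp k E F (T : blin F E) (P : E -> R[i]) :
  ideal_set (max_ideal alpha k) P ->
  ideal_set (max_ideal alpha k) (P \o T) /\
  ideal_norm (max_ideal alpha k) (P \o T) <= ideal_norm (max_ideal alpha k) P * rnorm T ^+ k.
Proof.
move=> Pm; apply: max_norm_le.
- by rewrite mulr_ge0 ?exprn_ge0 ?rnorm_ge0 ?max_norm_ge0.
- by apply: polynomials_comp; exact: Pm.1.
move=> N u uP; have [v vP] := restriction_exists (image_fdsub T N) Pm.1.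
have [S ST SE] := restrict_operator (@image_in _ _ _ T N).
have [A AS AE] := adjoint_exists S.
have -> : u = symtensor_map A v.
  apply: tensor_poly_inj => x.
  rewrite (@tensor_poly_map _ _ _ _ A _ x (S x)) => [|g]; last exact: AE.
  by rewrite uP vP/= SE.
rewrite (le_trans (tn_map aU _ _))// mulrC.
apply: ler_pM; rewrite ?exprn_ge0 ?rnorm_ge0 ?(tn_ge0 aU)//; first exact: max_norm_ub.
by rewrite lerXn2r ?nnegrE ?rnorm_ge0// (le_trans AS).
Qed.

Lemma max_norm_prod k l E (P Q : E -> R[i]) : (0 < l)%N ->
  ideal_set (max_ideal alpha k) P -> ideal_set (max_ideal alpha l) Q ->
  ideal_set (max_ideal alpha (k + l)) (fun x => P x * Q x) /\
  ideal_norm (max_ideal alpha (k + l)) (fun x => P x * Q x) <=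
    growth R k l * ideal_norm (max_ideal alpha k) P * ideal_norm (max_ideal alpha l) Q.
Proof.
move=> l0 Pm Qm; have g0 : 0 <= growth R k l by rewrite (le_trans ler01)// growth_ge1.
apply: max_norm_le.
- by rewrite !mulr_ge0 ?max_norm_ge0.
- by apply: polynomials_prod; [exact: Pm.1|exact: Qm.1].
move=> N u uPQ; have [v vP] := restriction_exists N Pm.1.
have [w wQ] := restriction_exists N Qm.1.
have -> : u = tprod v w.
  by apply: tensor_poly_inj => x; rewrite tensor_poly_prod uPQ vP wQ.
rewrite (le_trans (tn_prod aU _ _ l0))// -!mulrA ler_wpM2l//.
by apply: ler_pM; rewrite ?(tn_ge0 aU)//; exact: max_norm_ub.
Qed.

(** To contract the restriction to N by a vector a outside N, restrict to N + <a>
    first. *)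
Lemma max_norm_contract k E (P : E -> R[i]) a : (0 < k)%N ->
  ideal_set (max_ideal alpha k.+1) P ->
  ideal_set (max_ideal alpha k) (contract k P a) /\
  ideal_norm (max_ideal alpha k) (contract k P a) <=
    expR 1 * ideal_norm (max_ideal alpha k.+1) P * rnorm a.
Proof.
move=> k0 Pm; apply: max_norm_le.
- by rewrite !mulr_ge0 ?expR_ge0 ?rnorm_ge0 ?max_norm_ge0.
- by apply: polynomials_contract => //; exact: Pm.1.
move=> N u uP; pose N' := adjoin N a; pose a' : fdspace N' := FdSpace (adjoin_in N a).
have [v vP] := restriction_exists N' Pm.1.
have [G Ga GE] := eval_blin_exists a'.
have [S S1 SE] := restrict_operator (T := id_blin E) (@adjoin_sub _ _ N a).
have [A AS AE] := adjoint_exists S.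
have -> : u = symtensor_map A (contr G v).
  apply: tensor_poly_inj => x; rewrite (@tensor_poly_map _ _ _ _ A _ x (S x)) => [|g]; last exact: AE.
  rewrite uP.
  have -> : contr G v = contr (dual_eval a') v.
    apply: symtensor_ext => B; apply: (@symtensor_eq _ k.+1) => g /=.
    by rewrite !big_ord1 GE.
  have [B PB] := Pm.1.2.
  rewrite tensor_poly_contr (contractE (A := mlin_comp (@fd_val _ _ N') B)); last first.
    by move=> y; rewrite vP PB.
  rewrite asym_comp (contractE (A := B))//; congr (asym B _); apply/esym.
  apply: (@tjoin_eq _ _ 1 k) => i /=; first by rewrite (@tjoin_l _ _ 1 k).
  by rewrite (@tjoin_r _ _ 1 k) SE.
rewrite (le_trans (tn_map aU _ _))//.
apply: (@le_trans _ _ (1 * @alpha k _ (contr G v))).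
  rewrite ler_wpM2r ?(tn_ge0 aU)// exprn_ile1 ?rnorm_ge0//.
  by rewrite (le_trans AS)// (le_trans S1)// id_blin_rnorm.
rewrite mul1r (le_trans (tn_contr aU _ _ k0))// mulrAC.
apply: ler_pM; rewrite ?mulr_ge0 ?expR_ge0 ?rnorm_ge0 ?(tn_ge0 aU)//.
rewrite ler_wpM2l ?expR_ge0//; exact: max_norm_ub.
Qed.

End MaximalIdeal.
Section PointwiseLimits.
Variable R : realType.

Lemma dist_sub_le (W : normedModType R[i]) (x y z : W) : rnorm (x - z) <= rnorm (x - y) + rnorm (y - z).
Proof. by rewrite -[X in rnorm X <= _](_ : (x - y) + (y - z) = _) ?rnormD// addrA subrK. Qed.

(** By the polarization formula the symmetric forms converge pointwise as well, and
    multilinearity passes to the limit. *)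
Lemma polynomials_pointwise_form k (E : normedModType R[i]) (u : nat -> E -> R[i])
    (P : E -> R[i]) :
  (forall n, polynomials k (u n)) -> (forall x, (fun n => u n x) @ \oo --> P x) ->
  exists A : mlin k E, forall x, P x = A (fun=> x).
Proof.
move=> up uP; have /choice[A AE] : forall n, exists A : mlin k E, forall x, u n x = A (fun=> x).
  by move=> n; exact: (up n).2.
pose B (v : 'I_k -> E) := (k`!%:R)^-1 *
  \sum_(S : {set 'I_k}) (-1) ^+ (k - #|S|) * P (\sum_(i in S) v i).
have AB v : (fun n => asym (A n) v) @ \oo --> B v.
  under eq_fun do rewrite polarization.
  apply: cvgM; first exact: cvg_cst.
  apply: cvg_big => [|S _]; first exact: add_continuous.
  apply: cvgM; first exact: cvg_cst.
  by under eq_fun do rewrite -AE; exact: uP.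
have Bm : multilinear B.
  move=> i x a p q; apply: (cvg_unique (@norm_hausdorff _ R[i]) (AB _)).
  rewrite (_ : (fun n => asym (A n) _) =
      (fun n => a * asym (A n) (@dfwith _ (fun=> E) x i p) +
                asym (A n) (@dfwith _ (fun=> E) x i q))); last first.
    by apply/funext => n; exact: asym_multilinear.
  by apply: cvgD; [apply: cvgM; [exact: cvg_cst|exact: AB]|exact: AB].
exists (MLin Bm) => x /=; apply: (cvg_unique (@norm_hausdorff _ R[i]) _ (AB (fun=> x))).
rewrite (_ : (fun n => asym (A n) _) = (fun n => u n x)); first exact: uP.
by apply/funext => n; rewrite asym_diag AE.
Qed.

(** The hypothesis says that some u n is close to P uniformly on each ball. *)
Lemma locally_uniform_continuous (E : normedModType R[i]) (u : nat -> E -> R[i])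
    (P : E -> R[i]) k :
  (forall n, continuous (u n)) ->
  (forall e : R, 0 < e -> exists n, forall x, rnorm (P x - u n x) <= e * rnorm x ^+ k) ->
  continuous P.
Proof.
move=> uc uP x; apply/cvg_rnormP => e e0.
pose r := (rnorm x + 1) ^+ k.
have r0 : 0 < r by rewrite exprn_gt0// ltr_wpDl ?rnorm_ge0.
have e'0 : 0 < e / 4 / r by rewrite !divr_gt0.
have [n un] := uP _ e'0.
have unr y : rnorm y <= rnorm x + 1 -> rnorm (P y - u n y) <= e / 4.
  move=> yx; apply: (le_trans (un y)); rewrite mulrAC ler_pdivrMr// ler_wpM2l//.
    by rewrite divr_ge0// ltW.
  by rewrite /r lerXn2r ?nnegrE ?addr_ge0 ?rnorm_ge0.
have /cvg_rnormP h1 := uc n x.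
have /(cvg_rnormP (F := nbhs x) id x).1 h2 : y @[y --> x] --> x by exact: cvg_id.
have e4 : 0 < e / 4 by rewrite divr_gt0.
apply: filterS2 (h1 _ e4) (h2 _ ltr01) => y uy /= xy.
have yx : rnorm y <= rnorm x + 1.
  rewrite -[y in leLHS](subrK x) addrC (le_trans (rnormD _ _))// lerD2l rnormB.
  exact: ltW.
have Px := unr x; have Py := unr y yx.
have {}Px : rnorm (P x - u n x) <= e / 4 by apply: Px; rewrite lerDl.
have h3 := dist_sub_le (P x) (u n x) (P y).
have h4 := dist_sub_le (u n x) (u n y) (P y).
rewrite [in leRHS](rnormB (u n y)) in h4.
by lra.
Qed.

End PointwiseLimits.

Section MaximalBanach.
Variables (R : realType) (alpha : tensor_norms R).
Hypothesis aU : uniform_norms alpha.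
Implicit Types E F : completeNormedModType R[i].

Lemma max_sub k E (P Q : E -> R[i]) :
  ideal_set (max_ideal alpha k) P -> ideal_set (max_ideal alpha k) Q ->
  ideal_set (max_ideal alpha k) (P - Q).
Proof.
move=> Pm Qm; have [h _] := max_lin aU (-1) Qm Pm.
by rewrite scaleN1r addrC in h.
Qed.

(** On a finite dimensional N, pointwise convergence at the interpolation points is
    convergence of the tensors, so that bounds for u n - u m pass to the limit
    in m, on all N at once. *)
Lemma max_norm_limit k E (u : nat -> E -> R[i]) (P : E -> R[i]) (e : R) n :
  (forall m, ideal_set (max_ideal alpha k) (u m)) -> polynomials k P ->
  (forall x, (fun m => u m x) @ \oo --> P x) -> 0 <= e ->
  (\forall m \near \oo, ideal_norm (max_ideal alpha k) (u n - u m) <= e) ->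
  ideal_set (max_ideal alpha k) (u n - P) /\
  ideal_norm (max_ideal alpha k) (u n - P) <= e.
Proof.
move=> um Pp uP e0 ue.
have dp (m : nat) : polynomials k (u m - P).
  have := polynomials_lin (-1) Pp (um m).1; by rewrite scaleN1r addrC.
apply: max_norm_le => // N v vuP.
have [J [x [w [xw _]]]] := restriction_interpolation k N.
pose s m : R := \sum_j rnorm (P (fd_val (x j)) - u m (fd_val (x j))) * @alpha k _ (w j).
have s0 : s @ \oo --> (0 : R).
  rewrite (_ : 0 = \sum_(j : J) rnorm (P (fd_val (x j)) - P (fd_val (x j))) * @alpha k _ (w j)); last first.
    by rewrite big1// => j _; rewrite subrr rnorm0 mul0r.
  apply: cvg_big => [|j _]; first exact: add_continuous.
  apply: cvgMl; apply: cvg_rnorm; apply: cvgB; first exact: cvg_cst.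
  exact: uP.
have vm m : @alpha k _ v <= ideal_norm (max_ideal alpha k) (u n - u m) + s m.
  pose vm := \sum_j (u n - u m) (fd_val (x j)) *: w j.
  have dm := max_sub (um n) (um m).
  have -> : v = vm + \sum_j (u m - P) (fd_val (x j)) *: w j.
    apply: tensor_poly_inj => y; rewrite tensor_polyD -(xw _ (dp m)) -(xw _ dm.1) vuP.
    by rewrite -[LHS]/(u n _ - P _) -[RHS]/(u n _ - u m _ + (u m _ - P _)) addrA subrK.
  rewrite (le_trans (tn_add aU _ _))// lerD//.
    by apply: max_norm_ub => // y; rewrite -(xw _ dm.1).
  rewrite /s; elim/big_rec2 : _ => [|j a b _ ab].
    have h := tn_scale aU 0 (0 : symtensor k (dual (fdspace N))).
    by rewrite scaler0 rnorm0 mul0r in h.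
  rewrite (le_trans (tn_add aU _ _))// lerD// (le_trans (tn_scale aU _ _))//.
  by rewrite ler_wpM2r ?(tn_ge0 aU)// rnormB.
apply/ler_addgt0Pr => d d0; move/cvgrPdist_lt : s0 => /(_ _ d0) sd.
have [m [ume smd]] := filter_ex (filterI ue sd).
rewrite (le_trans (vm m))// lerD//; move: smd; rewrite sub0r normrN => /ltW.
exact: le_trans (ler_norm _).
Qed.

Lemma max_norm_complete k E (u : nat -> E -> R[i]) :
  (forall n, ideal_set (max_ideal alpha k) (u n)) ->
  (forall e : R, 0 < e -> exists N, forall m n, (N <= m)%N -> (N <= n)%N ->
     ideal_norm (max_ideal alpha k) (u m - u n) < e) ->
  exists2 P : E -> R[i], ideal_set (max_ideal alpha k) P &
    (fun n => ideal_norm (max_ideal alpha k) (u n - P)) @ \oo --> (0 : R).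
Proof.
move=> um uc.
have ev m n x : rnorm (u m x - u n x) <=
    ideal_norm (max_ideal alpha k) (u m - u n) * rnorm x ^+ k.
  exact: (max_norm_eval aU x (max_sub (um m) (um n))).
have /choice[P uP] : forall x, exists l : R[i], (fun n => u n x) @ \oo --> l.
  move=> x; apply: cauchy_seq_limit => e e0.
  have r0 : 0 < rnorm x ^+ k + 1 by rewrite ltr_wpDl ?exprn_ge0 ?rnorm_ge0.
  have [N HN] := uc (e / (rnorm x ^+ k + 1)) (divr_gt0 e0 r0).
  exists N => m n Nm Nn; apply: (le_lt_trans (ev m n x)).
  apply: (@le_lt_trans _ _ (ideal_norm (max_ideal alpha k) (u m - u n) * (rnorm x ^+ k + 1))).
    by rewrite ler_wpM2l ?lerDl// max_norm_ge0//; exact: max_sub.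
  by rewrite -ltr_pdivlMr// HN.
have near_limit (e : R) : 0 < e -> exists N, forall n, (N <= n)%N -> forall x,
    rnorm (P x - u n x) <= e * rnorm x ^+ k.
  move=> e0; have [N HN] := uc e e0; exists N => n Nn x.
  have cT : (fun m => rnorm (u m x - u n x)) @ \oo --> rnorm (P x - u n x).
    by apply: cvg_rnorm; apply: cvgB; [exact: uP|exact: cvg_cst].
  rewrite -(cvg_lim (@Rhausdorff R) cT); apply: limr_le.
    by apply/cvg_ex; eexists; exact: cT.
  exists N => // m /= Nm; rewrite (le_trans (ev m n x))// ler_wpM2r ?exprn_ge0 ?rnorm_ge0//.
  exact/ltW/HN.
have Pp : polynomials k P.
  split; last exact: (polynomials_pointwise_form (fun n => (um n).1) uP).
  apply: (@locally_uniform_continuous _ _ u _ k) => [n|e e0]; first exact: (um n).1.1.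
  by have [N HN] := near_limit e e0; exists N => x; exact: HN.
have close (e : R) : 0 < e -> exists N, forall n, (N <= n)%N ->
    ideal_set (max_ideal alpha k) (u n - P) /\
    ideal_norm (max_ideal alpha k) (u n - P) <= e.
  move=> e0; have [N HN] := uc e e0; exists N => n Nn.
  by apply: max_norm_limit => //; [exact: ltW|exists N => // m Nm; exact/ltW/HN].
exists P.
  have [N HN] := close 1 ltr01; have [h _] := HN N (leqnn N).
  have := max_sub (um N) h; by rewrite opprB addrC subrK.
apply/cvgrPdist_lt => e e0; have [N HN] := close (e / 2) (divr_gt0 e0 (ltr0n _ 2)).
exists N => // n Nn /=; have [h1 h2] := HN n Nn.
rewrite sub0r normrN ger0_norm ?max_norm_ge0//; apply: le_lt_trans h2 _.
by rewrite ltr_pdivrMr// ltr_pMr// ltr1n.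
Qed.

Lemma max_banach k E : banach_subspace (ideal_set (max_ideal alpha k) (E := E))
  (ideal_norm (max_ideal alpha k) (E := E)).
Proof.
have Zle (a : R[i]) (P : E -> R[i]) : ideal_set (max_ideal alpha k) P ->
    ideal_set (max_ideal alpha k) (a *: P) /\
    ideal_norm (max_ideal alpha k) (a *: P) <= rnorm a * ideal_norm (max_ideal alpha k) P.
  move=> Pm; have [h1 h2] := max0 aU k E; have := max_lin aU a Pm h1.
  rewrite addr0 => -[h3 h4]; split=> //; apply: le_trans h4 _.
  by rewrite gerDl.
split.
- exact: (max0 aU k E).1.
- by move=> a P Q Pm Qm; exact: (max_lin aU a Pm Qm).1.
- move=> P Q Pm Qm; have [_] := max_lin aU 1 Pm Qm.
  by rewrite scale1r rnorm1 mul1r.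
- move=> a P Pm; apply/eqP; rewrite eq_le (Zle a P Pm).2/=.
  have [->|a0] := eqVneq a 0.
    by rewrite rnorm0 mul0r max_norm_ge0//; exact: (Zle 0 P Pm).1.
  have na0 : 0 < rnorm a.
    by rewrite lt_def rnorm_ge0 andbT; apply: contra_neq a0 => /rnorm0_eq0.
  rewrite -ler_pdivlMl// -rnormV.
  have := (Zle a^-1 (a *: P) (Zle a P Pm).1).2.
  by rewrite scalerA mulVf// scale1r.
- move=> P Pm P0; apply/funext => x; apply: rnorm0_eq0; apply/eqP.
  by rewrite eq_le rnorm_ge0 andbT (le_trans (max_norm_eval aU x Pm))// P0 mul0r.
- exact: max_norm_complete.
Qed.

Lemma max_power k :
  ideal_set (max_ideal alpha k) (fun z : R[i] => z ^+ k) /\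
  ideal_norm (max_ideal alpha k) (fun z : R[i] => z ^+ k) = 1.
Proof.
have pp : polynomials k (fun z : R[i] => z ^+ k).
  apply: eq_polynomials (polynomials_pow k (id_blin R[i])) => z /=.
  by rewrite prodr_const card_ord.
have [h1 h2] : ideal_set (max_ideal alpha k) (fun z : R[i] => z ^+ k) /\
    ideal_norm (max_ideal alpha k) (fun z : R[i] => z ^+ k) <= 1.
  apply: max_norm_le => // N u uP.
  have fM (x : fdspace N) : rnorm (fd_val x) <= 1 * rnorm x by rewrite mul1r.
  have -> : u = dpow k (mkblin (@fd_val_linear _ _ N) fM).
    by apply: tensor_poly_inj => x; rewrite tensor_poly_dpow uP.
  rewrite (le_trans (tn_dpow aU _ _))// exprn_ile1 ?rnorm_ge0//.
  exact: mkblin_rnorm.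
split=> //; apply/eqP; rewrite eq_le h2/=.
have := max_norm_eval aU (1 : R[i]) h1.
by rewrite expr1n rnorm1 expr1n mulr1.
Qed.

Lemma max_banach_ideal k : banach_ideal k (max_ideal alpha k).
Proof.
split.
- by move=> E P [].
- exact: max_banach.
- by move=> E1 E T P; exact: max_norm_comp.
- exact: max_power.
Qed.

(** Multiplication by a functional is the product with a polynomial of degree 1. *)
Lemma max_functional E (g : dual E) : ideal_set (max_ideal alpha 1) g /\
  ideal_norm (max_ideal alpha 1) g <= rnorm g.
Proof.
have [h1 h2] := max_power 1; have [h3 h4] := max_norm_comp aU g h1.
rewrite h2 mul1r expr1 in h4.
by rewrite (_ : blin_fun g = (fun z : R[i] => z ^+ 1) \o g).
Qed.

Lemma max_multiplicative : multiplicative_sequence (max_ideal alpha).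
Proof.
split.
  split=> [k _|]; first exact: max_banach_ideal.
  exists (expR 1), (expR 1); split; rewrite ?expR_gt0// => E k k0; split=> [P a Pm|P g Pm].
    exact: max_norm_contract.
  have [g1 g2] := max_functional g.
  have [h1 h2] := max_norm_prod aU k0 g1 Pm; split; first exact: h1.
  apply: (le_trans h2); rewrite /growth eqxx ler_wpM2r ?max_norm_ge0//.
  by rewrite ler_wpM2l ?expR_ge0.
exists (expR 1) => k l k0 l0 E P Q Pm Qm.
have [h1 h2] := max_norm_prod aU l0 Pm Qm; split=> //; apply: (le_trans h2).
rewrite ler_wpM2r ?max_norm_ge0// ler_wpM2r ?max_norm_ge0//.
exact: growth_le.
Qed.

End MaximalBanach.
(** * l_oo-sums of sequences of Banach spaces *)

Section DirectSum.
Variables (R : realType) (E : nat -> completeNormedModType R[i]).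

(** The minimal ideals need to combine infinitely many factorizations with different
    middle spaces, hence sums of families of spaces. *)
Record dsum := DSum {
  dsum_fun :> forall n, E n ;
  dsum_bounded : exists M : R, forall n, rnorm (dsum_fun n) <= M }.

Lemma dsum_ext (f g : dsum) : (forall n, f n = g n) -> f = g.
Proof.
case: f g => [f fb] [g gb] /= fg.
have fgE : f = g by apply: functional_extensionality_dep.
by move: fb gb; rewrite fgE => fb gb; congr DSum; exact: Prop_irrelevance.
Qed.

HB.instance Definition _ := gen_eqMixin dsum.
HB.instance Definition _ := gen_choiceMixin dsum.

Lemma dsum0_bounded : exists M : R, forall n, rnorm (0 : E n) <= M.
Proof. by exists 0 => n; rewrite rnorm0. Qed.

Lemma dsumN_bounded (f : dsum) : exists M : R, forall n, rnorm (- f n) <= M.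
Proof. by have [M fM] := dsum_bounded f; exists M => n; rewrite rnormN. Qed.

Lemma dsumD_bounded (f g : dsum) : exists M : R, forall n, rnorm (f n + g n) <= M.
Proof.
have [M fM] := dsum_bounded f; have [N gN] := dsum_bounded g.
by exists (M + N) => n; rewrite (le_trans (rnormD _ _))// lerD.
Qed.

Lemma dsumZ_bounded (a : R[i]) (f : dsum) : exists M : R, forall n, rnorm (a *: f n) <= M.
Proof.
have [M fM] := dsum_bounded f.
by exists (rnorm a * M) => n; rewrite rnormZ ler_wpM2l ?rnorm_ge0.
Qed.

Definition dsum0 := DSum dsum0_bounded.
Definition dsumN f := DSum (dsumN_bounded f).
Definition dsumD f g := DSum (dsumD_bounded f g).
Definition dsumZ a f := DSum (dsumZ_bounded a f).

Lemma dsumDA : associative dsumD.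
Proof. by move=> f g h; apply: dsum_ext => n /=; rewrite addrA. Qed.
Lemma dsumDC : commutative dsumD.
Proof. by move=> f g; apply: dsum_ext => n /=; rewrite addrC. Qed.
Lemma dsum0D : left_id dsum0 dsumD.
Proof. by move=> f; apply: dsum_ext => n /=; rewrite add0r. Qed.
Lemma dsumND : left_inverse dsum0 dsumN dsumD.
Proof. by move=> f; apply: dsum_ext => n /=; rewrite addNr. Qed.

HB.instance Definition _ := GRing.isZmodule.Build dsum dsumDA dsumDC dsum0D dsumND.

Lemma dsumZA a b f : dsumZ a (dsumZ b f) = dsumZ (a * b) f.
Proof. by apply: dsum_ext => n /=; rewrite scalerA. Qed.
Lemma dsumZ1 : left_id 1 dsumZ.
Proof. by move=> f; apply: dsum_ext => n /=; rewrite scale1r. Qed.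
Lemma dsumZDr : right_distributive dsumZ +%R.
Proof. by move=> a f g; apply: dsum_ext => n /=; rewrite scalerDr. Qed.
Lemma dsumZDl f : {morph dsumZ^~ f : a b / a + b}.
Proof. by move=> a b; apply: dsum_ext => n /=; rewrite scalerDl. Qed.

HB.instance Definition _ :=
  GRing.Zmodule_isLmodule.Build R[i] dsum dsumZA dsumZ1 dsumZDr dsumZDl.

Definition dsum_norm (f : dsum) : R := sup [set rnorm (f n) | n in [set: nat]].

Lemma le_dsum_norm (f : dsum) n : rnorm (f n) <= dsum_norm f.
Proof.
apply: ub_le_sup; last by exists n.
by have [M fM] := dsum_bounded f; exists M => _ [m _ <-].
Qed.

Lemma dsum_norm_ge0 (f : dsum) : 0 <= dsum_norm f.
Proof. by rewrite (le_trans (rnorm_ge0 (f 0%N)))// le_dsum_norm. Qed.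

Lemma dsum_norm_le (f : dsum) (M : R) : (forall n, rnorm (f n) <= M) -> dsum_norm f <= M.
Proof. by move=> fM; apply: ge_sup => [|_ [n _ <-]//]; exists (rnorm (f 0%N)), 0%N. Qed.

Lemma dsum_normD (f g : dsum) :
  (dsum_norm (f + g))%:C <= (dsum_norm f)%:C + (dsum_norm g)%:C.
Proof.
rewrite -rmorphD lecR; apply: dsum_norm_le => n.
by rewrite (le_trans (rnormD _ _))// lerD ?le_dsum_norm.
Qed.

Lemma dsum_normZ (a : R[i]) (f : dsum) :
  (dsum_norm (a *: f))%:C = `|a| * (dsum_norm f)%:C.
Proof.
rewrite -rnormE -rmorphM/=; congr (_ %:C).
have le b g : dsum_norm (b *: g) <= rnorm b * dsum_norm g.
  by apply: dsum_norm_le => n; rewrite rnormZ ler_wpM2l ?rnorm_ge0 ?le_dsum_norm.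
exact: real_homogeneous le dsum_norm_ge0 a f.
Qed.

Lemma dsum_norm0_eq0 (f : dsum) : (dsum_norm f)%:C = 0 -> f = 0.
Proof.
move=> /complexI f0; apply: dsum_ext => n; apply: rnorm0_eq0; apply/eqP.
by rewrite eq_le rnorm_ge0 andbT (le_trans (le_dsum_norm _ _))// f0.
Qed.

HB.instance Definition _ :=
  Lmodule_isNormed.Build R[i] dsum dsum_normD dsum_normZ dsum_norm0_eq0.

Lemma dsum_rnormE (f : dsum) : rnorm f = dsum_norm f.
Proof. exact: rnorm_ext. Qed.

Lemma le_dsum (f : dsum) n : rnorm (f n) <= rnorm f.
Proof. by rewrite dsum_rnormE le_dsum_norm. Qed.

Lemma dsum_complete (F : set_system dsum) : ProperFilter F -> cauchy F -> cvg F.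
Proof.
move=> FF Fc; have Fc' := (@cauchy_rnormP R dsum F FF).1 Fc.
have cev n : cvg ((fun f : dsum => f n) @ F).
  apply: cauchy_cvg; apply/cauchy_rnormP => e /Fc'[v0 h]; exists (v0 n).
  change (F ((fun f : dsum => f n) @^-1` [set z | rnorm (z - v0 n) < e])).
  by apply: filterS h => v /=; apply: le_lt_trans; exact: (le_dsum (v - v0)).
pose g n := lim ((fun f : dsum => f n) @ F).
have gr v0 (r : R) : F [set v | rnorm (v - v0) <= r] -> forall n, rnorm (g n - v0 n) <= r.
  move=> Fr n.
  have cT : (fun f : dsum => rnorm (f n - v0 n)) @ F --> rnorm (g n - v0 n).
    by apply: cvg_rnorm; apply: cvgB; [exact: cev|exact: cvg_cst].
  rewrite -(cvg_lim (@Rhausdorff R) cT); apply: limr_le.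
    by apply/cvg_ex; eexists; exact: cT.
  by apply: filterS Fr => f /=; apply: le_trans; exact: (le_dsum (f - v0)).
have [v1 Fv1] := Fc' 1 ltr01.
have Fv1' : F [set v | rnorm (v - v1) <= 1] by apply: filterS Fv1 => v /ltW.
have gb : exists M : R, forall n, rnorm (g n) <= M.
  exists (1 + rnorm v1) => n; rewrite -(subrK (v1 n) (g n)) (le_trans (rnormD _ _))//.
  by rewrite lerD ?le_dsum// gr.
apply/cvg_ex; exists (DSum gb); apply/(@cvg_rnormP R dsum _ F _ id) => e e0.
have /Fc'[v0 Fv0] : 0 < e / 2 by rewrite divr_gt0.
have Fv0' : F [set v | rnorm (v - v0) <= e / 2] by apply: filterS Fv0 => v /ltW.
apply: filterS Fv0 => v hv /=.
rewrite -(subrK v0 (DSum gb)) -addrA; apply: le_lt_trans (rnormD _ _) _.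
rewrite (splitr e) ler_ltD//; last by rewrite rnormB.
by rewrite dsum_rnormE; apply: dsum_norm_le => n; exact: gr.
Qed.

HB.instance Definition _ := Uniform_isComplete.Build dsum dsum_complete.

Lemma dsum_proj_linear n : linear (fun f : dsum => f n).
Proof. by []. Qed.

Lemma dsum_proj_bound n (f : dsum) : rnorm (f n) <= 1 * rnorm f.
Proof. by rewrite mul1r le_dsum. Qed.

Definition dsum_proj n : blin dsum (E n) :=
  mkblin (@dsum_proj_linear n) (@dsum_proj_bound n).

Lemma dsum_proj_rnorm n : rnorm (dsum_proj n) <= 1.
Proof. exact: mkblin_rnorm. Qed.

Lemma dsum_inj_norm n (x : E n) m : rnorm (dfwith (fun m => 0 : E m) x m) <= rnorm x.
Proof.
by case: dfwithP => [|j nj]; rewrite ?rnorm0 ?rnorm_ge0.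
Qed.

Lemma dsum_inj_bounded n (x : E n) :
  exists M : R, forall m, rnorm (dfwith (fun m => 0 : E m) x m) <= M.
Proof. by exists (rnorm x) => m; exact: dsum_inj_norm. Qed.

Lemma dsum_inj_linear n : linear (fun x : E n => DSum (dsum_inj_bounded x)).
Proof.
move=> a x y; apply: dsum_ext => m /=.
have [<-|nm] := eqVneq n m; first by rewrite !dfwith_in.
by rewrite !dfwith_out// scaler0 addr0.
Qed.

Lemma dsum_inj_bound n (x : E n) : rnorm (DSum (dsum_inj_bounded x)) <= 1 * rnorm x.
Proof.
by rewrite mul1r dsum_rnormE; apply: dsum_norm_le => m; exact: dsum_inj_norm.
Qed.

Definition dsum_inj n : blin (E n) dsum :=
  mkblin (@dsum_inj_linear n) (@dsum_inj_bound n).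

End DirectSum.

(** * Approximable operators *)

Section Approximable.
Variable R : realType.
Implicit Types E F G : normedModType R[i].

Lemma finite_rank_approximable E F (S : blin E F) : finite_rank S -> approximable S.
Proof. by move=> Sf e e0; exists S; rewrite subrr rnorm0. Qed.

Lemma finite_rank0 E F : finite_rank (0 : blin E F).
Proof. by exists 0, (fun=> 0) => x; exists (fun=> 0); rewrite big_ord0. Qed.

Lemma finite_rankD E F (S T : blin E F) :
  finite_rank S -> finite_rank T -> finite_rank (S + T).
Proof.
move=> [m [b Sb]] [n [c Tc]].
exists (m + n)%N, (tjoin b c) => x; have [s sE] := Sb x; have [t tE] := Tc x.
exists (fun i => match fintype.split i with inl j => s j | inr j => t j end).
rewrite -[(S + T) x]/(S x + T x) sE tE big_split_ord/=; congr (_ + _).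
  by apply: eq_bigr => i _; rewrite tjoin_l (unsplitK (inl i)).
by apply: eq_bigr => i _; rewrite tjoin_r (unsplitK (inr i)).
Qed.

Lemma finite_rank_compl E F G (U : blin F G) (S : blin E F) :
  finite_rank S -> finite_rank (bcomp U S).
Proof.
move=> [m [b Sb]]; exists m, (U \o b) => x; have [s sE] := Sb x; exists s.
by rewrite /= sE linear_sum; apply: eq_bigr => i _; rewrite linearZ.
Qed.

Lemma finite_rank_compr E F G (S : blin F G) (U : blin E F) :
  finite_rank S -> finite_rank (bcomp S U).
Proof. by move=> [m [b Sb]]; exists m, b => x; exact: Sb. Qed.

Lemma approximableD E F (S T : blin E F) :
  approximable S -> approximable T -> approximable (S + T).
Proof.
move=> Sa Ta e e0; have e2 : 0 < e / 2 by rewrite divr_gt0.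
have [S' [S'f Se]] := Sa _ e2; have [T' [T'f Te]] := Ta _ e2.
exists (S' + T'); split; first exact: finite_rankD.
rewrite opprD addrACA (splitr e); apply: le_lt_trans (rnormD _ _) _.
exact: ltrD.
Qed.

Lemma approximable_compl E F G (U : blin F G) (S : blin E F) :
  approximable S -> approximable (bcomp U S).
Proof.
move=> Sa e e0; have u0 : 0 < rnorm U + 1 by rewrite ltr_wpDl ?rnorm_ge0.
have [S' [S'f Se]] := Sa _ (divr_gt0 e0 u0).
exists (bcomp U S'); split; first exact: finite_rank_compl.
have -> : bcomp U S - bcomp U S' = bcomp U (S - S').
  by apply/val_inj/funext => x; exact/esym/(linearB U (S x) (S' x)).
apply: (le_lt_trans (bcomp_rnorm _ _)).
apply: (@le_lt_trans _ _ ((rnorm U + 1) * rnorm (S - S'))).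
  by rewrite ler_wpM2r ?rnorm_ge0// lerDl.
by rewrite mulrC -ltr_pdivlMr.
Qed.

Lemma approximable_compr E F G (S : blin F G) (U : blin E F) :
  approximable S -> approximable (bcomp S U).
Proof.
move=> Sa e e0; have u0 : 0 < rnorm U + 1 by rewrite ltr_wpDl ?rnorm_ge0.
have [S' [S'f Se]] := Sa _ (divr_gt0 e0 u0).
exists (bcomp S' U); split; first exact: finite_rank_compr.
have -> : bcomp S U - bcomp S' U = bcomp (S - S') U by apply/val_inj/funext.
apply: (le_lt_trans (bcomp_rnorm _ _)).
apply: (@le_lt_trans _ _ (rnorm (S - S') * (rnorm U + 1))).
  by rewrite ler_wpM2l ?rnorm_ge0// lerDl.
by rewrite -ltr_pdivlMr.
Qed.

Lemma approximable_closed E F (T : blin E F) :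
  (forall e : R, 0 < e -> exists S : blin E F, approximable S /\ rnorm (T - S) < e) ->
  approximable T.
Proof.
move=> Ta e e0; have e2 : 0 < e / 2 by rewrite divr_gt0.
have [S [Sa TS]] := Ta _ e2; have [S' [S'f Se]] := Sa _ e2.
exists S'; split=> //; rewrite -(subrK S T) -addrA (splitr e).
apply: le_lt_trans (rnormD _ _) _; exact: ltrD.
Qed.

Lemma approximable_functional E (g : dual E) : approximable g.
Proof.
apply: finite_rank_approximable; exists 1%N, (fun=> 1) => x; exists (fun=> g x).
rewrite big_ord1; exact/esym/mulr1.
Qed.

Lemma approximableZ E F (a : R[i]) (T : blin E F) :
  approximable T -> approximable (a *: T).
Proof.
move=> Ta; have -> : a *: T = bcomp (a *: id_blin F) T by apply/val_inj/funext.
exact: approximable_compl.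
Qed.

End Approximable.

Section Gluing.
Variables (R : realType) (E : completeNormedModType R[i]).

(** The operator with components T_n is the norm limit of its truncations, because
    ||T_n|| tends to 0, and a truncation is a finite sum of approximable operators. *)
Lemma approximable_glue (F : nat -> completeNormedModType R[i])
    (T : forall n, blin E (F n)) (s : nat -> R) (S : R) :
  (forall n, approximable (T n)) -> (forall n, rnorm (T n) <= s n) ->
  (forall n, s n <= S) -> s @ \oo --> (0 : R) ->
  exists U : blin E (dsum F),
    [/\ approximable U, rnorm U <= S & forall n x, dsum_proj F n (U x) = T n x].
Proof.
move=> Ta Ts sS s0.
have S0 : 0 <= S by rewrite (le_trans _ (sS 0%N))// (le_trans _ (Ts 0%N)) ?rnorm_ge0.
have Tx x n : rnorm (T n x) <= S * rnorm x.
  by rewrite (le_trans (le_blin _ _))// ler_wpM2r ?rnorm_ge0// (le_trans (Ts n)).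
have fb x : exists M : R, forall n, rnorm (T n x) <= M by exists (S * rnorm x).
have fl : linear (fun x => DSum (fb x)).
  by move=> a x y; apply: dsum_ext => n /=; rewrite linearP.
have fM x : rnorm (DSum (fb x)) <= S * rnorm x.
  by rewrite dsum_rnormE; apply: dsum_norm_le => n; exact: Tx.
exists (mkblin fl fM); split=> //; last exact: mkblin_rnorm.
pose P := fix P n : blin E (dsum F) :=
  if n is n'.+1 then P n' + bcomp (dsum_inj F n') (T n') else 0.
have Pa n : approximable (P n).
  elim: n => [|n IH]; first exact/finite_rank_approximable/finite_rank0.
  exact: (approximableD IH (approximable_compl _ (Ta n))).
have PE n x m : P n x m = if (m < n)%N then T m x else 0.
  elim: n => [//|n IH].
  rewrite -[LHS]/(P n x m + dfwith (fun m => 0 : F m) (T n x) m) IH.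
  have [->|mn] := eqVneq m n; first by rewrite ltnn ltnSn dfwith_in add0r.
  by rewrite dfwith_out 1?eq_sym// addr0 [in RHS]ltnS [in RHS]leq_eqVlt (negbTE mn).
apply: approximable_closed => e e0; have e2 : 0 < e / 2 by rewrite divr_gt0.
move/cvgrPdist_lt : s0 => /(_ _ e2)[N _ HN].
exists (P N); split=> //; apply: (@le_lt_trans _ _ (e / 2)); last first.
  by rewrite ltr_pdivrMr// ltr_pMr// ltr1n.
rewrite blin_rnormE; apply: opnorm_le => [|x]; first exact: ltW.
rewrite dsum_rnormE; apply: dsum_norm_le => m.
rewrite -[X in rnorm X]/(T m x - P N x m) PE; case: ltnP => Nm.
  by rewrite subrr rnorm0 mulr_ge0 ?rnorm_ge0 ?ltW.
rewrite subr0 (le_trans (le_blin _ _))// ler_wpM2r ?rnorm_ge0// (le_trans (Ts m))//.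
have := HN m Nm; rewrite /= sub0r normrN => /ltW; exact: le_trans (ler_norm _).
Qed.

(** Glue the sequence T1, T2, 0, 0, and so on. *)
Lemma approximable_pair (F1 F2 : completeNormedModType R[i]) (T1 : blin E F1)
    (T2 : blin E F2) (s : R) :
  approximable T1 -> approximable T2 -> rnorm T1 <= s -> rnorm T2 <= s ->
  exists (F : completeNormedModType R[i]) (U : blin E F) (p1 : blin F F1) (p2 : blin F F2),
    [/\ approximable U, rnorm U <= s, rnorm p1 <= 1 /\ rnorm p2 <= 1,
        forall x, p1 (U x) = T1 x & forall x, p2 (U x) = T2 x].
Proof.
move=> a1 a2 s1 s2; have s0 : 0 <= s by rewrite (le_trans (rnorm_ge0 T1)).
pose F n : completeNormedModType R[i] := if n is 0 then F1 else F2.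
pose T n : blin E (F n) := match n with 0 => T1 | 1 => T2 | _ => 0 end.
have [||||U [Ua Us UE]] := @approximable_glue F T (fun n => if (n < 2)%N then s else 0) s.
- case=> [|[|n]]; [exact: a1|exact: a2|].
  exact: (finite_rank_approximable (@finite_rank0 R E (F n.+2))).
- case=> [|[|n]]; [exact: s1|exact: s2|].
  by rewrite -[T _]/(0 : blin E (F n.+2)) rnorm0.
- by move=> n; case: ifP.
- by apply: cvg_near_cst; exists 2%N => // n /= n2; rewrite ltnNge n2.
exists (dsum F), U, (dsum_proj F 0), (dsum_proj F 1); split=> //.
- by split; exact: dsum_proj_rnorm.
- by move=> x; exact: (UE 0%N x).
- by move=> x; exact: (UE 1%N x).
Qed.

End Gluing.
(** * Minimal ideals *)

Section MinimalIdeal.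
Variables (R : realType) (alpha : tensor_norms R).
Hypothesis aU : uniform_norms alpha.
Implicit Types E F : completeNormedModType R[i].

(** For passing from almost optimal factorizations to the infimum. *)
Lemma le_mul_limit (c a x : R) : 0 <= c -> (forall r, a < r -> x <= c * r) -> x <= c * a.
Proof.
move=> c0 h; have [c0'|cn0] := eqVneq c 0.
  by have := h (a + 1); rewrite c0' !mul0r ltrDl => /(_ ltr01).
have cp : 0 < c by rewrite lt_def cn0.
apply/ler_addgt0Pr => e e0.
have -> : c * a + e = c * (a + e / c) by rewrite mulrDr mulrCA divff ?mulr1.
by apply: h; rewrite ltrDl divr_gt0.
Qed.

Lemma factorization_ge0 k E (P : E -> R[i]) r : factorization_norms alpha k P r -> 0 <= r.
Proof.
move=> [F [T [Q [_ Qm _ ->]]]].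
by rewrite mulr_ge0 ?exprn_ge0 ?rnorm_ge0 ?(max_norm_ge0 aU).
Qed.

Lemma min_norm_le k E F (T : blin E F) (Q : F -> R[i]) (s r : R) :
  approximable T -> ideal_set (max_ideal alpha k) Q -> rnorm T <= s ->
  ideal_norm (max_ideal alpha k) Q <= r ->
  ideal_set (min_ideal alpha k) (Q \o T) /\
  ideal_norm (min_ideal alpha k) (Q \o T) <= r * s ^+ k.
Proof.
move=> Ta Qm Ts Qr.
have f0 : factorization_norms alpha k (Q \o T)
    (ideal_norm (max_ideal alpha k) Q * rnorm T ^+ k) by exists F, T, Q.
split; first by exists (ideal_norm (max_ideal alpha k) Q * rnorm T ^+ k).
apply: (@le_trans _ _ (ideal_norm (max_ideal alpha k) Q * rnorm T ^+ k)).
  apply: ge_inf => //; exists 0 => r' r'f; exact: (factorization_ge0 r'f).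
apply: ler_pM => //; rewrite ?exprn_ge0 ?rnorm_ge0 ?(max_norm_ge0 aU)//.
by rewrite lerXn2r ?nnegrE ?rnorm_ge0// (le_trans (rnorm_ge0 T)).
Qed.

Lemma min_norm_ge k E (P : E -> R[i]) (c x : R) : 0 <= c ->
  ideal_set (min_ideal alpha k) P ->
  (forall (F : completeNormedModType R[i]) (T : blin E F) (Q : F -> R[i]),
     approximable T -> ideal_set (max_ideal alpha k) Q -> P = Q \o T ->
     x <= c * (ideal_norm (max_ideal alpha k) Q * rnorm T ^+ k)) ->
  x <= c * ideal_norm (min_ideal alpha k) P.
Proof.
move=> c0 Pm h; apply: inf_mulr_ge => // _ [F [T [Q [Ta Qm PQ ->]]]]; exact: h.
Qed.

Lemma min_norm_ge0 k E (P : E -> R[i]) : ideal_set (min_ideal alpha k) P ->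
  0 <= ideal_norm (min_ideal alpha k) P.
Proof.
move=> Pm; rewrite -[leRHS]mul1r; apply: min_norm_ge => // F T Q _ Qm _.
by rewrite mul1r mulr_ge0 ?exprn_ge0 ?rnorm_ge0 ?(max_norm_ge0 aU).
Qed.

Lemma min_norm_eval k E (P : E -> R[i]) x : ideal_set (min_ideal alpha k) P ->
  rnorm (P x) <= ideal_norm (min_ideal alpha k) P * rnorm x ^+ k.
Proof.
move=> Pm; rewrite mulrC; apply: min_norm_ge => [||F T Q Ta Qm ->]//.
  by rewrite exprn_ge0 ?rnorm_ge0.
rewrite mulrC -mulrA -exprMn (le_trans (max_norm_eval aU _ Qm))//.
rewrite ler_wpM2l ?(max_norm_ge0 aU)// lerXn2r ?nnegrE ?mulr_ge0 ?rnorm_ge0//.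
exact: le_blin.
Qed.

(** Homogeneity allows the norm to be moved between the operator and the
    polynomial. *)
Lemma min_factor k E (P : E -> R[i]) (s r : R) : (0 < k)%N -> 0 < s -> 0 < r ->
  ideal_set (min_ideal alpha k) P -> ideal_norm (min_ideal alpha k) P < r * s ^+ k ->
  exists (F : completeNormedModType R[i]) (T : blin E F) (Q : F -> R[i]),
    [/\ approximable T, ideal_set (max_ideal alpha k) Q, P = Q \o T,
        rnorm T <= s & ideal_norm (max_ideal alpha k) Q <= r].
Proof.
move=> k0 s0 r0 Pm Pr; have [_ [F [T [Q [Ta Qm PQ ->]]]] QT] := inf_lt Pm Pr.
have [T0|T0] := eqVneq (rnorm T) 0.
  have [z1 z2] := max0 aU k F.
  exists F, T, 0; split=> //; rewrite ?T0 ?(le_trans z2) ?ltW//.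
  apply/funext => x; rewrite PQ; apply: rnorm0_eq0; apply/eqP.
  rewrite eq_le rnorm_ge0 andbT (le_trans (max_norm_eval aU _ Qm))//.
  rewrite (_ : rnorm (T x) = 0) ?expr0n ?gtn_eqF ?mulr0// ?eqn0Ngt ?k0 ?mulr0//.
  by apply/eqP; rewrite eq_le rnorm_ge0 andbT (le_trans (le_blin _ _))// T0 mul0r.
have Tp : 0 < rnorm T by rewrite lt_def T0 rnorm_ge0.
pose c := s / rnorm T; have c0 : 0 < c by rewrite divr_gt0.
pose D : blin F F := (c^-1)%:C *: id_blin F.
have Dc : rnorm D <= c^-1.
  rewrite rnormM_C ?invr_ge0 ?(ltW c0)// -[leRHS]mulr1 ler_wpM2l ?invr_ge0 ?(ltW c0)//.
  exact: id_blin_rnorm.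
have [QD QDn] := max_norm_comp aU D Qm.
exists F, (c%:C *: T), (Q \o D); split.
- exact: approximableZ.
- exact: QD.
- rewrite PQ; apply/funext => x; rewrite /=; congr Q.
  rewrite -[RHS]/((c^-1)%:C *: (c%:C *: T x)) scalerA -rmorphM/= mulVf ?gt_eqF//.
  by rewrite scale1r.
- by rewrite rnormM_C ?(ltW c0)// /c divfK// gt_eqF.
apply: (le_trans QDn); apply: (@le_trans _ _
    (ideal_norm (max_ideal alpha k) Q * c^-1 ^+ k)).
  rewrite ler_wpM2l ?(max_norm_ge0 aU)// lerXn2r ?nnegrE ?rnorm_ge0// ?invr_ge0 ltW//.
have -> : c^-1 ^+ k = rnorm T ^+ k / s ^+ k by rewrite /c invf_div expr_div_n.
by rewrite mulrA ler_pdivrMr ?exprn_gt0// ltW.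
Qed.

(** Normalize the operators of both factorizations, and sum the middle spaces: the
    l_oo-norm keeps the joint operator normalized, and the two polynomials become
    polynomials on the same space. *)
Lemma min_lin k E (a : R[i]) (P Q : E -> R[i]) : (0 < k)%N ->
  ideal_set (min_ideal alpha k) P -> ideal_set (min_ideal alpha k) Q ->
  ideal_set (min_ideal alpha k) (a *: P + Q) /\
  ideal_norm (min_ideal alpha k) (a *: P + Q) <=
    rnorm a * ideal_norm (min_ideal alpha k) P + ideal_norm (min_ideal alpha k) Q.
Proof.
move=> k0 Pm Qm.
have key (r1 r2 : R) : ideal_norm (min_ideal alpha k) P < r1 ->
    ideal_norm (min_ideal alpha k) Q < r2 ->
    ideal_set (min_ideal alpha k) (a *: P + Q) /\
    ideal_norm (min_ideal alpha k) (a *: P + Q) <= rnorm a * r1 + r2.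
  move=> Pr Qr.
  have r10 : 0 < r1 by rewrite (le_lt_trans (min_norm_ge0 Pm)).
  have r20 : 0 < r2 by rewrite (le_lt_trans (min_norm_ge0 Qm)).
  have [|F1 [T1 [P' [T1a P'm PE T1s P'r]]]] := min_factor k0 ltr01 r10 Pm.
    by rewrite expr1n mulr1.
  have [|F2 [T2 [Q' [T2a Q'm QE T2s Q'r]]]] := min_factor k0 ltr01 r20 Qm.
    by rewrite expr1n mulr1.
  have [F [U [p1 [p2 [Ua Us [p11 p21] p1U p2U]]]]] := approximable_pair T1a T2a T1s T2s.
  have [h1 h2] := max_norm_comp aU p1 P'm; have [h3 h4] := max_norm_comp aU p2 Q'm.
  have [h5 h6] := max_lin aU a h1 h3.
  rewrite (_ : a *: P + Q = (a *: (P' \o p1) + (Q' \o p2)) \o U); last first.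
    apply/funext => x; rewrite PE QE.
    by rewrite -[LHS]/(a * P' (T1 x) + Q' (T2 x)) -p1U -p2U.
  rewrite -[rnorm a * r1 + r2]mulr1 -[X in _ * X](expr1n _ k).
  apply: min_norm_le => //; apply: (le_trans h6); rewrite lerD//.
    rewrite ler_wpM2l ?rnorm_ge0// (le_trans h2)// (le_trans _ P'r)//.
    by rewrite ler_piMr ?(max_norm_ge0 aU)// exprn_ile1 ?rnorm_ge0.
  rewrite (le_trans h4)// (le_trans _ Q'r)//.
  by rewrite ler_piMr ?(max_norm_ge0 aU)// exprn_ile1 ?rnorm_ge0.
have lt1 (x : R) : x < x + 1 by rewrite ltrDl.
split; first exact: (key _ _ (lt1 _) (lt1 _)).1.
rewrite -lerBlDr; apply: le_mul_limit => [|r1 Pr]; first exact: rnorm_ge0.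
rewrite lerBlDr -lerBlDl -[leRHS]mul1r; apply: le_mul_limit => // r2 Qr.
by rewrite mul1r lerBlDl; exact: (key _ _ Pr Qr).2.
Qed.

Lemma min_norm_comp k E F (S : blin F E) (P : E -> R[i]) :
  ideal_set (min_ideal alpha k) P ->
  ideal_set (min_ideal alpha k) (P \o S) /\
  ideal_norm (min_ideal alpha k) (P \o S) <= ideal_norm (min_ideal alpha k) P * rnorm S ^+ k.
Proof.
move=> Pm; have key (G : completeNormedModType R[i]) (T : blin E G) (Q : G -> R[i]) : approximable T ->
    ideal_set (max_ideal alpha k) Q -> P = Q \o T ->
    ideal_set (min_ideal alpha k) (P \o S) /\ ideal_norm (min_ideal alpha k) (P \o S) <=
      ideal_norm (max_ideal alpha k) Q * (rnorm T * rnorm S) ^+ k.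
  move=> Ta Qm ->; rewrite (_ : (Q \o T) \o S = Q \o bcomp T S)//.
  by apply: min_norm_le => //; [exact: approximable_compr|exact: bcomp_rnorm].
split; first by have [_ [G [T [Q [Ta Qm PQ _]]]]] := Pm; exact: (key G T Q Ta Qm PQ).1.
rewrite mulrC; apply: min_norm_ge => // [|G T Q Ta Qm PQ].
  by rewrite exprn_ge0 ?rnorm_ge0.
by rewrite mulrC -mulrA -exprMn; exact: (key G T Q Ta Qm PQ).2.
Qed.

(** As for sums, but the product is taken in the maximal ideal of the middle space. *)
Lemma min_norm_prod k l E (P Q : E -> R[i]) : (0 < k)%N -> (0 < l)%N ->
  ideal_set (min_ideal alpha k) P -> ideal_set (min_ideal alpha l) Q ->
  ideal_set (min_ideal alpha (k + l)) (fun x => P x * Q x) /\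
  ideal_norm (min_ideal alpha (k + l)) (fun x => P x * Q x) <=
    growth R k l * ideal_norm (min_ideal alpha k) P * ideal_norm (min_ideal alpha l) Q.
Proof.
move=> k0 l0 Pm Qm; have g0 : 0 <= growth R k l by rewrite (le_trans ler01)// growth_ge1.
have key (r1 r2 : R) : ideal_norm (min_ideal alpha k) P < r1 ->
    ideal_norm (min_ideal alpha l) Q < r2 ->
    ideal_set (min_ideal alpha (k + l)) (fun x => P x * Q x) /\
    ideal_norm (min_ideal alpha (k + l)) (fun x => P x * Q x) <= growth R k l * r1 * r2.
  move=> Pr Qr.
  have r10 : 0 < r1 by rewrite (le_lt_trans (min_norm_ge0 Pm)).
  have r20 : 0 < r2 by rewrite (le_lt_trans (min_norm_ge0 Qm)).
  have [|F1 [T1 [P' [T1a P'm PE T1s P'r]]]] := min_factor k0 ltr01 r10 Pm.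
    by rewrite expr1n mulr1.
  have [|F2 [T2 [Q' [T2a Q'm QE T2s Q'r]]]] := min_factor l0 ltr01 r20 Qm.
    by rewrite expr1n mulr1.
  have [F [U [p1 [p2 [Ua Us [p11 p21] p1U p2U]]]]] := approximable_pair T1a T2a T1s T2s.
  have [h1 h2] := max_norm_comp aU p1 P'm; have [h3 h4] := max_norm_comp aU p2 Q'm.
  have [h5 h6] := max_norm_prod aU l0 h1 h3.
  rewrite (_ : (fun x => P x * Q x) = (fun y => (P' \o p1) y * (Q' \o p2) y) \o U); last first.
    by apply/funext => x; rewrite PE QE /= p1U p2U.
  rewrite -[X in _ <= X]mulr1 -[X in _ * X](expr1n _ (k + l)).
  apply: min_norm_le => //; apply: (le_trans h6); rewrite -!mulrA ler_wpM2l//.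
  apply: ler_pM; rewrite ?(max_norm_ge0 aU)//.
    rewrite (le_trans h2)// (le_trans _ P'r)//.
    by rewrite ler_piMr ?(max_norm_ge0 aU)// exprn_ile1 ?rnorm_ge0.
  rewrite (le_trans h4)// (le_trans _ Q'r)//.
  by rewrite ler_piMr ?(max_norm_ge0 aU)// exprn_ile1 ?rnorm_ge0.
have lt1 (x : R) : x < x + 1 by rewrite ltrDl.
split; first exact: (key _ _ (lt1 _) (lt1 _)).1.
apply: le_mul_limit => [|r2 Qr]; first by rewrite mulr_ge0 ?min_norm_ge0.
have r20 : 0 < r2 by rewrite (le_lt_trans (min_norm_ge0 Qm)).
rewrite mulrAC; apply: le_mul_limit => [|r1 Pr]; first by rewrite mulr_ge0// ltW.
by rewrite mulrAC; exact: (key _ _ Pr Qr).2.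
Qed.

Lemma min_norm_contract k E (P : E -> R[i]) a : (0 < k)%N ->
  ideal_set (min_ideal alpha k.+1) P ->
  ideal_set (min_ideal alpha k) (contract k P a) /\
  ideal_norm (min_ideal alpha k) (contract k P a) <=
    expR 1 * ideal_norm (min_ideal alpha k.+1) P * rnorm a.
Proof.
move=> k0 Pm; have key (G : completeNormedModType R[i]) (T : blin E G) (Q : G -> R[i]) : approximable T ->
    ideal_set (max_ideal alpha k.+1) Q -> P = Q \o T ->
    ideal_set (min_ideal alpha k) (contract k P a) /\
    ideal_norm (min_ideal alpha k) (contract k P a) <=
      expR 1 * ideal_norm (max_ideal alpha k.+1) Q * (rnorm T * rnorm a) * rnorm T ^+ k.
  move=> Ta Qm ->.
  have -> : contract k (Q \o T) a = contract k Q (T a) \o T.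
    have [A QA] := Qm.1.2; apply/funext => x.
    rewrite (contractE (A := mlin_comp T A)) => [|y]; last by rewrite /= QA.
    rewrite asym_comp/= (contractE (A := A))//; congr (asym A _).
    by apply: (@tjoin_eq _ _ 1 k) => i /=; rewrite ?(@tjoin_l _ _ 1 k) ?(@tjoin_r _ _ 1 k).
  have [h1 h2] := max_norm_contract aU (T a) k0 Qm.
  apply: min_norm_le => //; apply: (le_trans h2); rewrite ler_wpM2l//.
    by rewrite mulr_ge0 ?expR_ge0 ?(max_norm_ge0 aU).
  exact: le_blin.
split; first by have [_ [G [T [Q [Ta Qm PQ _]]]]] := Pm; exact: (key G T Q Ta Qm PQ).1.
rewrite mulrAC; apply: min_norm_ge => // [|G T Q Ta Qm PQ].
  by rewrite mulr_ge0 ?expR_ge0 ?rnorm_ge0.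
apply: (le_trans (key G T Q Ta Qm PQ).2); rewrite le_eqVlt; apply/orP; left; apply/eqP.
rewrite exprS; ring.
Qed.

(** A functional factors through the scalars, by itself. *)
Lemma min_functional E (g : dual E) : ideal_set (min_ideal alpha 1) g /\
  ideal_norm (min_ideal alpha 1) g <= rnorm g.
Proof.
have [h1 h2] := max_functional aU (id_blin R[i]).
have [h3 h4] := min_norm_le (approximable_functional g) h1 (lexx _)
  (le_trans h2 (id_blin_rnorm _)).
by rewrite mul1r expr1 in h4; split.
Qed.

Lemma min_power k :
  ideal_set (min_ideal alpha k) (fun z : R[i] => z ^+ k) /\
  ideal_norm (min_ideal alpha k) (fun z : R[i] => z ^+ k) = 1.
Proof.
have [h1 h2] := max_power aU k.
have h2' : ideal_norm (max_ideal alpha k) (fun z : R[i] => z ^+ k) <= 1 by rewrite h2.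
have [h3 h4] := min_norm_le (approximable_functional (id_blin R[i])) h1
  (id_blin_rnorm _) h2'.
rewrite mul1r expr1n in h4; split; first exact: h3.
apply/eqP; rewrite eq_le; apply/andP; split; first exact: h4.
have := min_norm_eval (1 : R[i]) h3.
by rewrite /= expr1n rnorm1 expr1n mulr1.
Qed.

End MinimalIdeal.
Section MinimalComplete.
Variables (R : realType) (alpha : tensor_norms R).
Hypothesis aU : uniform_norms alpha.
Implicit Types E F : completeNormedModType R[i].

Let h : R := 2^-1.

Lemma half_pow_gt0 n : 0 < h ^+ n.
Proof. by rewrite exprn_gt0// invr_gt0. Qed.

Lemma half_pow_le m n : (m <= n)%N -> h ^+ n <= h ^+ m.
Proof. by move=> mn; rewrite ler_wiXn2l// /h ?invr_ge0// invf_le1// ler1n. Qed.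

Lemma half_pow_small (c e : R) : 0 <= c -> 0 < e ->
  exists N, forall n, (N <= n)%N -> c * h ^+ n < e.
Proof.
move=> c0 e0; have e1 : 0 < e / (c + 1) by rewrite divr_gt0// ltr_wpDl.
have [N _ HN] := near_infty_natSinv_expn_lt (PosNum e1).
exists N => n Nn; have := HN n Nn; rewrite /= ltr_pdivlMr ?ltr_wpDl// mulrC div1r => H.
apply: le_lt_trans H; rewrite /h exprVn ler_wpM2r ?invr_ge0 ?exprn_ge0// lerDl.
by rewrite ler01.
Qed.

(** The tuple of the T_n is approximable with values in the l_oo-sum of the middle
    spaces, and the series of the Q_n, each depending on one coordinate, converges in
    the maximal ideal of that sum. *)
Lemma min_series k E (F : nat -> completeNormedModType R[i]) (T : forall n, blin E (F n))
    (Q : forall n, F n -> R[i]) (s r : R) : 0 <= s -> 0 <= r ->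
  (forall n, approximable (T n)) -> (forall n, rnorm (T n) <= s * h ^+ n) ->
  (forall n, ideal_set (max_ideal alpha k) (Q n)) ->
  (forall n, ideal_norm (max_ideal alpha k) (Q n) <= r * h ^+ n) ->
  exists P : E -> R[i],
    [/\ forall x, (fun n => \sum_(i < n) Q i (T i x)) @ \oo --> P x,
        ideal_set (min_ideal alpha k) P &
        ideal_norm (min_ideal alpha k) P <= 2 * r * s ^+ k].
Proof.
move=> s0 r0 Ta Ts Qm Qr.
have [|U [Ua US UT]] := approximable_glue Ta Ts (S := s)
  (fun n => ler_piMr s0 (half_pow_le (leq0n n))).
  apply/cvgrPdist_lt => e e0; have [N HN] := half_pow_small s0 e0.
  exists N => // n Nn /=; rewrite sub0r normrN ger0_norm; first exact: HN.
  by rewrite mulr_ge0// ltW// half_pow_gt0.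
pose H n : dsum F -> R[i] := fun y => \sum_(i < n) Q i (dsum_proj F i y).
have pm n := max_norm_comp aU (dsum_proj F n) (Qm n).
have pq n : ideal_norm (max_ideal alpha k) (Q n \o dsum_proj F n) <= r * h ^+ n.
  rewrite (le_trans (pm n).2)// (le_trans _ (Qr n))// ler_piMr ?(max_norm_ge0 aU)//.
  by rewrite exprn_ile1 ?rnorm_ge0 ?dsum_proj_rnorm.
have Hd m d : ideal_set (max_ideal alpha k) (H (m + d)%N - H m) /\
    ideal_norm (max_ideal alpha k) (H (m + d)%N - H m) <= 2 * r * (h ^+ m - h ^+ (m + d)).
  elim: d => [|d [IH1 IH2]].
    by rewrite addn0 !subrr mulr0; exact: (max0 aU).
  have [h1 h2] := max_lin aU 1 (pm (m + d)%N).1 IH1.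
  have E1 : H (m + d.+1)%N - H m =
      1 *: (Q (m + d)%N \o dsum_proj F (m + d)%N) + (H (m + d)%N - H m).
    apply/funext => y; rewrite scale1r addnS -[LHS]/(H (m + d).+1 y - H m y).
    rewrite -[RHS]/(Q (m + d)%N (dsum_proj F (m + d)%N y) + (H (m + d)%N y - H m y)).
    by rewrite {1}/H big_ord_recr addrA; congr (_ - _); exact: addrC.
  rewrite E1; split=> //; apply: (le_trans h2); rewrite rnorm1 mul1r.
  apply: (le_trans (lerD (pq _) IH2)); rewrite addnS exprSr.
  by rewrite le_eqVlt; apply/orP; left; apply/eqP; rewrite /h; field.
have H0 : H 0%N = 0 by apply/funext => y; rewrite /H big_ord0.
have Hm n : ideal_set (max_ideal alpha k) (H n) /\
    ideal_norm (max_ideal alpha k) (H n) <= 2 * r.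
  have [h1 h2] := Hd 0%N n; rewrite H0 subr0 add0n expr0 in h1 h2.
  split=> //; apply: (le_trans h2); rewrite ler_piMr ?mulr_ge0//.
  by rewrite gerBl ltW// half_pow_gt0.
have Hc (e : R) : 0 < e -> exists N, forall m n, (N <= m)%N -> (N <= n)%N ->
    ideal_norm (max_ideal alpha k) (H m - H n) < e.
  move=> e0; have [|N HN] := @half_pow_small (4 * r) e _ e0; first by rewrite mulr_ge0.
  have HN' m : (N <= m)%N -> ideal_set (max_ideal alpha k) (H m - H N) /\
      ideal_norm (max_ideal alpha k) (H m - H N) <= 2 * r * h ^+ N.
    move=> /subnKC <-; have [h1 h2] := Hd N (m - N)%N; split=> //.
    apply: (le_trans h2); rewrite ler_wpM2l ?mulr_ge0// gerBl.
    by rewrite ltW// half_pow_gt0.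
  exists N => m n Nm Nn; have [m1 m2] := HN' m Nm; have [n1 n2] := HN' n Nn.
  have [_] := max_lin aU (-1) n1 m1.
  rewrite scaleN1r opprB addrC addrA subrK rnormN rnorm1 mul1r => h3.
  apply: (le_lt_trans h3); apply: le_lt_trans (HN N (leqnn N)).
  by apply: (le_trans (lerD n2 m2)); lra.
have [Q0 Q0m HQ0] := max_norm_complete aU (fun n => (Hm n).1) Hc.
have Q0r : ideal_norm (max_ideal alpha k) Q0 <= 2 * r.
  apply/ler_addgt0Pr => e e0; move/cvgrPdist_lt : HQ0 => /(_ _ e0)[N _ HN].
  have := HN N (leqnn N); rewrite /= sub0r normrN => /(le_lt_trans (ler_norm _))/ltW h1.
  have [_] := max_lin aU (-1) (max_sub aU (Hm N).1 Q0m) (Hm N).1.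
  rewrite scaleN1r opprB subrK rnormN rnorm1 mul1r => /le_trans; apply.
  by rewrite addrC lerD// (Hm N).2.
exists (Q0 \o U); split.
- move=> x; apply/cvg_rnormP => e e0.
  have c0 : 0 < rnorm (U x) ^+ k + 1 by rewrite ltr_wpDl ?exprn_ge0 ?rnorm_ge0.
  move/cvgrPdist_lt : HQ0 => /(_ _ (divr_gt0 e0 c0))[N _ HN]; exists N => // n Nn /=.
  have := HN n Nn; rewrite /= sub0r normrN => /(le_lt_trans (ler_norm _)).
  rewrite ltr_pdivlMr// => h1; apply: le_lt_trans h1.
  have HE : \sum_(i < n) Q i (T i x) = H n (U x).
    by apply: eq_bigr => i _; rewrite UT.
  have Hmn := max_sub aU (Hm n).1 Q0m.
  rewrite HE rnormB (le_trans (max_norm_eval aU (U x) Hmn))//.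
  by rewrite ler_wpM2l ?lerDl// (max_norm_ge0 aU).
- exact: (min_norm_le aU Ua Q0m US Q0r).1.
- exact: (min_norm_le aU Ua Q0m US Q0r).2.
Qed.

Lemma min_sub k E (P Q : E -> R[i]) : (0 < k)%N ->
  ideal_set (min_ideal alpha k) P -> ideal_set (min_ideal alpha k) Q ->
  ideal_set (min_ideal alpha k) (P - Q).
Proof.
move=> k0 Pm Qm; have [h1 _] := min_lin aU (-1) k0 Qm Pm.
by rewrite scaleN1r addrC in h1.
Qed.

Record factorization E := Factorization {
  middle : completeNormedModType R[i] ;
  fac_op : blin E middle ;
  fac_poly : middle -> R[i] }.

(** The differences of a rapidly convergent subsequence are a series to which
    [min_series] applies, and so is each of its tails, with smaller bounds. *)
Lemma min_norm_complete k E (u : nat -> E -> R[i]) : (0 < k)%N ->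
  (forall n, ideal_set (min_ideal alpha k) (u n)) ->
  (forall e : R, 0 < e -> exists N, forall m n, (N <= m)%N -> (N <= n)%N ->
     ideal_norm (min_ideal alpha k) (u m - u n) < e) ->
  exists2 P : E -> R[i], ideal_set (min_ideal alpha k) P &
    (fun n => ideal_norm (min_ideal alpha k) (u n - P)) @ \oo --> (0 : R).
Proof.
(* Differences below this bound factor with both norms at most h^j. *)
move=> k0 um uc; pose d j : R := h ^+ j * (h ^+ j) ^+ k.
have d0 j : 0 < d j by rewrite mulr_gt0 ?half_pow_gt0// exprn_gt0 ?half_pow_gt0.
have /choice[f0 f0P] : forall j, exists N, forall m n, (N <= m)%N -> (N <= n)%N ->
    ideal_norm (min_ideal alpha k) (u m - u n) < d j.
  by move=> j; exact: uc.
(* Sums make the sequence of indices nondecreasing. *)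
pose f j := (\sum_(i < j.+1) f0 i)%N.
have ff0 j : (f0 j <= f j)%N by rewrite /f big_ord_recr/= leq_addl.
have fS j : (f j <= f j.+1)%N by rewrite /f [leqRHS]big_ord_recr/= leq_addr.
have fd j : ideal_norm (min_ideal alpha k) (u (f j.+1) - u (f j)) < d j.
  by apply: f0P; rewrite ?(leq_trans _ (fS j)).
have /choice[c cP] : forall j, exists c : factorization E,
    [/\ approximable (fac_op c), ideal_set (max_ideal alpha k) (@fac_poly _ c),
        u (f j.+1) - u (f j) = @fac_poly _ c \o fac_op c, rnorm (fac_op c) <= h ^+ j &
        ideal_norm (max_ideal alpha k) (@fac_poly _ c) <= h ^+ j].
  move=> j; have [F [T [Q HTQ]]] := min_factor aU k0 (half_pow_gt0 j) (half_pow_gt0 j)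
    (min_sub k0 (um (f j.+1)) (um (f j))) (fd j).
  by exists (Factorization T Q).
have /choice[L LP] : forall j, exists P : E -> R[i],
    [/\ forall x, (fun n => u (f (j + n)%N) x - u (f j) x) @ \oo --> P x,
        ideal_set (min_ideal alpha k) P &
        ideal_norm (min_ideal alpha k) P <= 2 * h ^+ j].
  move=> j; have hj := ltW (half_pow_gt0 j).
  have [||||P [P1 P2 P3]] := @min_series k E (fun n => middle (c (j + n)%N))
    (fun n => fac_op (c (j + n)%N)) (fun n => @fac_poly _ (c (j + n)%N)) _ _ hj hj.
  - by move=> n; have [] := cP (j + n)%N.
  - by move=> n; rewrite -exprD; have [] := cP (j + n)%N.
  - by move=> n; have [] := cP (j + n)%N.
  - by move=> n; rewrite -exprD; have [] := cP (j + n)%N.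
  exists P; split=> // [x|].
    rewrite (_ : (fun n => _) =
        (fun n => \sum_(i < n) @fac_poly _ (c (j + i)%N) (fac_op (c (j + i)%N) x))) //.
    apply/funext => n; elim: n => [|n IH]; first by rewrite addn0 subrr big_ord0.
    rewrite big_ord_recr/= -IH addnS; have [_ _ cE _ _] := cP (j + n)%N.
    have -> : @fac_poly _ (c (j + n)%N) (fac_op (c (j + n)%N) x) =
        u (f (j + n).+1) x - u (f (j + n)%N) x.
      by rewrite -[RHS]/((u (f (j + n).+1) - u (f (j + n)%N)) x) cE.
    by rewrite addrC addrA subrK.
  apply: (le_trans P3); rewrite ler_piMr ?mulr_ge0// exprn_ile1//.
  exact: (half_pow_le (leq0n j)).
pose P : E -> R[i] := u (f 0%N) + L 0%N.
have PL j : P - u (f j) = L j.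
  apply/funext => x; have [L0 _ _] := LP 0%N; have [Lj _ _] := LP j.
  apply: (cvg_unique (@norm_hausdorff _ R[i]) _ (Lj x)).
  have {}L0 := L0 x; rewrite -(cvg_shiftn j) in L0.
  rewrite -[(P - u (f j)) x]/(u (f 0%N) x + L 0%N x - u (f j) x).
  rewrite (_ : (fun n => u (f (j + n)%N) x - u (f j) x) =
    (fun n => u (f 0%N) x + (u (f (0 + (n + j))%N) x - u (f 0%N) x) - u (f j) x)); last first.
    by apply/funext => n; rewrite add0n (addnC n j) subrKC.
  apply: cvgB; last exact: cvg_cst.
  by apply: cvgD; [exact: cvg_cst|exact: L0].
have Pm : ideal_set (min_ideal alpha k) P.
  have [h1 _] := min_lin aU 1 k0 (um (f 0%N)) (let: And3 _ L0 _ := LP 0%N in L0).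
  by rewrite scale1r in h1.
exists P => //; apply/cvgrPdist_lt => e e0.
(* ||P - u (f N)|| is at most 2 h^N, and ||u n - u (f N)|| at most h^N. *)
have [N HN] := @half_pow_small 3 e (ler0n _ 3) e0.
exists (f N) => // n Nn /=; have dm := min_sub k0 (um n) Pm.
rewrite sub0r normrN ger0_norm ?(min_norm_ge0 aU dm)//.
have [_ L1 L2] := LP N.
have [_] := min_lin aU (-1) k0 L1 (min_sub k0 (um n) (um (f N))).
rewrite -{1}PL scaleN1r opprB addrC addrA subrK rnormN rnorm1 mul1r => h1.
apply: (le_lt_trans h1); apply: le_lt_trans (HN N (leqnn N)).
have h2 : ideal_norm (min_ideal alpha k) (u n - u (f N)) < d N.
  by apply: f0P; rewrite ?(leq_trans _ Nn).
have h3 : d N <= h ^+ N.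
  rewrite ler_piMr ?(ltW (half_pow_gt0 N))// exprn_ile1 ?(ltW (half_pow_gt0 N))//.
  exact: (half_pow_le (leq0n N)).
by lra.
Qed.

Lemma min_banach k E : (0 < k)%N -> banach_subspace
  (ideal_set (min_ideal alpha k) (E := E)) (ideal_norm (min_ideal alpha k) (E := E)).
Proof.
move=> k0.
have [z1 z2] : ideal_set (min_ideal alpha k) (0 : E -> R[i]) /\
    ideal_norm (min_ideal alpha k) (0 : E -> R[i]) <= 0.
  have [h1 h2] := max0 aU k E.
  have := min_norm_le aU (finite_rank_approximable (@finite_rank0 R E E)) h1 (lexx _) h2.
  by rewrite mul0r.
have Zle (a : R[i]) (P : E -> R[i]) : ideal_set (min_ideal alpha k) P ->
    ideal_set (min_ideal alpha k) (a *: P) /\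
    ideal_norm (min_ideal alpha k) (a *: P) <= rnorm a * ideal_norm (min_ideal alpha k) P.
  move=> Pm; have := min_lin aU a k0 Pm z1.
  rewrite addr0 => -[h3 h4]; split=> //; apply: le_trans h4 _.
  by rewrite gerDl.
split.
- exact: z1.
- by move=> a P Q Pm Qm; exact: (min_lin aU a k0 Pm Qm).1.
- move=> P Q Pm Qm; have [_] := min_lin aU 1 k0 Pm Qm.
  by rewrite scale1r rnorm1 mul1r.
- move=> a P Pm; apply/eqP; rewrite eq_le (Zle a P Pm).2/=.
  have [->|a0] := eqVneq a 0.
    by rewrite rnorm0 mul0r (min_norm_ge0 aU)//; exact: (Zle 0 P Pm).1.
  have na0 : 0 < rnorm a.
    by rewrite lt_def rnorm_ge0 andbT; apply: contra_neq a0 => /rnorm0_eq0.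
  rewrite -ler_pdivlMl// -rnormV.
  have := (Zle a^-1 (a *: P) (Zle a P Pm).1).2.
  by rewrite scalerA mulVf// scale1r.
- move=> P Pm P0; apply/funext => x; apply: rnorm0_eq0; apply/eqP.
  by rewrite eq_le rnorm_ge0 andbT (le_trans (min_norm_eval aU x Pm))// P0 mul0r.
- by move=> u; exact: min_norm_complete.
Qed.

Lemma min_banach_ideal k : (0 < k)%N -> banach_ideal k (min_ideal alpha k).
Proof.
move=> k0; split.
- move=> E P [_ [F [T [Q [_ Qm -> _]]]]]; exact: polynomials_comp Qm.1.
- by move=> E; exact: min_banach.
- by move=> E1 E T P; exact: min_norm_comp.
- exact: min_power.
Qed.

Lemma min_multiplicative : multiplicative_sequence (min_ideal alpha).
Proof.
split.
  split=> [k k0|]; first exact: min_banach_ideal.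
  exists (expR 1), (expR 1); split; rewrite ?expR_gt0// => E k k0; split=> [P a Pm|P g Pm].
    exact: min_norm_contract.
  have [g1 g2] := min_functional aU g.
  have [h1 h2] := min_norm_prod aU (ltn0Sn 0) k0 g1 Pm; split; first exact: h1.
  apply: (le_trans h2); rewrite /growth eqxx ler_wpM2r ?(min_norm_ge0 aU)//.
  by rewrite ler_wpM2l ?expR_ge0.
exists (expR 1) => k l k0 l0 E P Q Pm Qm.
have [h1 h2] := min_norm_prod aU k0 l0 Pm Qm; split=> //; apply: (le_trans h2).
rewrite ler_wpM2r ?(min_norm_ge0 aU)// ler_wpM2r ?(min_norm_ge0 aU)//.
exact: growth_le.
Qed.

End MinimalComplete.

Theorem theorem2p10 (R : realType) (alpha : tensor_norms R)
    (alpha_natural : natural_sequence alpha) :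
  multiplicative_sequence (max_ideal alpha) /\
  multiplicative_sequence (min_ideal alpha).
Proof.
have aU := natural_uniform alpha_natural.
by split; [exact: max_multiplicative|exact: min_multiplicative].
Qed.
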